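(* Let $d\ge 2$. As $\lambda\to\infty$, the random compact sets $S_d\,\lambda\, I^\lambda$ converge in distribution, with respect to the Hausdorff metric $d_H$ on closed subsets of $\mathbb{R}^d$, to the random set $2D_0^1$. That is, $\lim_{\lambda\to\infty} S_d\lambda I^\lambda \sim 2C$, where $C$ is the law of $D_0^1$.
   Context: $\mathbb{B}$ is the closed unit ball in $\mathbb{R}^d$, $\mathbb{S}=\partial\mathbb{B}$ the unit sphere, $\omega_d$ the volume of $\mathbb{B}$ and $S_d=d\omega_d$ the surface area of $\mathbb{S}$. For $a>0$ and a set $A$, $aA=\{ax:x\in A\}$. Boolean intersection model: let $\mathcal{C}_\lambda$ be a Poisson point process on $\mathbb{B}$ with intensity $\lambda$ times Lebesgue measure, and $I^\lambda=\mathbb{B}\cap\bigcap_{c\in\mathcal{C}_\lambda}(c+\mathbb{B})$ (with $I^\lambda=\mathbb{B}$ if $\mathcal{C}_\lambda=\emptyset$). Poisson hyperplane tessellation: let $\{R_n\}$ be a Poisson point process of intensity $1$ on $\mathbb{R}$ and $\theta_n$ i.i.d. uniform on $\mathbb{S}$, independent of $\{R_n\}$; let $H_n=\{x\in\mathbb{R}^d: x\cdot\theta_n=R_n\}$. $D_0^1$ is the closure of the connected component of $\mathbb{R}^d\setminus\bigcup_n H_n$ containing the origin (the Crofton cell). Hausdorff distance: $d_H(X,Y)=\max\{\sup_{x\in X}\inf_{y\in Y}\|x-y\|,\sup_{y\in Y}\inf_{x\in X}\|x-y\|\}$. *)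

(* Defs.v *)
From HB Require Import structures.
From mathcomp Require Import all_boot all_order all_algebra.
From mathcomp Require Import all_classical all_reals all_analysis.
Set Implicit Arguments. Unset Strict Implicit. Unset Printing Implicit Defensive.
Import Order.TTheory GRing.Theory Num.Theory.
Import numFieldNormedType.Exports.
Local Open Scope classical_set_scope.
Local Open Scope ring_scope.
Local Open Scope card_scope.

Section Defs.
Context {R : realType} {d : nat}.
Local Notation V := 'rV[R]_d.

(* Euclidean inner product and norm on R^d (the library norm on 'rV is the sup norm). *)
Definition dotp (x y : V) : R := \sum_(i < d) x ord0 i * y ord0 i.
Definition enorm (x : V) : R := Num.sqrt (dotp x x).

Definition Ball : set V := [set x | enorm x <= 1].
Definition Sphere : set V := [set x | enorm x = 1].

Definition scale (a : R) (A : set V) : set V := [set a *: x | x in A].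

Definition borel (A : set V) : Prop := <<s [set: V], [set U : set V | open U] >> A.

Definition box (a b : V) : set V := [set x | forall i, a ord0 i <= x ord0 i <= b ord0 i].
Definition boxvol (a b : V) : R := \prod_(i < d) Num.max 0 (b ord0 i - a ord0 i).
Definition vol (A : set V) : \bar R :=
  ereal_inf [set s | exists a b : nat -> V,
    A `<=` \bigcup_k box (a k) (b k) /\
    s = (\sum_(0 <= k <oo) (boxvol (a k) (b k))%:E)%E].

Definition omega : R := fine (vol Ball).
Definition Sd : R := d%:R * omega.

(* uniform distribution on the sphere: normalized surface measure,
   sigma(A) = d * vol(cone over A), so sigma(A)/S_d = vol(cone A)/omega_d *)
Definition cone (A : set V) : set V :=
  [set y | exists t x, 0 <= t <= 1 /\ A x /\ Sphere x /\ y = t *: x].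
Definition unifS (A : set V) : R := fine (vol (cone A)) / omega.

(* Poisson probability mass function (valid also for mean 0) *)
Definition pois (m : R) (k : nat) : R := m ^+ k / k`!%:R * expR (- m).

Definition count_is (C A : set V) (n : nat) : Prop := (C `&` A) #= `I_n.

Definition ppp_ball dT (T : measurableType dT) (P : probability T R)
    (lam : R) (C : T -> set V) : Prop :=
  (forall A n, borel A -> measurable [set w | count_is (C w) A n]) /\
  forall (k : nat) (A : nat -> set V) (n : nat -> nat),
    (forall i, (i < k)%N -> borel (A i)) ->
    (forall i j, (i < k)%N -> (j < k)%N -> i <> j -> A i `&` A j = set0) ->
    P (\bigcap_(i in `I_k) [set w | count_is (C w) (A i) (n i)]) =
    (\prod_(i < k) pois (lam * fine (vol (A i `&` Ball))) (n i))%:E.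

Definition Iset (C : set V) : set V :=
  [set x | Ball x /\ forall c, C c -> Ball (x - c)].

Definition hyperplane_model dT (T : measurableType dT) (P : probability T R)
    (Rn : nat -> T -> R) (th : nat -> T -> V) : Prop :=
  (forall n, measurable_fun setT (Rn n)) /\
  (forall n A, borel A -> measurable (th n @^-1` A)) /\
  (forall (k : nat) (A : nat -> set R) (n : nat -> nat),
    (forall i, (i < k)%N -> measurable (A i) /\ bounded_set (A i)) ->
    (forall i j, (i < k)%N -> (j < k)%N -> i <> j -> A i `&` A j = set0) ->
    P (\bigcap_(i in `I_k) [set w | [set m | A i (Rn m w)] #= `I_(n i)]) =
    (\prod_(i < k) pois (fine (lebesgue_measure (A i))) (n i))%:E) /\
  (forall (m : nat) (B : nat -> set R) (k : nat) (A : nat -> set V),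
    (forall j, (j < m)%N -> measurable (B j)) ->
    (forall i, (i < k)%N -> borel (A i)) ->
    P (\bigcap_(j in `I_m) [set w | B j (Rn j w)] `&`
       \bigcap_(i in `I_k) [set w | A i (th i w)]) =
    (P (\bigcap_(j in `I_m) [set w | B j (Rn j w)]) *
     (\prod_(i < k) unifS (A i))%:E)%E).

Definition hyperplane (r : R) (t : V) : set V := [set x | dotp x t = r].
Definition crofton (Rn : nat -> R) (th : nat -> V) : set V :=
  closure (connected_component (~` \bigcup_n hyperplane (Rn n) (th n)) 0).

Definition dH (X Y : set V) : \bar R :=
  maxe (ereal_sup [set ereal_inf [set (enorm (x - y))%:E | y in Y] | x in X])
       (ereal_sup [set ereal_inf [set (enorm (x - y))%:E | x in X] | y in Y]).

Definition dH_bounded_continuous (f : set V -> R) : Prop :=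
  (exists M : R, forall X, closed X -> `|f X| <= M) /\
  (forall X, closed X -> forall e : R, 0 < e -> exists2 delta : R, 0 < delta &
     forall Y, closed Y -> (dH X Y < delta%:E)%E -> `|f X - f Y| < e).

Definition cvg_dist_dH dT (T : measurableType dT) (P : R -> probability T R)
    (X : R -> T -> set V) dT' (T' : measurableType dT') (Q : probability T' R)
    (Y : T' -> set V) : Prop :=
  forall f : set V -> R, dH_bounded_continuous f ->
    (\int[P lam]_w (f (X lam w))%:E)%E @[lam --> +oo] -->
    (\int[Q]_w (f (Y w))%:E)%E.

End Defs.

(* Main.v *)
Require Import Defs.
From HB Require Import structures.
From mathcomp Require Import all_boot all_order all_algebra.
From mathcomp Require Import all_classical all_reals all_analysis.
From mathcomp Require Import measurable_realfun ring lra.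
Import Order.TTheory GRing.Theory Num.Theory.
Local Open Scope classical_set_scope.
Local Open Scope ring_scope.

(** The dilation [S_d lam] and the factor 2 are calibrated by the same count. A spherical shell of
    thickness [s delta] carries on average about [lam omega d s delta = delta] Poisson points, hence
    the weight [delta G]. A hyperplane excludes [x] from the doubled cell when [x . v > 2 |r|], so
    the radii are cut into slabs of length [delta / 2], and a positive slab together with its mirror
    image contributes [delta G] again. The two sums are compared at one fixed [delta]: each
    probability is enclosed between exponentials of sums with shifted arguments, and as [G] has
    values in [0, 1], the shifted sums telescope to within [3 delta]. On the Hausdorff side the
    obstacle is that [f (X w)] is not known to be measurable. Only the trace on a finite grid is an
    honest random variable, and all integrals are bounded through it. *)

(** Convergence in law of random closed convex sets is reduced to convergence of
    the probabilities that the set contains a given finite set of points. The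
    trace of a convex set on a fine and large finite grid takes finitely many
    values, so its law converges; and if [Y] is bounded, convex and has [0] in its
    interior, every convex set with the same trace as [Y] is Hausdorff-close to
    [Y]. Hence [f] is squeezed between two functions of the trace whose difference
    vanishes along almost every realization of [Y], without any compactness or
    tightness argument.

    With [s = 1 / (S_d lam)], the set [S_d lam I] contains the finite set [xs] iff
    no Poisson point [c] satisfies [1 < |s x - c|] for some [x] in [xs]. Writing
    [c = - (1 - s tau) v] with [v] on the sphere, this condition is [tau < x . v]
    up to an error of order [s], so the probability is close to
    [exp (- sum_j delta G(j delta))], where [G t] is the uniform measure of the
    cap [{v | exists x in xs, t < x . v}]. For the Crofton cell the same sum comes
    out of the void probabilities of the marked process [(R_n, theta_n)].

    The Lebesgue measure on the ball needs no construction: its additivity is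
    read off the void probabilities of the Poisson process. *)

Set Implicit Arguments. Unset Strict Implicit. Unset Printing Implicit Defensive.

(** * Euclidean geometry and Borel sets *)

Section EuclideanSpace.
Import numFieldNormedType.Exports.
Context {R : realType} {d : nat}.
Local Notation V := 'rV[R]_d.
Implicit Types (x y c v : V) (t : R).

Lemma dotpC x y : dotp x y = dotp y x.
Proof. by apply: eq_bigr => i _; rewrite mulrC. Qed.

Lemma dotpDl x y c : dotp (x + y) c = dotp x c + dotp y c.
Proof. by rewrite -big_split /=; apply: eq_bigr => i _; rewrite mxE mulrDl. Qed.

Lemma dotpZl t x c : dotp (t *: x) c = t * dotp x c.
Proof. by rewrite mulr_sumr; apply: eq_bigr => i _; rewrite mxE mulrA. Qed.

Lemma dotpNl x c : dotp (- x) c = - dotp x c.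
Proof. by rewrite -scaleN1r dotpZl mulN1r. Qed.

Lemma dotpZr t x c : dotp c (t *: x) = t * dotp c x.
Proof. by rewrite dotpC dotpZl dotpC. Qed.

Lemma dotpDr x y c : dotp c (x + y) = dotp c x + dotp c y.
Proof. by rewrite dotpC dotpDl !(dotpC c). Qed.

Lemma dotpNr x c : dotp c (- x) = - dotp c x.
Proof. by rewrite dotpC dotpNl dotpC. Qed.

Lemma dotp0l c : dotp 0 c = 0 :> R.
Proof. by rewrite -(scale0r c) dotpZl mul0r. Qed.

Lemma dotp_ge0 x : 0 <= dotp x x.
Proof. by apply: sumr_ge0 => i _; rewrite -expr2 sqr_ge0. Qed.

Lemma enorm_ge0 x : 0 <= enorm x.
Proof. exact: sqrtr_ge0. Qed.

Lemma enorm_sqr x : enorm x ^+ 2 = dotp x x.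
Proof. by rewrite sqr_sqrtr// dotp_ge0. Qed.

Lemma enormZ t x : enorm (t *: x) = `|t| * enorm x.
Proof.
by rewrite /enorm dotpZl dotpZr mulrA -expr2 sqrtrM ?sqr_ge0// sqrtr_sqr.
Qed.

Lemma enorm0 : enorm (0 : V) = 0.
Proof. by rewrite /enorm dotp0l sqrtr0. Qed.

Lemma enormN x : enorm (- x) = enorm x.
Proof. by rewrite -scaleN1r enormZ normrN1 mul1r. Qed.

Lemma enorm_le1 x : (enorm x <= 1) = (dotp x x <= 1).
Proof. by rewrite -enorm_sqr expr_le1// enorm_ge0. Qed.

Lemma coord_le_enorm x i : `|x ord0 i| <= enorm x.
Proof.
rewrite -(@ler_pXn2r _ 2)// ?nnegrE ?enorm_ge0//.
rewrite enorm_sqr real_normK ?num_real// expr2 /dotp (bigD1 i)//= lerDl.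
by apply: sumr_ge0 => j _; rewrite -expr2 sqr_ge0.
Qed.

(** Takes the place of the Euclidean norm of one factor in Cauchy-Schwarz; the bound
    [dotp_le_l1norm] is then coordinatewise, and the loss in the constant is harmless. *)
Definition l1norm x : R := \sum_i `|x ord0 i|.

Lemma l1norm_ge0 x : 0 <= l1norm x.
Proof. exact: sumr_ge0. Qed.

Lemma dotp_le_l1norm x c : `|dotp x c| <= l1norm x * enorm c.
Proof.
rewrite (le_trans (ler_norm_sum _ _ _))// mulr_suml ler_sum// => i _.
by rewrite normrM ler_wpM2l// coord_le_enorm.
Qed.

Lemma enorm_le_l1norm x : enorm x <= l1norm x.
Proof.
have := dotp_le_l1norm x x; rewrite -enorm_sqr ger0_norm ?sqr_ge0// expr2.
have := enorm_ge0 x; rewrite le_eqVlt => /predU1P[<- _|x0]; first exact: l1norm_ge0.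
by rewrite ler_pM2r.
Qed.

Lemma coord_le_norm x i : `|x ord0 i| <= `|x|.
Proof.
rewrite [leRHS]/Num.norm/= mx_normrE.
exact: (le_bigmax _ (fun ij : 'I_1 * 'I_d => `|x ij.1 ij.2|) (ord0, i)).
Qed.

Lemma normr_le_coord x t : 0 <= t -> (forall i, `|x ord0 i| <= t) -> `|x| <= t.
Proof.
move=> t0 xt; rewrite [leLHS]/Num.norm/= mx_normrE.
by apply: bigmax_le => // -[i j] _ /=; rewrite ord1.
Qed.

Lemma l1norm_le_norm x : l1norm x <= d%:R * `|x|.
Proof.
rewrite /l1norm (le_trans (ler_sum _ (fun i _ => coord_le_norm x i)))//.
by rewrite sumr_const card_ord mulr_natl.
Qed.

Lemma enorm_le_norm x : enorm x <= d%:R * `|x|.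
Proof. exact: le_trans (enorm_le_l1norm x) (l1norm_le_norm x). Qed.

Lemma continuous_bigsum (T : topologicalType) (I : Type) (r : seq I) (F : I -> T -> R) :
  (forall i, continuous (F i)) -> continuous (fun p => \sum_(i <- r) F i p).
Proof.
move=> Fc; elim: r => [|i r IH].
  rewrite (_ : (fun _ => _) = cst 0); first by move=> ?; exact: cvg_cst.
  by apply/funext => p; rewrite big_nil.
rewrite (_ : (fun _ => _) = F i \+ (fun p => \sum_(i <- r) F i p)).
  by move=> p; apply: cvgD; [exact: Fc|exact: IH].
by apply/funext => p; rewrite big_cons.
Qed.

Lemma continuous_dotp c : continuous (fun x => dotp c x).
Proof.
apply: (@continuous_bigsum V _ _ (fun i x => c ord0 i * x ord0 i)) => i x.
by apply: continuousM; [exact: cst_continuous|exact: coord_continuous].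
Qed.

Lemma continuous_enorm : continuous (@enorm R d).
Proof.
move=> x; apply: (@continuous_comp _ _ _ (fun x => dotp x x) Num.sqrt).
  apply: (@continuous_bigsum V _ _ (fun i x => x ord0 i * x ord0 i)) => i y.
  by apply: continuousM; exact: coord_continuous.
exact: sqrt_continuous.
Qed.

Lemma open_ltfun (T : topologicalType) (f g : T -> R) :
  continuous f -> continuous g -> open [set p | f p < g p].
Proof.
move=> fc gc; rewrite (_ : mkset _ = (fun p => g p - f p) @^-1` [set t | 0 < t]).
  apply: open_comp => [p _|]; last exact: open_gt.
  by apply: cvgB; [exact: gc|exact: fc].
by apply/seteqP; split => p /=; rewrite subr_gt0.
Qed.

Lemma closed_lefun (T : topologicalType) (f g : T -> R) :
  continuous f -> continuous g -> closed [set p | f p <= g p].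
Proof.
move=> fc gc; rewrite (_ : mkset _ = ~` [set p | g p < f p]).
  by apply: open_closedC; exact: open_ltfun.
by apply/seteqP; split => p /=; rewrite leNgt => /negP.
Qed.

End EuclideanSpace.

Section Borel.
Import numFieldNormedType.Exports.
Context {R : realType} {d : nat}.
Local Notation V := 'rV[R]_d.
Implicit Types A B : set V.
Local Notation VB := (g_sigma_algebraType [set U : set V | open U]).

Lemma borel_open A : open A -> borel A.
Proof. exact: sub_sigma_algebra. Qed.

Lemma borelC A : borel A -> borel (~` A).
Proof. exact: (@measurableC _ VB). Qed.

Lemma borel_closed A : closed A -> borel A.
Proof. by move=> Ac; rewrite -(setCK A); apply: borelC; apply: borel_open; apply: closed_openC. Qed.

Lemma borelI A B : borel A -> borel B -> borel (A `&` B).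
Proof. exact: (@measurableI _ VB). Qed.

Lemma borelU A B : borel A -> borel B -> borel (A `|` B).
Proof. exact: (@measurableU _ VB). Qed.

Lemma borelD A B : borel A -> borel B -> borel (A `\` B).
Proof. exact: (@measurableD _ VB). Qed.

Lemma borelT : borel [set: V].
Proof. exact: (@measurableT _ VB). Qed.

Lemma borel_forall (I : finType) (F : I -> set V) : (forall i, borel (F i)) ->
  borel [set v | forall i, F i v].
Proof.
move=> bF; have := @fin_bigcap_measurable _ (g_sigma_algebraType [set U : set V | open U])
  I setT F finite_finset (fun i _ => bF i).
rewrite (_ : \bigcap_(i in _) _ = [set v | forall i, F i v])//.
by apply/seteqP; split => v H i; [exact: H|move=> _; exact: H].
Qed.

Lemma borel1 (x : V) : borel [set x].
Proof.
apply: borel_closed; apply: accessible_closed_set1.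
by apply: hausdorff_accessible; exact: norm_hausdorff.
Qed.

Lemma closed_Ball : closed (@Ball R d).
Proof.
apply: (@closed_lefun R _ (@enorm R d) (cst 1)) => ?; [exact: continuous_enorm|exact: cst_continuous].
Qed.

Lemma borel_Ball : borel (@Ball R d).
Proof. exact: (borel_closed closed_Ball). Qed.

Lemma borel_Sphere : borel (@Sphere R d).
Proof.
rewrite (_ : Sphere = Ball `\` [set x | enorm x < 1]).
  apply: borelD borel_Ball (borel_open _).
  apply: (@open_ltfun R _ (@enorm R d) (cst 1)) => ?; [exact: continuous_enorm|exact: cst_continuous].
rewrite /Sphere /Ball; apply/seteqP; split => x /=.
  by move=> ->; rewrite ltxx.
by move=> [x1 /negP]; rewrite -leNgt => x1'; apply/eqP; rewrite eq_le x1.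
Qed.

End Borel.

(** * Volume *)

Section Volume.
Import numFieldNormedType.Exports.
Context {R : realType} {d : nat}.
Local Notation V := 'rV[R]_d.
Implicit Types (A B K : set V) (a x : V) (t : R).

Lemma boxvol_ge0 a x : 0 <= boxvol a x.
Proof. by apply: prodr_ge0 => i _; rewrite le_max lexx. Qed.

Lemma vol_ge0 A : (0 <= vol A)%E.
Proof.
apply: le_ereal_inf_tmp => _ [a [b [_ ->]]].
by apply: nneseries_ge0 => k _ _; rewrite lee_fin boxvol_ge0.
Qed.

Lemma le_vol A B : A `<=` B -> (vol A <= vol B)%E.
Proof.
move=> AB; apply: ereal_inf_le_tmp => _ [a [b [Bab ->]]].
by exists a, b; split => //; exact: subset_trans Bab.
Qed.

(** Diagonal linear maps send boxes to boxes, so they act on the coverings that define [vol]. They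
    supply both dilations and coordinate reflections. *)
Definition hadamard a x : V := \row_i (a ord0 i * x ord0 i).

Definition unit_coords a := forall i, a ord0 i != 0.

Lemma vol_hadamard_le a A : unit_coords a ->
  (vol (hadamard a @` A) <= (\prod_i `|a ord0 i|)%:E * vol A)%E.
Proof.
move=> a0; have pa0 : 0 < \prod_i `|a ord0 i|.
  by apply: prodr_gt0 => i _; rewrite normr_gt0.
rewrite -lee_pdivrMl//; apply: le_ereal_inf_tmp => _ [l [u [Alu ->]]].
rewrite lee_pdivrMl//; apply: ereal_inf_lbound.
(* The two endpoints of a side are exchanged in the coordinates where [a] is negative. *)
pose l' k : V := \row_i (if 0 < a ord0 i then a ord0 i * l k ord0 i
                         else a ord0 i * u k ord0 i).
pose u' k : V := \row_i (if 0 < a ord0 i then a ord0 i * u k ord0 i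
                         else a ord0 i * l k ord0 i).
exists l', u'; split.
  move=> _ [x /Alu [k _ xk] <-]; exists k => // i; rewrite !mxE.
  have /andP[lx xu] := xk i.
  case: ifPn => [ai|]; first by rewrite !ler_pM2l ?lx.
  rewrite -leNgt le_eqVlt (negbTE (a0 i)) /= => ai.
  by rewrite !ler_nM2l ?lx ?xu.
rewrite -nneseriesZl; last by move=> k _; rewrite lee_fin boxvol_ge0.
apply: eq_eseriesr => k _; rewrite -EFinM; congr (_%:E).
rewrite /boxvol -big_split /=; apply: eq_bigr => i _; rewrite !mxE.
case: ifPn => [ai|].
  by rewrite (gtr0_norm ai) maxr_pMr ?ltW// mulr0 mulrBr.
rewrite -leNgt le_eqVlt (negbTE (a0 i)) /= => ai.
by rewrite (ltr0_norm ai) maxr_pMr ?oppr_ge0 ?ltW// mulr0; congr Num.max; ring.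
Qed.

Lemma hadamardK a : unit_coords a ->
  cancel (hadamard a) (hadamard (\row_i (a ord0 i)^-1)).
Proof. by move=> a0 x; apply/rowP => i; rewrite !mxE mulKf. Qed.

(** The reverse inequality is [vol_hadamard_le] for the inverse diagonal map. *)
Lemma vol_hadamard a A : unit_coords a ->
  vol (hadamard a @` A) = ((\prod_i `|a ord0 i|)%:E * vol A)%E.
Proof.
move=> a0; apply/eqP; rewrite eq_le vol_hadamard_le//=.
have pa0 : 0 < \prod_i `|a ord0 i|.
  by apply: prodr_gt0 => i _; rewrite normr_gt0.
rewrite -lee_pdivlMl//.
have {1}-> : A = hadamard (\row_i (a ord0 i)^-1) @` (hadamard a @` A).
  rewrite image_comp; apply/seteqP; split => [x Ax|_ [x Ax <-]].
    by exists x => //=; rewrite hadamardK.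
  by rewrite /= hadamardK.
rewrite (le_trans (vol_hadamard_le _ _))//.
  by move=> i; rewrite mxE invr_eq0.
apply: lee_wpmul2r; first exact: vol_ge0.
rewrite lee_fin -prodfV; apply: ler_prod => i _.
by rewrite mxE normfV lexx invr_ge0 normr_ge0.
Qed.

Lemma hadamard_const t x : hadamard (const_mx t) x = t *: x.
Proof. by apply/rowP => i; rewrite !mxE. Qed.

Lemma vol_scale t A : 0 < t -> vol (scale t A) = ((t ^+ d)%:E * vol A)%E.
Proof.
move=> t0; rewrite (_ : scale t A = hadamard (const_mx t) @` A).
  rewrite vol_hadamard => [|i]; last by rewrite mxE gt_eqF.
  under eq_bigr do rewrite mxE (gtr0_norm t0).
  by rewrite prodr_const card_ord.
by apply: eq_imagel => x _; rewrite hadamard_const.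
Qed.

Definition sign_vector a := forall i, `|a ord0 i| = 1.


Lemma hadamard_signK a : sign_vector a -> involutive (hadamard a).
Proof.
move=> a1 x; apply/rowP => i; rewrite !mxE mulrA -expr2.
by rewrite -real_normK ?num_real// a1 expr1n mul1r.
Qed.

Lemma dotp_hadamard a x y : dotp x (hadamard a y) = dotp (hadamard a x) y.
Proof. by apply: eq_bigr => i _; rewrite !mxE mulrCA mulrA. Qed.

Lemma enorm_hadamard a x : sign_vector a -> enorm (hadamard a x) = enorm x.
Proof. by move=> a1; rewrite /enorm dotp_hadamard hadamard_signK. Qed.

Lemma hadamardZ t a x : hadamard a (t *: x) = t *: hadamard a x.
Proof. by apply/rowP => i; rewrite !mxE mulrCA. Qed.

Lemma vol_sign a A : sign_vector a -> vol (hadamard a @^-1` A) = vol A.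
Proof.
move=> a1; rewrite (_ : _ @^-1` A = hadamard a @` A).
  rewrite vol_hadamard => [|i]; last by rewrite -normr_eq0 a1 oner_eq0.
  by rewrite big1 ?mul1e// => i _; rewrite a1.
apply/seteqP; split => [x Ax|_ [x Ax <-]] /=; last by rewrite hadamard_signK.
by exists (hadamard a x) => //; rewrite hadamard_signK.
Qed.

(** Reflections preserve the sphere and commute with forming cones. This serves the antipodal
    symmetry [capN] and gives all open orthants equal mass. *)
Lemma unifS_sign a A : sign_vector a -> unifS (hadamard a @^-1` A) = unifS A.
Proof.
move=> a1; rewrite /unifS -(vol_sign (cone A) a1); congr (fine (vol _) / _).
rewrite /cone /Sphere; apply/seteqP; split => [_ [t [x [t01 [Ax [Sx ->]]]]]|y /=].
  exists t, (hadamard a x); rewrite t01 hadamardZ; do 3!split => //.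
  by rewrite /= enorm_hadamard.
move=> [t [x [t01 [Ax [Sx yE]]]]]; exists t, (hadamard a x).
rewrite /= hadamard_signK// t01 -hadamardZ -yE hadamard_signK//.
by do 3!split => //; rewrite enorm_hadamard.
Qed.

(** A single flat box, repeated, is a covering of total volume 0. A coordinate [i] must exist: for
    [d = 0] every box has volume 1, and even the empty set would have infinite volume. *)
Lemma vol_coord_hyperplane i A : A `<=` Ball -> (forall x, A x -> x ord0 i = 0) ->
  vol A = 0%E.
Proof.
move=> AB A0; apply/eqP; rewrite eq_le vol_ge0 andbT.
pose b t : V := \row_j (if j == i then 0 else t).
apply: ereal_inf_lbound; exists (fun=> b (-1)), (fun=> b 1); split.
  move=> x Ax; exists 0%N => // j; rewrite !mxE; case: eqVneq => [->|_].
    by rewrite A0// lexx.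
  by rewrite -ler_norml (le_trans (coord_le_enorm x j))//; exact: AB.
apply/esym/eseries0 => k _ _; rewrite /boxvol (bigD1 i)//= !mxE eqxx.
by rewrite subrr maxxx mul0r.
Qed.

End Volume.

(** * Void probabilities and volumes of conical shells *)

Section PoissonBall.
Import numFieldNormedType.Exports.
Context {R : realType} {d : nat}.
Local Notation V := 'rV[R]_d.
Implicit Types (A B K : set V) (x c : V) (t : R).

Definition ballvol A : R := fine (vol (A `&` Ball)).

Lemma count_is0 (C A : set V) : count_is C A 0 <-> C `&` A = set0.
Proof. by rewrite /count_is II0 card_eq0; split => /eqP. Qed.

Context dT (T : measurableType dT) (P : probability T R) (lam : R) (C : T -> set V).
Hypotheses (lam_gt0 : 0 < lam) (pppC : ppp_ball P lam C).

Lemma measurable_void A : borel A -> measurable [set w | C w `&` A = set0].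
Proof.
move=> bA; rewrite (_ : mkset _ = [set w | count_is (C w) A 0]).
  by case: pppC => + _; apply.
by apply/seteqP; split => w /= /count_is0.
Qed.

Lemma void_prob_disjoint (k : nat) (A : nat -> set V) :
  (forall i, (i < k)%N -> borel (A i)) ->
  (forall i j, (i < k)%N -> (j < k)%N -> i <> j -> A i `&` A j = set0) ->
  P (\bigcap_(i in `I_k) [set w | C w `&` A i = set0]) =
  (expR (- (lam * \sum_(i < k) ballvol (A i))))%:E.
Proof.
move=> bA dA; case: pppC => _ /(_ k A (fun=> 0%N) bA dA) pE.
rewrite (eq_bigcapr (G := fun i => [set w | count_is (C w) (A i) 0])); last first.
  by move=> i _; apply/seteqP; split => w /= /count_is0.
rewrite pE mulr_sumr -sumrN expR_sum; congr (_%:E).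
by apply: eq_bigr => i _; rewrite /pois expr0 fact0 divr1 mul1r.
Qed.

Lemma void_prob A : borel A ->
  P [set w | C w `&` A = set0] = (expR (- (lam * ballvol A)))%:E.
Proof.
move=> bA; have pE := @void_prob_disjoint 1 (fun=> A) (fun _ _ => bA).
rewrite (_ : ballvol A = \sum_(i < 1) ballvol A); last by rewrite big_ord1.
rewrite -pE; last by move=> [|?] [|?].
by congr (P _); apply/seteqP; split => w /= h; [move=> ? _|exact: (h 0%N)].
Qed.

(* Both sides are read off the probability that [C] misses [A `|` B]. *)
Lemma ballvolU A B : borel A -> borel B -> A `&` B = set0 ->
  ballvol (A `|` B) = ballvol A + ballvol B.
Proof.
move=> bA bB AB; pose F i := if i is 0%N then A else B.
have := @void_prob_disjoint 2 F.
rewrite big_ord_recl big_ord1 /=.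
have -> : \bigcap_(i in `I_2) [set w | C w `&` F i = set0] =
          [set w | C w `&` (A `|` B) = set0].
  apply/seteqP; split => w /=.
    by move=> h; rewrite setIUr (h 0%N)// (h 1%N)// setU0.
  rewrite setIUr => h i i2; apply/seteqP; split => // x Fx.
  have : (C w `&` A `|` C w `&` B) x by case: i i2 Fx => [_|i _]; [left|right].
  by rewrite h.
rewrite void_prob; last exact: borelU.
move=> voidE.
have F1 i : (i < 2)%N -> borel (F i) by case: i => [|[|?]].
have F2 i j : (i < 2)%N -> (j < 2)%N -> i <> j -> F i `&` F j = set0.
  by move: i j => [|[|?]] [|[|?]]//= _ _ _; rewrite setIC.
apply: (mulfI (lt0r_neq0 lam_gt0)); apply: oppr_inj; apply: expR_inj.
exact: (congr1 fine (voidE F1 F2)).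
Qed.

Lemma ballvolD A B : borel A -> borel B -> A `<=` B ->
  ballvol (B `\` A) = ballvol B - ballvol A.
Proof.
move=> bA bB AB; apply/esym/eqP; rewrite subr_eq -ballvolU//.
- by rewrite setUC setDUK.
- exact: borelD.
- by rewrite setIC setDIK.
Qed.

Hypotheses (d_gt0 : (0 < d)%N) (vol_Ball : vol (@Ball R d) = (@omega R d)%:E)
  (omega_gt0 : 0 < @omega R d).

Lemma vol_fin A : A `<=` Ball -> vol A \is a fin_num.
Proof.
move=> /le_vol AB; rewrite ge0_fin_numE ?vol_ge0//.
by rewrite (le_lt_trans AB)// vol_Ball ltry.
Qed.

Definition annulus (a b : R) : set V := [set x | a < enorm x <= b].

Lemma borel_annulus a b : borel (annulus a b).
Proof.
rewrite (_ : annulus a b = [set x | a < enorm x] `\` [set x | b < enorm x]).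
  by apply: borelD; apply: borel_open;
    [apply: (@open_ltfun R _ (cst a) (@enorm R d))|
     apply: (@open_ltfun R _ (cst b) (@enorm R d))] => ?;
    (exact: cst_continuous || exact: continuous_enorm).
apply/seteqP; split => x; first by move=> /andP[ax xb]; split => //=; rewrite ltNge xb.
by move=> [/= ax /negP]; rewrite -leNgt /annulus /= ax.
Qed.

Definition homogeneous K := forall t x, 0 < t -> K x -> K (t *: x).

(** The cone over [K] and the part of [K] in the punctured ball differ at most by the origin, which
    has volume 0. *)
Lemma ballvol_annulus1 K : borel K -> homogeneous K ->
  ballvol (K `&` annulus 0 1) = @omega R d * unifS K.
Proof.
move=> bK hK; have K1B : K `&` annulus 0 1 `<=` Ball by move=> x [_ /andP[]].
rewrite /unifS mulrCA divff ?gt_eqF// mulr1 /ballvol (setIidl K1B).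
have coneB : cone K `<=` Ball.
  move=> _ [t [x [/andP[t0 t1] [_ [Sx ->]]]]].
  by rewrite /Ball /= enormZ Sx mulr1 ger0_norm.
apply/eqP; rewrite eq_le; apply/andP; split.
  apply: fine_le; rewrite ?vol_fin//; apply: le_vol => x [Kx /andP[x0 x1]].
  exists (enorm x), ((enorm x)^-1 *: x); rewrite x1 enorm_ge0; split => //.
  split; first by apply: hK => //; rewrite invr_gt0.
  rewrite /Sphere /= enormZ normfV ger0_norm ?enorm_ge0// mulVf ?gt_eqF//.
  by rewrite scalerA divff ?gt_eqF// scale1r.
(* The origin is added by the additivity [ballvolU], since [vol] itself is only an outer measure;
   afterwards the cone is included in the set. *)
have -> : fine (vol (K `&` annulus 0 1)) = ballvol ((K `&` annulus 0 1) `|` [set 0]).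
  rewrite ballvolU; last 3 first.
  - by apply: borelI => //; exact: borel_annulus.
  - exact: borel1.
  - by apply/seteqP; split => // x [[_ /andP[+ _]] /= x0]; rewrite x0 enorm0 ltxx.
  have -> : ballvol [set 0] = 0.
    rewrite /ballvol (@vol_coord_hyperplane _ _ (Ordinal d_gt0))//.
    by move=> x [-> _]; rewrite mxE.
  by rewrite addr0 /ballvol (setIidl K1B).
apply: fine_le; rewrite ?vol_fin//.
apply: le_vol => _ [t [x [/andP[t0 t1] [Kx [Sx ->]]]]]; split; last first.
  by rewrite /Ball /= enormZ Sx mulr1 ger0_norm.
move: t0; rewrite le_eqVlt => /predU1P[<-|t0]; first by right; rewrite scale0r.
left; split; first exact: hK.
by rewrite /annulus /= enormZ Sx mulr1 gtr0_norm ?t0.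
Qed.

Lemma ballvol_annulus0 K t : borel K -> homogeneous K -> 0 <= t <= 1 ->
  ballvol (K `&` annulus 0 t) = t ^+ d * (@omega R d * unifS K).
Proof.
move=> bK hK /andP[]; rewrite le_eqVlt => /predU1P[<- _|t0 t1].
  rewrite expr0n gtn_eqF// mul0r /ballvol.
  rewrite (@vol_coord_hyperplane _ _ (Ordinal d_gt0))//.
  by move=> x [[_ /andP[a /(lt_le_trans a)]]]; rewrite ltxx.
rewrite -ballvol_annulus1// /ballvol (_ : _ `&` Ball = scale t (K `&` annulus 0 1 `&` Ball)).
  by rewrite vol_scale// fineM// vol_fin//; exact: subIsetr.
apply/seteqP; split => [x [[Kx /andP[x0 xt]] Bx]|_ [x [[Kx /andP[x0 x1]] Bx] <-]].
  exists (t^-1 *: x); last by rewrite scalerA divff ?scale1r ?gt_eqF.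
  have xt1 : enorm (t^-1 *: x) = enorm x / t.
    by rewrite enormZ ger0_norm ?invr_ge0 ?ltW// mulrC.
  have xt1' : enorm x / t <= 1 by rewrite ler_pdivrMr ?mul1r.
  split; last by rewrite /Ball /= xt1.
  split; first by apply: hK => //; rewrite invr_gt0.
  by rewrite /annulus /= xt1 divr_gt0.
have tx : enorm (t *: x) = t * enorm x by rewrite enormZ gtr0_norm.
split; last by rewrite /Ball /= tx mulr_ile1 ?enorm_ge0// ltW.
split; first exact: hK.
by rewrite /annulus /= tx mulr_gt0//= ger_pMr.
Qed.

Lemma ballvol_annulus K a b : borel K -> homogeneous K -> 0 <= a -> a <= b -> b <= 1 ->
  ballvol (K `&` annulus a b) = (b ^+ d - a ^+ d) * (@omega R d * unifS K).
Proof.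
move=> bK hK a0 ab b1; have aK : K `&` annulus 0 a `<=` K `&` annulus 0 b.
  move=> x [Kx /andP[x0 xa]]; split => //.
  by rewrite /annulus /= x0 (le_trans xa).
rewrite (_ : K `&` annulus a b = (K `&` annulus 0 b) `\` (K `&` annulus 0 a)).
  rewrite ballvolD//; try by apply: borelI => //; exact: borel_annulus.
  rewrite !ballvol_annulus0//; first by rewrite mulrBl.
    by rewrite a0 (le_trans ab).
  by rewrite (le_trans a0).
apply/seteqP; split => x.
  move=> [Kx /andP[ax xb]]; split; first split => //.
    by rewrite /annulus /= xb (le_lt_trans a0).
  by move=> [_ /andP[_]]; rewrite leNgt ax.
move=> [[Kx /andP[x0 xb]] nK]; split => //; rewrite /annulus /= xb andbT ltNge.
by apply/negP => xa; apply: nK; split => //; rewrite /annulus /= x0.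
Qed.

End PoissonBall.

(** * Shells and caps *)

Section PowerBounds.
Context {R : realType}.
Implicit Types (a b : R) (d : nat).

Lemma subXn_le a b d : 0 <= a -> a <= b -> b <= 1 -> b ^+ d - a ^+ d <= d%:R * (b - a).
Proof.
move=> a0 ab b1; have b0 := le_trans a0 ab; elim: d => [|d IH].
  by rewrite !expr0 subrr mul0r.
rewrite (_ : _ - _ = b * (b ^+ d - a ^+ d) + a ^+ d * (b - a)); last first.
  by rewrite !exprS; ring.
rewrite -natr1 mulrDl mul1r lerD//.
  by rewrite (le_trans _ IH)// ler_piMl// subr_ge0 lerXn2r ?nnegrE.
by rewrite ler_piMl ?subr_ge0// exprn_ile1// (le_trans ab).
Qed.

(** The mean value theorem would give the exponent [d - 1]; the weaker [a ^+ d] keeps the induction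
    uniform, and it is close to 1 as soon as [a] is. *)
Lemma subXn_ge a b d : 0 <= a -> a <= b -> b <= 1 ->
  d%:R * a ^+ d * (b - a) <= b ^+ d - a ^+ d.
Proof.
move=> a0 ab b1; have b0 := le_trans a0 ab; elim: d => [|d IH].
  by rewrite !expr0 subrr !mul0r.
rewrite [leRHS](_ : _ - _ = b * (b ^+ d - a ^+ d) + a ^+ d * (b - a)); last first.
  by rewrite !exprS; ring.
have ad0 : 0 <= a ^+ d by rewrite exprn_ge0.
have ba0 : 0 <= b - a by rewrite subr_ge0.
rewrite -natr1 !mulrDl mul1r lerD//.
  rewrite exprS (_ : _ * _ * _ = a * (d%:R * a ^+ d * (b - a))); last by ring.
  by rewrite ler_pM// !mulr_ge0.
by rewrite ler_wpM2r// exprS ler_piMl// (le_trans ab).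
Qed.

End PowerBounds.

Section Caps.
Import numFieldNormedType.Exports.
Context {R : realType} {d : nat}.
Local Notation V := 'rV[R]_d.
Implicit Types (x c : V) (t s : R) (xs : seq V).

(** The union of the spherical caps [t < x . v], made invariant under positive dilations by the
    factor [enorm v], as [ballvol_annulus] requires. *)
Definition capcone xs t : set V := [set v | exists2 x, x \in xs & t * enorm v < dotp x v].

Definition cap xs t : R := unifS (capcone xs t).

Definition total_l1norm xs : R := \sum_(x <- xs) l1norm x.

Lemma l1norm_le_total xs x : x \in xs -> l1norm x <= total_l1norm xs.
Proof.
move=> xxs; rewrite /total_l1norm (big_rem x)//= lerDl.
by apply: sumr_ge0 => y _; exact: l1norm_ge0.
Qed.

Lemma total_l1norm_ge0 xs : 0 <= total_l1norm xs.
Proof. by apply: sumr_ge0 => y _; exact: l1norm_ge0. Qed.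

Lemma open_exists_seq xs (U : V -> set V) : (forall x, open (U x)) ->
  open [set v | exists2 x, x \in xs & U x v].
Proof.
move=> oU; rewrite (_ : mkset _ = \bigcup_(x in [set` xs]) U x).
  by apply: bigcup_open => x _.
by apply/seteqP; split => v [x xxs Uxv]; exists x.
Qed.

Lemma open_capcone xs t : open (capcone xs t).
Proof.
apply: open_exists_seq => x.
apply: (@open_ltfun R V (fun v => t * enorm v) (dotp x)) => v.
  by apply: continuousM; [exact: cst_continuous|exact: continuous_enorm].
exact: continuous_dotp.
Qed.

Lemma borel_capcone xs t : borel (capcone xs t).
Proof. exact: (@borel_open R d _ (@open_capcone xs t)). Qed.

Lemma homogeneous_capcone xs t : homogeneous (capcone xs t).
Proof.
move=> r v r0 [x xxs xv]; exists x => //.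
by rewrite enormZ dotpZr gtr0_norm// mulrCA ltr_pM2l.
Qed.

Lemma capN xs t : cap (map -%R xs) t = cap xs t.
Proof.
have sg : sign_vector (const_mx (-1) : V) by move=> i; rewrite mxE normrN1.
rewrite /cap -(unifS_sign (capcone xs t) sg); congr unifS.
apply/seteqP; split => v; rewrite /= hadamard_const scaleN1r.
  move=> [_ /mapP[x xxs ->] xv]; exists x => //.
  by rewrite enormN dotpNr -dotpNl.
move=> [x xxs]; rewrite enormN dotpNr -dotpNl => xv; exists (- x) => //.
by apply/mapP; exists x.
Qed.

Definition exceed xs s : set V := [set c | exists2 x, x \in xs & 1 < enorm (s *: x - c)].

Lemma open_exceed xs s : open (exceed xs s).
Proof.
apply: open_exists_seq => x.
apply: (@open_ltfun R V (cst 1) (fun c => enorm (s *: x - c))) => c.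
  exact: cst_continuous.
apply: (@continuous_comp _ _ _ (fun c => s *: x - c) (@enorm R d)).
  by apply: continuousB; [exact: cst_continuous|move=> ?; exact: cvg_id].
exact: continuous_enorm.
Qed.

Lemma borel_exceed xs s : borel (exceed xs s).
Proof. exact: (@borel_open R d _ (@open_exceed xs s)). Qed.

Lemma enormB_gt1 s x c :
  (1 < enorm (s *: x - c)) =
  (1 < s ^+ 2 * dotp x x + 2 * s * dotp (- x) c + enorm c ^+ 2).
Proof.
rewrite -[in LHS](@ltr_pXn2r _ 2)// ?nnegrE ?enorm_ge0// expr1n !enorm_sqr.
congr (1 < _).
rewrite !(dotpDl, dotpDr, dotpNl, dotpNr, dotpZl, dotpZr) (dotpC c x).
by ring.
Qed.

Lemma dotp_le_sqr_total xs x : x \in xs -> dotp x x <= total_l1norm xs ^+ 2.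
Proof.
move=> /l1norm_le_total xL; rewrite -enorm_sqr ler_pXn2r ?nnegrE ?enorm_ge0//.
  by rewrite (le_trans (enorm_le_l1norm x)).
exact: total_l1norm_ge0.
Qed.

(** From [|s x - c| <= s L + |c|]. Excluding centers thus lie at depth less than [s L] below the
    sphere, so finitely many shells cover those in the ball. *)
Lemma exceed_lt_total xs s c : 0 < s -> exceed xs s c ->
  1 - enorm c < s * total_l1norm xs.
Proof.
move=> s0 [x xxs]; rewrite enormB_gt1 => h.
set L := total_l1norm xs; have L0 : 0 <= L := total_l1norm_ge0 xs.
have xL := dotp_le_sqr_total xxs.
have pL : dotp (- x) c <= L * enorm c.
  rewrite (le_trans (ler_norm _))// (le_trans (dotp_le_l1norm _ _))//.
  rewrite ler_wpM2r ?enorm_ge0// (le_trans _ (l1norm_le_total xxs))//.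
  by apply: ler_sum => i _; rewrite mxE normrN.
have : 1 < (s * L + enorm c) ^+ 2.
  rewrite (lt_le_trans h)// [leRHS](_ : _ = s ^+ 2 * L ^+ 2 + 2 * s * (L * enorm c) + enorm c ^+ 2); last by ring.
  by rewrite lerD2r lerD ?ler_wpM2l ?sqr_ge0// mulr_ge0// ltW.
rewrite -{1}(expr1n _ 2) ltr_pXn2r ?nnegrE ?addr_ge0 ?mulr_ge0 ?enorm_ge0 ?(ltW s0)//.
by lra.
Qed.

Section Shell.
(** The center [c] has depth [s tau]. Expanding the square and dividing by [s] turns [1 < |s x - c|]
    into [0 < 2 p - 2 tau + s tau^2 + s |x|^2] with [p = - x . c]. The hypotheses make the quadratic
    terms at most [delta], and [s tau <= 1 / 2] controls the factor [enorm c = 1 - s tau] in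
    [capcone]. *)
Variables (xs : seq V) (s tau delta T : R) (c : V).
Hypotheses (s_gt0 : 0 < s) (delta_gt0 : 0 < delta) (cE : enorm c = 1 - s * tau)
  (tau_ge0 : 0 <= tau) (tauT : tau <= T) (sT : s * T <= 1 / 2)
  (sL : s * total_l1norm xs ^+ 2 <= delta) (sT2 : s * T ^+ 2 <= delta).

Lemma exceed_sub_capcone t : t <= tau - delta -> exceed xs s c ->
  capcone (map -%R xs) t c.
Proof.
move=> tE [x xxs]; rewrite enormB_gt1 => h; exists (- x).
  by apply/mapP; exists x.
rewrite (le_lt_trans (ler_wpM2r (enorm_ge0 c) tE))//.
have xL := dotp_le_sqr_total xxs.
set q := dotp x x in h xL; set p := dotp (- x) c in h *.
have sq : s * q <= delta by rewrite (le_trans _ sL)// ler_wpM2l// ltW.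
have st : s * tau <= 1 / 2 by rewrite (le_trans _ sT)// ler_wpM2l// ltW.
have st0 : 0 <= s * tau by rewrite mulr_ge0// ltW.
move: h; rewrite cE => h.
have : 0 < s * (2 * p - 2 * tau + s * tau ^+ 2 + s * q) by nra.
rewrite pmulr_rgt0// => h2.
have : delta * (s * tau) <= delta * (1 / 2) by rewrite ler_wpM2l// ltW.
have : 0 <= s * tau ^+ 2 by rewrite mulr_ge0 ?sqr_ge0// ltW.
rewrite (_ : (tau - delta) * (1 - s * tau) = tau - delta - s * tau ^+ 2 + delta * (s * tau)); last by ring.
by lra.
Qed.

Lemma capcone_sub_exceed t : tau + delta <= t -> capcone (map -%R xs) t c ->
  exceed xs s c.
Proof.
move=> tE [_ /mapP[x xxs ->] h]; exists x => //; rewrite enormB_gt1.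
have {}h := le_lt_trans (ler_wpM2r (enorm_ge0 c) tE) h.
have q0 := dotp_ge0 x.
set q := dotp x x in q0 *; set p := dotp (- x) c in h *.
have st : s * tau <= 1 / 2 by rewrite (le_trans _ sT)// ler_wpM2l// ltW.
have st0 : 0 <= s * tau by rewrite mulr_ge0// ltW.
have st2 : s * tau ^+ 2 <= delta.
  rewrite (le_trans _ sT2)// ler_wpM2l ?(ltW s_gt0)//.
  by rewrite ler_pXn2r// nnegrE// (le_trans tau_ge0).
move: h; rewrite cE => h.
have h2 : 0 < 2 * p - 2 * tau + s * tau ^+ 2.
  have : delta * (s * tau) <= delta * (1 / 2) by rewrite ler_wpM2l// ltW.
  move: h; rewrite (_ : (tau + delta) * (1 - s * tau) = tau + delta - s * tau ^+ 2 - delta * (s * tau)); last by ring.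
  by lra.
have : 0 < s * (2 * p - 2 * tau + s * tau ^+ 2) by rewrite mulr_gt0.
have : 0 <= s ^+ 2 * q by rewrite mulr_ge0 ?sqr_ge0.
by nra.
Qed.

End Shell.

End Caps.

(** * Void probability of the excluding centers, shell by shell *)

Section ShellDecomposition.
Import numFieldNormedType.Exports.
Context {R : realType} {d : nat}.
Local Notation V := 'rV[R]_d.
Context dT (T : measurableType dT) (P : probability T R) (lam : R) (C : T -> set V).
Hypotheses (lam_gt0 : 0 < lam) (pppC : ppp_ball P lam C).
Hypotheses (d_gt0 : (0 < d)%N) (vol_Ball : vol (@Ball R d) = (@omega R d)%:E)
  (omega_gt0 : 0 < @omega R d).
Variables (xs : seq V) (m : nat) (delta : R).
Local Notation s := ((@Sd R d * lam)^-1).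
Local Notation tmax := (m%:R * delta).
Hypotheses (delta_gt0 : 0 < delta) (Lt : total_l1norm xs <= tmax)
  (st : s * tmax <= 1 / 2) (sL2 : s * total_l1norm xs ^+ 2 <= delta)
  (st2 : s * tmax ^+ 2 <= delta) (dst : d%:R * (s * tmax) <= delta)
  (cap_ge0 : forall t, 0 <= cap xs t).

(** The threshold [t] is left free: low thresholds make the shells cover the excluding centers, high
    ones place the shells among them. The points are negated because the center is
    [- (1 - s tau) v]. *)
Definition shell (t : nat -> R) (j : nat) : set V :=
  capcone (map -%R xs) (t j) `&`
  annulus (1 - s * (j.+1%:R * delta)) (1 - s * (j%:R * delta)).

Lemma Sd_gt0 : 0 < @Sd R d.
Proof. by rewrite mulr_gt0// ltr0n. Qed.

Lemma scale_gt0 : 0 < s.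
Proof. by rewrite invr_gt0 mulr_gt0// Sd_gt0. Qed.

Lemma borel_shell t j : borel (shell t j).
Proof. by apply: borelI; [exact: borel_capcone|exact: borel_annulus]. Qed.

Lemma shell_disjoint t i j : i <> j -> shell t i `&` shell t j = set0.
Proof.
have H k l : (k < l)%N -> shell t k `&` shell t l = set0.
  move=> kl; apply/seteqP; split => // c [[_ /andP[ck _]] [_ /andP[_ cl]]].
  have : s * (k.+1%:R * delta) <= s * (l%:R * delta).
    by rewrite ler_pM2l ?scale_gt0// ler_pM2r// ler_nat.
  by move: ck cl; lra.
by move=> /eqP; rewrite neq_ltn => /orP[/H//|/H]; rewrite setIC.
Qed.

Lemma shell_bounds j : (j < m)%N ->
  [/\ 0 <= 1 - s * (j.+1%:R * delta),
      1 - s * (j.+1%:R * delta) <= 1 - s * (j%:R * delta),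
      1 - s * (j%:R * delta) <= 1,
      1 - s * (j%:R * delta) - (1 - s * (j.+1%:R * delta)) = s * delta &
      d%:R * (s * (j.+1%:R * delta)) <= delta].
Proof.
move=> jm; have s0 := scale_gt0.
have jt : s * (j.+1%:R * delta) <= s * tmax.
  by rewrite ler_pM2l// ler_pM2r// ler_nat.
have jj : s * (j%:R * delta) <= s * (j.+1%:R * delta).
  by rewrite ler_pM2l// ler_pM2r// ler_nat.
have j0 : 0 <= s * (j%:R * delta) by rewrite !mulr_ge0// ltW.
split; [by move: st; lra|by lra|by lra| |].
- by rewrite -natr1; ring.
- by rewrite (le_trans _ dst)// ler_wpM2l.
Qed.

Lemma lam_ballvol_shell t j : (j < m)%N ->
  (1 - delta) * delta * cap xs (t j) <= lam * ballvol (shell t j) <= delta * cap xs (t j).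
Proof.
move=> /shell_bounds[a0 ab b1 baE da].
set a := 1 - s * (j.+1%:R * delta) in a0 ab baE da *.
set b := 1 - s * (j%:R * delta) in ab b1 baE *.
have s0 := scale_gt0.
rewrite (ballvol_annulus lam_gt0 pppC d_gt0 vol_Ball omega_gt0)//; last 2 first.
- exact: borel_capcone.
- exact: homogeneous_capcone.
rewrite -/(cap _ _) capN.
(* This is where the choice [s = 1 / (S_d lam)] enters: a shell of thickness [s delta] gets weight
   [delta]. *)
have lE : lam * @omega R d * (d%:R * s) = 1.
  by rewrite /Sd; field; rewrite ?gt_eqF ?ltr0n.
have lo0 : 0 < lam * @omega R d by rewrite mulr_gt0.
have lower := subXn_ge d a0 ab b1; have upper := subXn_le d a0 ab b1.
have a1 : a <= 1 by rewrite (le_trans ab).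
(* Bernoulli's inequality [1 - a^d <= d (1 - a) <= delta]: the lower bound loses only a factor
   [1 - delta]. *)
have ad := subXn_le d a0 a1 (lexx 1).
rewrite expr1n in ad; rewrite baE in lower upper.
have ad1 : 1 - delta <= a ^+ d.
  by move: ad da; rewrite (_ : 1 - a = s * (j.+1%:R * delta)) /a; [lra|ring].
rewrite (_ : lam * _ = lam * @omega R d * (b ^+ d - a ^+ d) * cap xs (t j)); last by ring.
apply/andP; split; apply: ler_wpM2r => //.
- apply: (@le_trans _ _ (lam * @omega R d * (d%:R * a ^+ d * (s * delta)))); last first.
    by rewrite ler_pM2l.
  rewrite [leRHS](_ : _ = lam * @omega R d * (d%:R * s) * (a ^+ d * delta)); last by ring.
  by rewrite lE mul1r ler_pM2r.
- apply: (@le_trans _ _ (lam * @omega R d * (d%:R * (s * delta)))).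
    by rewrite ler_pM2l.
  rewrite [leLHS](_ : _ = lam * @omega R d * (d%:R * s) * delta); last by ring.
  by rewrite lE mul1r.
Qed.

(** A center at scaled depth in [[j delta, (j + 1) delta)] that excludes a point lies in the capcone
    with threshold [(j - 1) delta], by [exceed_sub_capcone]. Missing all these shells therefore
    forces missing [exceed]. *)
Lemma void_exceed_ge :
  expR (- (delta * \sum_(j < m) cap xs (j%:R * delta - delta))) <=
  fine (P [set w | C w `&` exceed xs s = set0]).
Proof.
have s0 := scale_gt0.
pose t (j : nat) := j%:R * delta - delta.
(* [ppp_ball] puts the points in the ball only almost surely, so the complement of the ball is added
   as cell [m], with mean 0. *)
pose A i := if (i < m)%N then shell t i else ~` Ball.
have bA i : borel (A i).
  by rewrite /A; case: ifP => _; [exact: borel_shell|exact: (borelC borel_Ball)].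
have AB i : (i < m)%N -> A i `<=` Ball.
  move=> im; rewrite /A im => c [_ /andP[_ cb]].
  by have [_ _ b1 _ _] := shell_bounds im; exact: le_trans cb b1.
have dA i j : (i < m.+1)%N -> (j < m.+1)%N -> i <> j -> A i `&` A j = set0.
  have aux k : (k < m)%N -> A k `&` A m = set0.
    move=> km; apply/seteqP; split => // c [/(AB _ km) cB].
    by rewrite /A ltnn.
  rewrite !ltnS (leq_eqVlt i) (leq_eqVlt j) => /predU1P[->|im] /predU1P[->|jm] ij //.
  - by rewrite setIC aux.
  - by rewrite aux.
  - by rewrite /A im jm shell_disjoint.
have Am : A m = ~` Ball by rewrite /A ltnn.
have := void_prob_disjoint pppC (k := m.+1) (fun i _ => bA i) dA.
rewrite big_ord_recr /= Am.
rewrite [ballvol (~` _)](_ : _ = 0); last first.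
  by rewrite /ballvol setICl (@vol_coord_hyperplane _ _ (Ordinal d_gt0)).
rewrite addr0 => pE.
apply: (@le_trans _ _ (fine (P (\bigcap_(i in `I_m.+1) [set w | C w `&` A i = set0])))).
  rewrite pE /= ler_expR lerN2 !mulr_sumr; apply: ler_sum => j _.
  by rewrite /A ltn_ord; have /andP[] := lam_ballvol_shell t (ltn_ord j).
have mI : measurable (\bigcap_(i in `I_m.+1) [set w | C w `&` A i = set0]).
  by apply: bigcap_measurableType => i _; exact: (measurable_void pppC).
have mE : measurable [set w | C w `&` exceed xs s = set0].
  exact: (measurable_void pppC (@borel_exceed R d xs s)).
apply: fine_le; rewrite ?fin_num_measure//.
apply: le_measure; rewrite ?inE//.
move=> w voidA /=; apply/seteqP; split => // c [Cc ce].
have cB : enorm c <= 1.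
  rewrite leNgt; apply/negP => c1.
  have : (C w `&` A m) c.
    by rewrite Am; split => //; rewrite /Ball /= leNgt c1.
  by rewrite (voidA m)/=.
have cL := exceed_lt_total s0 ce.
pose tau := (1 - enorm c) / s.
have cE : enorm c = 1 - s * tau by rewrite /tau mulrC divfK ?gt_eqF//; ring.
have tau0 : 0 <= tau by rewrite divr_ge0 ?subr_ge0// ltW.
have tauL : tau < total_l1norm xs by rewrite ltr_pdivrMr// mulrC.
pose j := Num.truncn (tau / delta).
have /andP[jl ju] : j%:R <= tau / delta < j.+1%:R.
  by apply: truncn_itv; rewrite divr_ge0// ltW.
rewrite ler_pdivlMr// in jl; rewrite ltr_pdivrMr// in ju.
have jm : (j < m)%N.
  rewrite -(ltr_nat R) -(ltr_pM2r delta_gt0) (le_lt_trans jl)//.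
  exact: lt_le_trans Lt.
have : (C w `&` A j) c.
  split => //; rewrite /A jm; split.
    apply: (exceed_sub_capcone s0 delta_gt0 cE tau0 _ st sL2) => //.
    - exact/ltW/(lt_le_trans tauL).
    - by rewrite /t; lra.
  by rewrite /annulus /= cE; apply/andP; split;
    rewrite ?ltrD2l ?lerD2l ?ltrN2 ?lerN2 ?ltr_pM2l ?ler_pM2l.
by rewrite (voidA j)//= ltnS ltnW.
Qed.

(** In the shell [j] the scaled depth is below [(j + 1) delta]; one more [delta], required by
    [capcone_sub_exceed], gives the threshold [(j + 2) delta] that places the shell inside
    [exceed]. *)
Lemma void_exceed_le :
  fine (P [set w | C w `&` exceed xs s = set0]) <=
  expR (- ((1 - delta) * delta * \sum_(j < m) cap xs (j%:R * delta + 2 * delta))).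
Proof.
have s0 := scale_gt0.
pose t (j : nat) := j%:R * delta + 2 * delta.
have pE := void_prob_disjoint pppC (k := m) (fun i _ => borel_shell t i)
  (fun i j _ _ => @shell_disjoint t i j).
apply: (@le_trans _ _ (fine (P (\bigcap_(i in `I_m) [set w | C w `&` shell t i = set0])))); last first.
  rewrite pE /= ler_expR lerN2 !mulr_sumr; apply: ler_sum => j _.
  by have /andP[] := lam_ballvol_shell t (ltn_ord j).
have mI : measurable (\bigcap_(i in `I_m) [set w | C w `&` shell t i = set0]).
  by apply: bigcap_measurableType => i _; apply: (measurable_void pppC); exact: borel_shell.
have mE : measurable [set w | C w `&` exceed xs s = set0].
  exact: (measurable_void pppC (@borel_exceed R d xs s)).
apply: fine_le; rewrite ?fin_num_measure//.
apply: le_measure; rewrite ?inE// => w voidE j /= jm.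
apply/seteqP; split => // c [Cc [cK /andP[ca cb]]].
suff : (C w `&` exceed xs s) c by rewrite voidE.
split => //; pose tau := (1 - enorm c) / s.
have cE : enorm c = 1 - s * tau by rewrite /tau mulrC divfK ?gt_eqF//; ring.
have tl : j%:R * delta <= tau by move: cb; rewrite cE lerD2l lerN2 ler_pM2l.
have tu : tau < j.+1%:R * delta by move: ca; rewrite cE ltrD2l ltrN2 ltr_pM2l.
apply: (capcone_sub_exceed s0 delta_gt0 cE _ _ st st2 _ cK).
- by rewrite (le_trans _ tl)// mulr_ge0// ltW.
- by rewrite (le_trans (ltW tu))// ler_pM2r// ler_nat.
- by move: tu; rewrite /t -natr1; lra.
Qed.

End ShellDecomposition.

(** * Finite probability calculus *)

Section FiniteProbability.
Import numFieldNormedType.Exports.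
Context {R : realType} dT (T : measurableType dT) (Q : probability T R).
Implicit Types A B : set T.

Definition pr A : R := fine (Q A).

Lemma prE A : measurable A -> Q A = (pr A)%:E.
Proof. by move=> mA; rewrite fineK// fin_num_measure. Qed.

Lemma pr_ge0 A : 0 <= pr A.
Proof. by rewrite fine_ge0. Qed.

Lemma pr_setT : pr setT = 1.
Proof. by rewrite /pr probability_setT. Qed.

Lemma pr_set0 : pr set0 = 0.
Proof. by rewrite /pr measure0. Qed.

Lemma le_pr A B : measurable A -> measurable B -> A `<=` B -> pr A <= pr B.
Proof.
by move=> mA mB AB; apply: fine_le; rewrite ?fin_num_measure// le_measure ?inE.
Qed.

Lemma pr_le1 A : measurable A -> pr A <= 1.
Proof. by move=> mA; rewrite -pr_setT le_pr. Qed.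

Lemma prU A B : measurable A -> measurable B -> A `&` B = set0 ->
  pr (A `|` B) = pr A + pr B.
Proof. by move=> mA mB AB; rewrite /pr measureU// fineD// fin_num_measure. Qed.

Lemma prID A B : measurable A -> measurable B -> pr A = pr (A `&` B) + pr (A `\` B).
Proof.
move=> mA mB; rewrite -prU ?setUIDK//; first exact: measurableI.
  exact: measurableD.
by rewrite setDE setIACA setICr setI0.
Qed.

Lemma prC A : measurable A -> pr (~` A) = 1 - pr A.
Proof. by move=> mA; rewrite -pr_setT (prID measurableT mA) setTI setTD; ring. Qed.

Lemma pr_bigcup_seq (I : eqType) (s : seq I) (F : I -> set T) : uniq s ->
  (forall i, measurable (F i)) -> (forall i j w, F i w -> F j w -> i = j) ->
  measurable [set w | exists2 i, i \in s & F i w] /\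
  pr [set w | exists2 i, i \in s & F i w] = \sum_(i <- s) pr (F i).
Proof.
move=> + mF dF; elim: s => [_|i s IH /= /andP[is_ us]].
  rewrite big_nil (_ : mkset _ = set0) ?pr_set0//.
  by apply/seteqP; split => // w [].
have [mU IH1] := IH us.
rewrite (_ : mkset _ = F i `|` [set w | exists2 j, j \in s & F j w]).
  split; first exact: measurableU.
  rewrite big_cons prU ?IH1//; apply/seteqP; split => // w [Fi [j js Fj]].
  by move: is_; rewrite (dF _ _ _ Fi Fj) js.
apply/seteqP; split => w.
  by move=> [j]; rewrite inE => /predU1P[->|js] Fj; [left|right; exists j].
move=> [Fi|[j js Fj]]; first by exists i; rewrite ?mem_head.
by exists j; rewrite // inE js orbT.
Qed.

Lemma pr_bigcup_fin (I : finType) (F : I -> set T) :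
  (forall i, measurable (F i)) -> (forall i j w, F i w -> F j w -> i = j) ->
  measurable [set w | exists i, F i w] /\
  pr [set w | exists i, F i w] = \sum_i pr (F i).
Proof.
move=> mF dF; have [] := pr_bigcup_seq (index_enum_uniq I) mF dF.
rewrite (_ : mkset _ = [set w | exists i, F i w])//.
by apply/seteqP; split => w [i]; exists i => //; exact: mem_index_enum.
Qed.

Lemma pr_fiber (I : finType) (W : T -> I) A : measurable A ->
  (forall i, measurable [set w | W w = i]) ->
  pr A = \sum_i pr (A `&` [set w | W w = i]).
Proof.
move=> mA mW; have [||_ <-] := @pr_bigcup_fin I (fun i => A `&` [set w | W w = i]).
- by move=> i; exact: measurableI.
- by move=> i j w [_ <-] [_ <-].
by congr pr; apply/seteqP; split => w; [exists (W w)|move=> [i []]].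
Qed.

Lemma measurable_finfun (I : finType) (W : T -> I) (S : pred I) :
  (forall i, measurable [set w | W w = i]) -> measurable [set w | S (W w)].
Proof.
move=> mW; have [||+ _] := @pr_bigcup_fin I (fun i => [set w | W w = i /\ S i]).
- move=> i; case: (boolP (S i)) => Si.
    by rewrite (_ : mkset _ = [set w | W w = i])//; apply/seteqP; split => w// [].
  by rewrite (_ : mkset _ = set0)//; apply/seteqP; split => w// [].
- by move=> i j w [<- _] [<- _].
rewrite (_ : mkset _ = [set w | S (W w)])//.
by apply/seteqP; split => w /=; [move=> [i [<-]]|exists (W w)].
Qed.

Lemma pr_finfun (I : finType) (W : T -> I) (p : pred I) : (forall i, measurable [set w | W w = i]) ->
  pr [set w | p (W w)] = \sum_(i | p i) pr [set w | W w = i].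
Proof.
move=> mW; rewrite (pr_fiber (measurable_finfun p mW) mW) (bigID p) /=.
rewrite [X in _ + X]big1 ?addr0 => [|i npi].
  apply: eq_bigr => i pi; congr (pr _); apply/seteqP; split => w; first by case.
  by move=> /= Wi; rewrite Wi.
rewrite (_ : _ `&` _ = set0) ?pr_set0//; apply/seteqP; split => // w [/= + Wi].
by rewrite Wi (negbTE npi).
Qed.

(** What [A] has outside the union of the [F i] is at most the mass missing from the [F i]. This
    replaces a sum over all counts by a finite one with an explicit remainder. *)
Lemma pr_between_disjoint (I : finType) (F : I -> set T) A : measurable A ->
  (forall i, measurable (F i)) -> (forall i j w, F i w -> F j w -> i = j) ->
  \sum_i pr (A `&` F i) <= pr A <= \sum_i pr (A `&` F i) + (1 - \sum_i pr (F i)).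
Proof.
move=> mA mF dF; have [mU UE] := pr_bigcup_fin mF dF.
have [||mAU AUE] := @pr_bigcup_fin I (fun i => A `&` F i).
- by move=> i; exact: measurableI.
- by move=> i j w [_ Fi] [_ Fj]; exact: dF Fi Fj.
have AUI : [set w | exists i, (A `&` F i) w] = A `&` [set w | exists i, F i w].
  by apply/seteqP; split => w; [move=> [i [Aw Fi]]|move=> [Aw [i Fi]]];
    (split => //; exists i) || exists i.
rewrite -AUE -UE -prC// (prID mA mU) AUI lerDl pr_ge0/= lerD2l.
by apply: le_pr; [exact: measurableD|exact: measurableC|exact: subDsetr].
Qed.

(** Dominated convergence for indicators: [A n] lies between the intersection and the union of its
    tail, and both converge to [B] monotonically. It also yields measurability of [B]. *)
Lemma pr_cvg_pointwise (A : nat -> set T) B : (forall n, measurable (A n)) ->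
  (forall w, exists N, forall n, (N <= n)%N -> A n w <-> B w) ->
  measurable B /\ (fun n => pr (A n)) @ \oo --> pr B.
Proof.
move=> mA AB.
pose L n := \bigcap_(k in [set k | (n <= k)%N]) A k.
pose U n := \bigcup_(k in [set k | (n <= k)%N]) A k.
have mL n : measurable (L n) by apply: bigcap_measurableType.
have mU n : measurable (U n) by apply: bigcup_measurable.
have LB : \bigcup_n L n = B.
  apply/seteqP; split => w.
    move=> [n _ Ln]; have [N NB] := AB w.
    by apply/(NB (maxn N n)); [exact: leq_maxl|apply: Ln; exact: leq_maxr].
  by move=> Bw; have [N NB] := AB w; exists N => // k Nk; apply/NB.
have UB : \bigcap_n U n = B.
  apply/seteqP; split => w; have [N NB] := AB w.
    by move=> /(_ N I)[k Nk Ak]; apply/(NB k).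
  move=> Bw n _; exists (maxn N n); first exact: leq_maxr.
  by apply/NB => //; exact: leq_maxl.
have mB : measurable B by rewrite -LB; exact: bigcup_measurable.
split => //; apply: (@squeeze_cvgr _ _ _ _ (pr \o L) (pr \o U)).
- apply: nearW => n /=; rewrite !le_pr//.
    by move=> w Aw; exists n => /=.
  by move=> w; apply => /=.
- apply: (@fine_cvg _ _ _ _ (Q \o L)); rewrite -(prE mB) -LB.
  apply: nondecreasing_cvg_mu => //; first by rewrite LB.
  by move=> m n mn; apply/subsetPset => w Lw k /= nk; exact/Lw/(leq_trans mn).
- apply: (@fine_cvg _ _ _ _ (Q \o U)); rewrite -(prE mB) -UB.
  apply: nonincreasing_cvg_mu => //; first by rewrite ltey_eq fin_num_measure.
    by rewrite UB.
  move=> m n mn; apply/subsetPset => w [k /= nk Ak].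
  by exists k => //=; exact: leq_trans nk.
Qed.

End FiniteProbability.

Section CountingNat.
Local Open Scope card_scope.

Lemma card_nat_initial (D : set nat) M :
  D `&` `I_M #= `I_(\sum_(i < M) `[< D i >])%N.
Proof.
elim: M => [|M IH]; first by rewrite big_ord0 !II0 setI0.
rewrite big_ord_recr /=; case: asboolP => DM; last first.
  rewrite addn0 (_ : _ `&` _ = D `&` `I_M)//.
  apply/seteqP; split => k /= [Dk kM]; split => //; last exact: ltnW.
  by move: kM; rewrite ltnS leq_eqVlt => /predU1P[kM|//]; rewrite kM in Dk.
rewrite addn1; apply/eq_cardSP; exists M; first by split => /=.
rewrite (_ : _ `\ _ = D `&` `I_M)//; apply/seteqP; split => k /=.
  move=> [[Dk kM] km]; split => //.
  by move: kM; rewrite ltnS leq_eqVlt => /predU1P[].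
by move=> [Dk kM]; split; [split => //; exact: ltnW|move=> kE; rewrite kE ltnn in kM].
Qed.

(** The truncated counts stabilize when [D] is finite. When [D] is infinite they exceed [n] from
    some point on, and both sides are false. *)
Lemma card_nat_eventually (D : set nat) n : exists N, forall M, (N <= M)%N ->
  (\sum_(i < M) `[< D i >])%N = n <-> D #= `I_n.
Proof.
pose S M := (\sum_(i < M) `[< D i >])%N.
have SE M : D `&` `I_M #= `I_(S M) := card_nat_initial D M.
have Smono N M : (N <= M)%N -> (S N <= S M)%N.
  move=> /subnKC <-; elim: (M - N)%N => [|k IH]; first by rewrite addn0.
  by rewrite addnS (leq_trans IH)// {2}/S big_ord_recr leq_addr.
have [[N N2]|unb] := pselect (exists N, forall k, (N <= k)%N -> ~ D k).
  exists N => M NM; have DM : D `&` `I_M = D.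
    apply/seteqP; split => k; first by case.
    move=> Dk; split => //=; rewrite (leq_trans _ NM)// ltnNge.
    by apply/negP => /N2.
  have := SE M; rewrite DM => SM; split => [<-//|Dn].
  by apply/card_eq_II; rewrite -(card_eql SM).
have grow m : exists N, (m <= S N)%N.
  elim: m => [|m [N mN]]; first by exists 0%N.
  have [k Nk Dk] : exists2 k, (N <= k)%N & D k.
    apply: contrapT => H; apply: unb; exists N => k Nk Dk.
    by apply: H; exists k.
  exists k.+1; rewrite /S big_ord_recr /= (asboolT Dk) addn1 ltnS.
  by rewrite (leq_trans mN)// -/(S k) Smono.
have [N nN] := grow n.+1; exists N => M NM.
have nM : (n < S M)%N by rewrite (leq_trans nN)// Smono.
split => [SMn|Dn]; first by move: nM; rewrite /S SMn ltnn.
have : `I_(S M) #<= `I_n.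
  rewrite -(card_le_eql (SE M)) -(card_le_eqr Dn).
  by apply: subset_card_le; exact: subIsetl.
by rewrite card_le_II leqNgt nM.
Qed.

End CountingNat.

(** * The marked hyperplane process *)

Section MarkedProcess.
Local Open Scope card_scope.
Import numFieldNormedType.Exports.
Context {R : realType} {d : nat}.
Local Notation V := 'rV[R]_d.
Context dT (T : measurableType dT) (Q : probability T R) (Rn : nat -> T -> R)
  (th : nat -> T -> V).
Hypothesis model : hyperplane_model Q Rn th.

(** The independence clause with no condition on the radii and one trivial condition on a mark reads
    [1 = unifS setT]. This normalization is the source of the facts on [omega]. *)
Lemma unifS_setT : unifS [set: V] = 1.
Proof.
case: model => _ [_ [_ H]].
have := H 0%N (fun=> setT) 1%N (fun=> setT) (fun _ _ => measurableT) (fun _ _ => borelT).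
rewrite big_ord1 II0 bigcap_set0 setTI (_ : \bigcap_(i in _) _ = setT); last first.
  by apply/seteqP; split.
by rewrite probability_setT mul1e => /(congr1 fine).
Qed.

(** Division by zero yields 0, so [omega = 0] would make [unifS] vanish identically. *)
Lemma omega_neq0 : @omega R d != 0.
Proof.
apply/eqP => o0; have := unifS_setT.
by rewrite /unifS o0 invr0 mulr0 => /esym/eqP; rewrite oner_eq0.
Qed.

Lemma omega_gt0 : 0 < @omega R d.
Proof. by rewrite lt_neqAle eq_sym omega_neq0 fine_ge0// vol_ge0. Qed.

(** [fine] sends infinite values to 0, so positivity of [omega] certifies that the ball has finite
    volume. *)
Lemma vol_BallE : vol (@Ball R d) = (@omega R d)%:E.
Proof.
have := omega_gt0; rewrite /omega; case: (vol _) => [r|/=|/=]//; rewrite ?ltxx//.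
Qed.

Lemma measurable_Rn n (A : set R) : measurable A -> measurable [set w | A (Rn n w)].
Proof.
by move=> mA; case: model => mR _; rewrite -[X in measurable X]setTI; exact: mR.
Qed.

Lemma measurable_th n (A : set V) : borel A -> measurable [set w | A (th n w)].
Proof. by move=> bA; case: model => _ [mt _]; exact: mt. Qed.

Lemma pr_Rn_th M (B : nat -> set R) (A : nat -> set V) :
  (forall j, (j < M)%N -> measurable (B j)) ->
  (forall i, (i < M)%N -> borel (A i)) ->
  pr Q (\bigcap_(j in `I_M) [set w | B j (Rn j w)] `&`
        \bigcap_(i in `I_M) [set w | A i (th i w)]) =
  pr Q (\bigcap_(j in `I_M) [set w | B j (Rn j w)]) * \prod_(i < M) unifS (A i).
Proof.
move=> mB bA; case: model => _ [_ [_ /(_ M B M A mB bA) h]].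
rewrite /pr h fineM// fin_num_measure//.
by apply: bigcap_measurableType => j jM; apply: measurable_Rn; exact: mB.
Qed.

(** Once [unifS] is the law of a mark, monotonicity, bounds and the complement rule come from a
    probability measure instead of the outer measure [vol]. *)
Lemma unifSE n (A : set V) : borel A -> unifS A = pr Q [set w | A (th n w)].
Proof.
move=> bA.
have := @pr_Rn_th n.+1 (fun=> setT) (fun i => if i == n then A else setT)
  (fun _ _ => measurableT).
rewrite big_ord_recr /= eqxx big1 ?mul1r => [|i _]; last first.
  by rewrite ltn_eqF ?unifS_setT.
rewrite (_ : \bigcap_(j in _) _ = setT); last by apply/seteqP; split.
rewrite pr_setT mul1r setTI => <-.
  congr pr; apply/seteqP; split => w /=.
    by move=> /(_ n); rewrite eqxx; apply => /=.
  by move=> Aw i _ /=; case: eqP => [->|].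
by move=> i _; case: ifP => // _; exact: borelT.
Qed.

Lemma unifS_ge0 (A : set V) : borel A -> 0 <= unifS A.
Proof. by move=> bA; rewrite (unifSE 0 bA) pr_ge0. Qed.

Lemma unifS_le1 (A : set V) : borel A -> unifS A <= 1.
Proof. by move=> bA; rewrite (unifSE 0 bA) pr_le1//; exact: measurable_th. Qed.

Lemma le_unifS (A B : set V) : borel A -> borel B -> A `<=` B -> unifS A <= unifS B.
Proof.
move=> bA bB AB; rewrite (unifSE 0 bA) (unifSE 0 bB).
by apply: le_pr; [exact: measurable_th|exact: measurable_th|move=> w; exact: AB].
Qed.

Lemma unifSC (A : set V) : borel A -> unifS (~` A) = 1 - unifS A.
Proof.
move=> bA; rewrite (unifSE 0 bA) (unifSE 0 (borelC bA)) -prC//.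
exact: measurable_th.
Qed.

Section Marks.
(** The function [g] sorts the radii into finitely many classes, and [B j] is the set in which a
    mark must lie when its radius has class [j]. *)
Variables (J : finType) (g : R -> J) (B : J -> set V).
Hypotheses (mg : forall j, measurable [set r | g r = j]) (bB : forall j, borel (B j)).

Definition labels M w : {ffun 'I_M -> J} := [ffun n : 'I_M => g (Rn n w)].

Definition marked M : set T := [set w | forall n, (n < M)%N -> B (g (Rn n w)) (th n w)].

Lemma measurable_labels M h : measurable [set w | labels M w = h].
Proof.
rewrite (_ : mkset _ = \bigcap_(n in [set: 'I_M]) [set w | g (Rn n w) = h n]).
  by apply: fin_bigcap_measurable => // n _; exact: (measurable_Rn n (mg (h n))).
apply/seteqP; split => w /=; first by move=> <- n _ /=; rewrite ffunE.
by move=> H; apply/ffunP => n; rewrite ffunE H.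
Qed.

Lemma measurable_mark n : measurable [set w | B (g (Rn n w)) (th n w)].
Proof.
have [||+ _] := @pr_bigcup_fin _ _ _ Q J
  (fun j => [set w | g (Rn n w) = j] `&` [set w | B j (th n w)]).
- move=> j; apply: measurableI; first exact: (measurable_Rn n (mg j)).
  exact: (measurable_th n (bB j)).
- by move=> i j w [<- _] [<- _].
rewrite (_ : mkset _ = [set w | B (g (Rn n w)) (th n w)])//.
by apply/seteqP; split => w /=; [move=> [j [<-]]|exists (g (Rn n w))].
Qed.

Lemma measurable_marked M : measurable (marked M).
Proof.
rewrite (_ : marked M = \bigcap_(n in `I_M) [set w | B (g (Rn n w)) (th n w)])//.
by apply: bigcap_measurableType => n _; exact: measurable_mark.
Qed.

(** With the label vector fixed, every mark has a fixed constraint, so the event is a product event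
    for the independence clause. *)
Lemma pr_marked_labels M h :
  pr Q (marked M `&` [set w | labels M w = h]) =
  \prod_(n < M) unifS (B (h n)) * pr Q [set w | labels M w = h].
Proof.
pose lab n : set R := if insub n is Some i then [set r | g r = h i] else setT.
pose mark n : set V := if insub n is Some i then B (h i) else setT.
have labE (i : 'I_M) : lab i = [set r | g r = h i] by rewrite /lab valK.
have markE (i : 'I_M) : mark i = B (h i) by rewrite /mark valK.
have := @pr_Rn_th M lab mark.
rewrite (eq_bigr (fun i : 'I_M => unifS (B (h i)))) => [|i _]; last by rewrite markE.
have -> : \bigcap_(j in `I_M) [set w | lab j (Rn j w)] = [set w | labels M w = h].
  apply/seteqP; split => w /= H.
    by apply/ffunP => n; have := H n (ltn_ord n); rewrite labE ffunE.
  by move=> n nM /=; rewrite (labE (Ordinal nM)) /= -H ffunE.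
have -> : [set w | labels M w = h] `&` \bigcap_(i in `I_M) [set w | mark i (th i w)]
        = marked M `&` [set w | labels M w = h].
  rewrite setIC; apply/seteqP; split => w /= [H1 H2]; split => // n nM /=.
    by have := H1 n nM; rewrite /= (markE (Ordinal nM)) -H2 ffunE.
  by rewrite (markE (Ordinal nM)) -H2 ffunE; exact: H1.
rewrite mulrC; apply.
  by move=> n nM; rewrite (labE (Ordinal nM)); exact: mg.
by move=> n nM; rewrite (markE (Ordinal nM)); exact: bB.
Qed.

Lemma pr_marked_pred M (G : pred {ffun 'I_M -> J}) c :
  (forall h, G h -> \prod_(n < M) unifS (B (h n)) = c) ->
  pr Q (marked M `&` [set w | G (labels M w)]) = c * pr Q [set w | G (labels M w)].
Proof.
move=> Gc; have mW := @measurable_labels M.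
have mG := measurable_finfun Q G mW.
rewrite (pr_fiber Q (measurableI _ _ (measurable_marked M) mG) mW).
rewrite (pr_fiber Q mG mW) mulr_sumr; apply: eq_bigr => h _.
have [Gh|nGh] := boolP (G h).
  rewrite -setIA (_ : [set w | G (labels M w)] `&` _ = [set w | labels M w = h]).
    by rewrite pr_marked_labels Gc.
  by apply/seteqP; split => w /=; [case|move=> ->].
rewrite -setIA (_ : [set w | G (labels M w)] `&` _ = set0) ?setI0 ?pr_set0 ?mulr0//.
by apply/seteqP; split => // w /= [+ E]; rewrite E (negbTE nGh).
Qed.

End Marks.

Section Cells.
Variables (k : nat) (A : nat -> set R) (b : nat -> set V).
Hypotheses (mA : forall i, (i < k)%N -> measurable (A i) /\ bounded_set (A i))
  (dA : forall i j, (i < k)%N -> (j < k)%N -> i <> j -> A i `&` A j = set0)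
  (bb : forall i, borel (b i)).

Definition cell_of (r : R) : option 'I_k := [pick i : 'I_k | `[< A i r >]].

Lemma cell_ofP r (i : 'I_k) : cell_of r = Some i <-> A i r.
Proof.
rewrite /cell_of; case: pickP => [j /asboolP Aj|nA]; last first.
  by split => // Ai; have := nA i; rewrite (asboolT Ai).
split => [[<-//]|Ai]; congr Some; apply: contrapT => ij.
have : (A i `&` A j) r by [].
rewrite dA// => ijE; apply: ij; exact/val_inj.
Qed.

Lemma measurable_cell_of j : measurable [set r | cell_of r = j].
Proof.
have mS (i : 'I_k) : measurable [set r | cell_of r = Some i].
  rewrite (_ : mkset _ = A i); first by case: (mA (ltn_ord i)).
  by apply/seteqP; split => r /cell_ofP.
case: j => [i//|]; rewrite (_ : mkset _ = ~` \bigcup_(i in [set: 'I_k]) A i).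
  apply/measurableC/fin_bigcup_measurable => // i _.
  by case: (mA (ltn_ord i)).
apply/seteqP; split => r /= rN.
  by move=> [i _ /cell_ofP]; rewrite rN.
by case E: (cell_of r) => [i|//]; case: rN; exists i => //; exact/cell_ofP.
Qed.

Definition avoid (j : option 'I_k) : set V := if j is Some i then ~` b i else setT.

Lemma borel_avoid j : borel (avoid j).
Proof. by case: j => [i|]; [exact: (borelC (bb i))|exact: borelT]. Qed.

Definition counts (nn : 'I_k -> nat) : set T :=
  [set w | forall i : 'I_k, [set m | A i (Rn m w)] #= `I_(nn i)].

Definition counts_pred (nn : 'I_k -> nat) M : pred {ffun 'I_M -> option 'I_k} :=
  fun h => [forall i, #|[pred n | h n == Some i]| == nn i].

Lemma label_count M w (i : 'I_k) :
  #|[pred n | labels cell_of M w n == Some i]| =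
  (\sum_(n < M) `[< A i (Rn n w) >])%N.
Proof.
rewrite -sum1_card big_mkcond /=; apply: eq_bigr => n _.
rewrite inE ffunE; case: asboolP => [/cell_ofP ->|nA]; first by rewrite eqxx.
by case: eqP => // /cell_ofP.
Qed.

Lemma counts_eventually nn w : exists N, forall M, (N <= M)%N ->
  counts_pred nn (labels cell_of M w) <-> counts nn w.
Proof.
have /choice[N NE] : forall i : 'I_k, exists N, forall M, (N <= M)%N ->
  #|[pred n | labels cell_of M w n == Some i]| = nn i <->
  [set m | A i (Rn m w)] #= `I_(nn i).
  move=> i; have [N NE] := card_nat_eventually [set m | A i (Rn m w)] (nn i).
  by exists N => M /NE; rewrite label_count.
exists (\max_i N i)%N => M NM; split.
  move=> /forallP H i; apply/(NE i M); last exact/eqP/H.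
  exact: leq_trans (leq_bigmax i) NM.
move=> H; apply/forallP => i; apply/eqP/(NE i M); last exact: H.
exact: leq_trans (leq_bigmax i) NM.
Qed.

(** The product depends on [h] only through the number of indices in each cell; hence it is constant
    on [counts_pred], as [pr_marked_pred] demands. *)
Lemma prod_counts nn M h : counts_pred nn h ->
  \prod_(n < M) unifS (avoid (h n)) = \prod_(i < k) (1 - unifS (b i)) ^+ nn i.
Proof.
move=> /forallP hn.
transitivity (\prod_(n < M) \prod_(i < k)
    (if h n == Some i then 1 - unifS (b i) else 1)).
  apply: eq_bigr => n _; case: (h n) => [i|]; last first.
    by rewrite unifS_setT big1.
  rewrite /= unifSC// (bigD1 i)//= eqxx big1 ?mulr1// => j /negbTE ji.
  by case: eqP => // -[ij]; rewrite ij eqxx in ji.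
rewrite exchange_big; apply: eq_bigr => i _.
rewrite -big_mkcond /= prodr_const; congr (_ ^+ _).
by rewrite -(eqP (hn i)).
Qed.

Definition avoid_all : set T := [set w | forall n, avoid (cell_of (Rn n w)) (th n w)].

Lemma measurable_avoid_all : measurable avoid_all.
Proof.
rewrite (_ : avoid_all = \bigcap_n [set w | avoid (cell_of (Rn n w)) (th n w)]).
  apply: bigcapT_measurable => n.
  exact: (measurable_mark measurable_cell_of borel_avoid).
by apply/seteqP; split => w H n; [move=> _; exact: H|exact: (H n)].
Qed.

Lemma pr_counts nn : measurable (counts nn) /\
  pr Q (counts nn) = \prod_(i < k) pois (fine (lebesgue_measure (A i))) (nn i).
Proof.
have [||mc _] := @pr_cvg_pointwise _ _ _ Q
  (fun M => [set w | counts_pred nn (labels cell_of M w)]) (counts nn).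
- move=> M; apply: (measurable_finfun Q); exact: (measurable_labels measurable_cell_of).
- exact: counts_eventually.
split => //; have [_ [_ [H0 _]]] := model.
have := H0 k A (fun j => if insub j is Some i then nn i else 0%N) mA dA.
rewrite (eq_bigr (fun i : 'I_k => pois (fine (lebesgue_measure (A i))) (nn i))); last first.
  by move=> i _; rewrite valK.
move=> /(congr1 fine) /= <-; congr (fine (Q _)); apply/seteqP; split => w H.
  by move=> i ik /=; rewrite (_ : insub i = Some (Ordinal ik)) ?insubT //; exact: (H (Ordinal ik)).
by move=> i; have := H i (ltn_ord i); rewrite /= valK.
Qed.

(** Given the counts, each of the [nn i] marks in cell [i] misses [b i] independently. For the first
    [M] points the factor is exact and does not depend on [M], so it survives the limit in [M]. *)
Lemma pr_avoid_counts nn :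
  pr Q (avoid_all `&` counts nn) =
  \prod_(i < k) (1 - unifS (b i)) ^+ nn i *
  \prod_(i < k) pois (fine (lebesgue_measure (A i))) (nn i).
Proof.
have [_ <-] := pr_counts nn.
set c := \prod_(i < k) (1 - unifS (b i)) ^+ nn i.
pose G M := [set w | counts_pred nn (labels cell_of M w)].
have mG M : measurable (G M).
  by apply: (measurable_finfun Q); exact: (measurable_labels measurable_cell_of).
have mK M := measurable_marked measurable_cell_of borel_avoid M.
have [||_ c1] := @pr_cvg_pointwise _ _ _ Q
    (fun M => marked cell_of avoid M `&` G M) (avoid_all `&` counts nn).
- by move=> M; exact: measurableI.
- move=> w; have [N NE] := counts_eventually nn w.
  have [aw|/existsNP[n0 n0w]] := pselect (avoid_all w).
    exists N => M NM; have NEM := NE M NM.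
    by split => [[_ /NEM cw]|[_ /NEM GM]]; split => // n _; exact: aw.
  (* The mark [n0] violates its constraint, so both events fail once the index [n0] is included. *)
  exists n0.+1 => M nM; split => [[/(_ _ nM)//]|[/(_ n0)//]].
have [||_ c2] := @pr_cvg_pointwise _ _ _ Q G (counts nn) => //.
- exact: counts_eventually.
have c3 : (fun M => c * pr Q (G M)) @ \oo --> c * pr Q (counts nn).
  exact: cvgMr.
have pE : (fun M => pr Q (marked cell_of avoid M `&` G M)) = (fun M => c * pr Q (G M)).
  apply/funext => M; apply: (pr_marked_pred measurable_cell_of borel_avoid) => h.
  exact: prod_counts.
rewrite -(cvg_lim (@Rhausdorff R) c1) pE; exact: (cvg_lim (@Rhausdorff R) c3).
Qed.

End Cells.

End MarkedProcess.

Section PoissonGeneratingFunction.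
Import numFieldNormedType.Exports.
Context {R : realType}.

Lemma cvg_bigprod (I : Type) (r : seq I) (f : I -> nat -> R) (l : I -> R) :
  (forall i, f i @ \oo --> l i) ->
  (fun n => \prod_(i <- r) f i n) @ \oo --> \prod_(i <- r) l i.
Proof.
move=> fl; elim: r => [|i r IH].
  rewrite big_nil (_ : (fun _ => _) = cst 1); first exact: cvg_cst.
  by apply/funext => n; rewrite big_nil.
rewrite big_cons (_ : (fun _ => _) = (fun n => f i n * \prod_(j <- r) f j n)).
  exact: cvgM.
by apply/funext => n; rewrite big_cons.
Qed.

Lemma cvg_pois_gen (a u : R) :
  (fun K => \sum_(j < K) u ^+ j * pois a j) @ \oo --> expR (- (a * (1 - u))).
Proof.
rewrite (_ : - (a * (1 - u)) = - a + a * u); last by ring.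
rewrite expRD (_ : (fun _ => _) = (fun K => expR (- a) * series (exp_coeff (a * u)) K)).
  by apply: cvgMr; exact: is_cvg_series_exp_coeff.
apply/funext => K; rewrite /series /= mulr_sumr big_mkord; apply: eq_bigr => j _.
by rewrite /pois exp_coeffE exprMn; ring.
Qed.

End PoissonGeneratingFunction.

(** * Poisson thinning: the void probabilities of the marked process *)

Section AvoidProbability.
Local Open Scope card_scope.
Import numFieldNormedType.Exports.
Context {R : realType} {d : nat}.
Local Notation V := 'rV[R]_d.
Context dT (T : measurableType dT) (Q : probability T R) (Rn : nat -> T -> R)
  (th : nat -> T -> V).
Hypothesis model : hyperplane_model Q Rn th.
Variables (k : nat) (A : nat -> set R) (b : nat -> set V).
Hypotheses (mA : forall i, (i < k)%N -> measurable (A i) /\ bounded_set (A i))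
  (dA : forall i j, (i < k)%N -> (j < k)%N -> i <> j -> A i `&` A j = set0)
  (bb : forall i, borel (b i)).

Local Notation len i := (fine (lebesgue_measure (A i))).

(** Sum over the counts below [K]. Distributivity turns the sum over count vectors into the product
    [p K] of truncated Poisson generating functions at [u i]; the same product at 1 is [q K], the
    mass of the counts summed over. The error is at most [1 - q K], which tends to 0. *)
Lemma pr_avoid_all : pr Q (avoid_all Rn th k A b) =
  expR (- \sum_(i < k) len i * unifS (b i)).
Proof.
set E := avoid_all _ _ _ _ _.
have mE : measurable E := measurable_avoid_all model mA dA bb.
pose u (i : nat) := 1 - unifS (b i).
pose p K := \prod_(i < k) \sum_(j < K) u i ^+ j * pois (len i) j.
pose q K := \prod_(i < k) \sum_(j < K) 1 ^+ j * pois (len i) j.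
have pE K : \sum_(f : {ffun 'I_k -> 'I_K}) pr Q (E `&` counts Rn A (fun i => f i)) = p K.
  rewrite /p bigA_distr_bigA /=; apply: eq_bigr => f _.
  by rewrite (pr_avoid_counts model mA dA bb) -big_split.
have qE K : \sum_(f : {ffun 'I_k -> 'I_K}) pr Q (counts Rn A (fun i => f i)) = q K.
  rewrite /q bigA_distr_bigA /=; apply: eq_bigr => f _.
  rewrite (pr_counts model mA dA (fun i => f i)).2.
  by apply: eq_bigr => i _; rewrite expr1n mul1r.
have pqE K : p K <= pr Q E <= p K + (1 - q K).
  rewrite -pE -qE; apply: pr_between_disjoint => //.
    by move=> f; exact: (pr_counts model mA dA (fun i => f i)).1.
  move=> f f' w cf cf'; apply/ffunP => i; apply/val_inj/card_eq_II.
  by rewrite -(card_eql (cf i)); exact: cf'.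
have cp : p @ \oo --> \prod_(i < k) expR (- (len i * (1 - u i))).
  by apply: cvg_bigprod => i; exact: cvg_pois_gen.
have cq : q @ \oo --> (1 : R).
  rewrite (_ : 1 = \prod_(i < k) expR (- (len i * (1 - 1)))).
    by apply: cvg_bigprod => i; exact: cvg_pois_gen.
  by rewrite big1// => i _; rewrite subrr mulr0 oppr0 expR0.
have -> : expR (- \sum_(i < k) len i * unifS (b i)) =
    \prod_(i < k) expR (- (len i * (1 - u i))).
  rewrite -sumrN expR_sum; apply: eq_bigr => i _.
  by rewrite /u; congr (expR (- (_ * _))); ring.
set l := \prod_(i < k) _ in cp *.
have cpq : (fun K => p K + (1 - q K)) @ \oo --> l.
  rewrite (_ : l = l + (1 - 1)); last by rewrite subrr addr0.
  by apply: cvgD => //; apply: cvgB => //; exact: cvg_cst.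
have cE : (fun _ : nat => pr Q E) @ \oo --> l.
  by apply: (@squeeze_cvgr _ _ _ _ p (fun K => p K + (1 - q K))) => //; exact: nearW.
rewrite -(cvg_lim (@Rhausdorff R) cE); apply/esym/cvg_lim; last exact: cvg_cst.
exact: Rhausdorff.
Qed.

End AvoidProbability.

Section AlmostSure.
Import numFieldNormedType.Exports.
Context {R : realType} dT (T : measurableType dT) (Q : probability T R).
Implicit Types A B E : set T.

Lemma pr_null A B : measurable A -> measurable B -> A `<=` B -> pr Q B = 0 -> pr Q A = 0.
Proof.
by move=> mA mB AB B0; apply/eqP; rewrite eq_le pr_ge0 andbT -B0 le_pr.
Qed.

Lemma pr_setI_full A E : measurable A -> measurable E -> pr Q E = 1 ->
  pr Q (A `&` E) = pr Q A.
Proof.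
move=> mA mE E1; rewrite (prID Q mA mE) (@pr_null (A `\` E) (~` E)) ?addr0//.
- exact: measurableD.
- exact: measurableC.
- by rewrite prC// E1 subrr.
Qed.

Lemma pr_full_cap A B : measurable A -> measurable B -> pr Q A = 1 -> pr Q B = 1 ->
  pr Q (A `&` B) = 1.
Proof. by move=> mA mB A1 B1; rewrite pr_setI_full. Qed.

Lemma pr_full_bigcap (F : nat -> set T) : (forall n, measurable (F n)) ->
  (forall n, pr Q (F n) = 1) -> pr Q (\bigcap_n F n) = 1.
Proof.
move=> mF F1; pose G N := \bigcap_(n in `I_N) F n.
have mG N : measurable (G N) by apply: bigcap_measurableType.
have G1 N : pr Q (G N) = 1.
  elim: N => [|N IH]; first by rewrite /G II0 bigcap_set0 pr_setT.
  rewrite (_ : G N.+1 = G N `&` F N) ?pr_full_cap//.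
  apply/seteqP; split => w; first by move=> H; split => [n /= nN|]; apply: H => //=; exact: ltnW.
  by move=> [H1 H2] n /=; rewrite ltnS leq_eqVlt => /predU1P[->//|/H1].
have [//|w|_ cG] := @pr_cvg_pointwise _ _ _ Q G (\bigcap_n F n).
  have [aw|/existsNP[n /not_implyP[_ nw]]] := pselect ((\bigcap_n F n) w).
    by exists 0%N => N _; split => // _ n _; exact: aw.
  by exists n.+1 => N nN; split => [/(_ _ nN)//|/(_ n I)].
rewrite -(cvg_lim (@Rhausdorff R) cG); apply: cvg_lim; first exact: Rhausdorff.
by rewrite (_ : (fun n => _) = cst 1); [exact: cvg_cst|apply/funext].
Qed.

Lemma pr_null_bigcup_seq (I : eqType) (s : seq I) (F : I -> set T) :
  (forall i, measurable (F i)) -> (forall i, pr Q (F i) = 0) ->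
  measurable [set w | exists2 i, i \in s & F i w] /\
  pr Q [set w | exists2 i, i \in s & F i w] = 0.
Proof.
move=> mF F0; elim: s => [|i s [mU U0]].
  by rewrite (_ : mkset _ = set0) ?pr_set0//; apply/seteqP; split => // w [].
rewrite (_ : mkset _ = F i `|` [set w | exists2 j, j \in s & F j w]).
  have mFU := measurableU _ _ (mF i) mU; split => //.
  rewrite (prID Q mFU (mF i)) (@pr_null (_ `&` _) (F i)) ?add0r//.
  - apply: (@pr_null _ [set w | exists2 j, j \in s & F j w]) => //.
      exact: measurableD.
    by move=> w [[]].
  - exact: measurableI.
apply/seteqP; split => w.
  by move=> [j]; rewrite inE => /predU1P[->|js] Fj; [left|right; exists j].
move=> [Fi|[j js Fj]]; first by exists i; rewrite ?mem_head.
by exists j; rewrite // inE js orbT.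
Qed.

End AlmostSure.

(** * The Crofton cell *)

Section CroftonCell.
Import numFieldNormedType.Exports.
Context {R : realType} {d : nat}.
Local Notation V := 'rV[R]_d.

(** Intersection of the half-spaces on the origin's side, dilated by 2. A vanishing [r n] imposes no
    constraint here, whereas its hyperplane passes through the origin; so the comparison with the
    Crofton cell asks for [r n != 0]. *)
Definition polytope (r : nat -> R) (t : nat -> V) : set V :=
  [set x | forall n, Num.sg (r n) * dotp x (t n) <= 2 * `|r n|].

Variables (r : nat -> R) (t : nat -> V).
Hypothesis r_neq0 : forall n, r n != 0.

Let side n (x : V) : R := Num.sg (r n) * dotp x (t n).
Let open_cell : set V := [set x | forall n, side n x < `|r n|].

Let continuous_side n : continuous (side n).
Proof.
rewrite (_ : side n = dotp (Num.sg (r n) *: t n)); first exact: continuous_dotp.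
by apply/funext => y; rewrite dotpZl dotpC.
Qed.

Let side0 n : side n 0 = 0.
Proof. by rewrite /side dotp0l mulr0. Qed.

Let sideZ n c x : side n (c *: x) = c * side n x.
Proof. by rewrite /side dotpZl mulrCA. Qed.

Lemma closed_polytope : closed (polytope r t).
Proof.
rewrite (_ : polytope r t = \bigcap_n [set x | side n x <= 2 * `|r n|]).
  apply: closed_bigI => n _.
  by apply: (@closed_lefun R V (side n) (cst (2 * `|r n|))) => // ?; exact: cst_continuous.
by apply/seteqP; split => x H n; [move=> _; exact: H|exact: (H n)].
Qed.

(** The open cell is star-shaped about 0, hence connected. Conversely [side n] maps the component to
    an interval containing 0; if it reached [|r n|] or more, it would take the value [|r n|], on the
    hyperplane. The argument applies to infinitely many hyperplanes at once. *)
Lemma connected_component_open_cell :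
  connected_component (~` \bigcup_n hyperplane (r n) (t n)) 0 = open_cell.
Proof.
set U := ~` _.
have r0 n : 0 < `|r n| by rewrite normr_gt0.
have cell0 : open_cell 0 by move=> n; rewrite side0.
have cellU : open_cell `<=` U.
  by move=> x xC [n _ xn]; have := xC n; rewrite /side xn -normrEsg ltxx.
apply/seteqP; split; last first.
  apply: connected_component_max => //.
  pose seg (x : V) := (fun c : R => c *: x) @` `[0, 1].
  rewrite (_ : open_cell = \bigcup_(x in open_cell) seg x).
    apply: bigcup_connected => [|x _].
      by exists 0 => x _; exists 0; rewrite ?scale0r//= in_itv/= lexx ler01.
    apply: connected_continuous_connected; first exact: segment_connected.
    by apply: continuous_subspaceT => c; apply: cvgZr_tmp; exact: cvg_id.
  apply/seteqP; split => [x xC|_ [x xC [c + <-]] n].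
    by exists x => //; exists 1; rewrite ?scale1r//= in_itv/= lexx ler01.
  rewrite /= in_itv /= => /andP[c0 c1]; rewrite sideZ.
  have [s0|s0] := leP (side n x) 0.
    by rewrite (le_lt_trans _ (r0 n))// mulr_ge0_le0.
  by rewrite (le_lt_trans _ (xC n))// ger_pMl.
move=> y Cy n; rewrite ltNge; apply/negP => ry.
have C0 : connected_component U 0 0 by apply: connected_component_refl; exact: cellU.
have /connected_intervalP itv : connected (side n @` connected_component U 0).
  apply: connected_continuous_connected; first exact: component_connected.
  exact: continuous_subspaceT.
have s0 : (side n @` connected_component U 0) 0 by exists 0; rewrite ?side0.
have sy : (side n @` connected_component U 0) (side n y) by exists y.
have [|z Cz] := itv _ _ s0 sy `|r n|; first by rewrite normr_ge0.
rewrite {1}normrEsg => /mulfI zn.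
have := connected_component_sub Cz; apply; exists n => //; apply: zn.
by rewrite sgr_eq0.
Qed.

Lemma scale2_crofton : scale 2 (crofton r t) = polytope r t.
Proof.
rewrite /crofton connected_component_open_cell.
have clE : closure open_cell = [set x | forall n, side n x <= `|r n|].
  apply/seteqP; split.
    have clo : closed [set x | forall n, side n x <= `|r n|].
      rewrite (_ : mkset _ = \bigcap_n [set x | side n x <= `|r n|]).
        apply: closed_bigI => n _.
        by apply: (@closed_lefun R V (side n) (cst `|r n|)) => // ?; exact: cst_continuous.
      by apply/seteqP; split => x H n; [move=> _; exact: H|exact: (H n)].
    by rewrite closureE; apply: smallest_sub => // x xC n; exact/ltW/xC.
  move=> x xC B Bx.
  have cx : (fun c : R => c *: x) @ (1 : R) --> x.
    by rewrite -[X in _ --> X](scale1r x); apply: cvgZr_tmp; exact: cvg_id.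
  have /nbhs_ballP[e /= e0 eB] := cx _ Bx.
  (* A factor in [[0, 1)] within [e] of 1: it moves [x] into the open cell while staying in the
     given neighbourhood. *)
  pose c : R := 1 - Num.min e 1 / 2.
  have m0 : 0 < Num.min e 1 by rewrite lt_min e0 ltr01.
  have m1 : Num.min e 1 <= 1 by rewrite ge_min lexx orbT.
  have me : Num.min e 1 <= e by rewrite ge_min lexx.
  have c1 : c < 1 by rewrite /c; lra.
  have c0 : 0 <= c by rewrite /c; lra.
  exists (c *: x); split.
    move=> n; rewrite sideZ; have rn : 0 < `|r n| by rewrite normr_gt0.
    have [s0|s0] := leP (side n x) 0.
      by rewrite (le_lt_trans _ rn)// mulr_ge0_le0.
    by rewrite (lt_le_trans _ (xC n))// gtr_pMl.
  apply: eB; rewrite /ball /= (_ : 1 - c = Num.min e 1 / 2); last by rewrite /c; ring.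
  by rewrite ger0_norm; lra.
rewrite clE; apply/seteqP; split => [_ [x xC <-] n|x xC].
  by rewrite -/(side _ _) sideZ ler_pM2l.
exists (2^-1 *: x); last by rewrite scalerA divff ?scale1r.
by move=> n; rewrite sideZ ler_pdivrMl//; exact: xC.
Qed.

End CroftonCell.

(** * Almost sure properties of the hyperplanes *)

Section HyperplaneAlmostSure.
Local Open Scope card_scope.
Import numFieldNormedType.Exports.
Context {R : realType} {d : nat}.
Local Notation V := 'rV[R]_d.
Context dT (T : measurableType dT) (Q : probability T R) (Rn : nat -> T -> R)
  (th : nat -> T -> V).
Hypothesis model : hyperplane_model Q Rn th.
Hypothesis d_gt0 : (0 < d)%N.

Lemma bounded_le_set (A : set R) M : (forall x, A x -> `|x| <= M) -> bounded_set A.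
Proof.
move=> AM; exists M; split; first exact: num_real.
by move=> x Mx y Ay; apply: (le_trans (AM _ Ay)); exact: ltW.
Qed.

Definition on_sphere : set T := [set w | forall n, enorm (th n w) = 1].

(** A cone sees only the points of its base on the sphere, so [Sphere] and the whole space have the
    same [unifS]. *)
Lemma on_sphere_full : measurable on_sphere /\ pr Q on_sphere = 1.
Proof.
have E : on_sphere = \bigcap_n [set w | Sphere (th n w)].
  by apply/seteqP; split => w H n; [move=> _; exact: H|exact: (H n)].
have mS n : measurable [set w | Sphere (th n w)].
  exact: (measurable_th model n borel_Sphere).
split; first by rewrite E; exact: bigcapT_measurable.
rewrite E; apply: pr_full_bigcap => // n.
rewrite -(unifSE model n borel_Sphere) -(unifS_setT model) /unifS.
congr (fine (vol _) / _); apply/seteqP; split => y [c [x [c01 [_ [Sx ->]]]]];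
  by exists c, x.
Qed.

Definition no_point_within (e : R) : set T := [set w | forall n, e < `|Rn n w|].

Lemma pr_no_point_within (e : R) : 0 <= e ->
  measurable (no_point_within e) /\ pr Q (no_point_within e) = expR (- (2 * e)).
Proof.
move=> e0; pose A (_ : nat) : set R := `[- e, e]%classic.
have mA i : (i < 1)%N -> measurable (A i) /\ bounded_set (A i).
  split; first exact: measurable_itv.
  by apply: (@bounded_le_set _ e) => x; rewrite /A /= in_itv /= ler_norml.
have dA i j : (i < 1)%N -> (j < 1)%N -> i <> j -> A i `&` A j = set0.
  by case: i j => [|?] [|?].
have [mc] := pr_counts model mA dA (fun=> 0%N).
rewrite big_ord1 /pois expr0 fact0 divr1 mul1r.
have cE : counts Rn A (fun _ : 'I_1 => 0%N) = no_point_within e.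
  rewrite /counts; apply/seteqP; split => w /= H.
    move=> n; have := H ord0; rewrite II0 card_eq0 => /eqP/seteqP[+ _].
    by move=> /(_ n); rewrite /A /= in_itv /= -ler_norml ltNge => /negP.
  move=> i; rewrite II0 card_eq0; apply/eqP/seteqP; split => // n /=.
  by rewrite /A /= in_itv /= -ler_norml leNgt H.
rewrite cE in mc *; have -> : fine (lebesgue_measure (A 0%N)) = 2 * e.
  rewrite /A lebesgue_measure_itv /= lte_fin.
  have [_|e0'] := ltP; first by rewrite /=; ring.
  by rewrite (_ : e = 0) ?mulr0//; lra.
by [].
Qed.

Definition has_gap : set T := [set w | exists2 e, 0 < e & no_point_within e w].

(** A gap of radius [1 / (j + 1)] has probability at least [1 - 2 / (j + 1)]. The gap is what gives
    the cell the origin as an interior point. *)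
Lemma has_gap_full : measurable has_gap /\ pr Q has_gap = 1.
Proof.
have i0 (j : nat) : 0 <= (j.+1%:R : R)^-1 by rewrite invr_ge0.
have E : has_gap = \bigcup_j no_point_within (j.+1%:R)^-1.
  apply/seteqP; split => w.
    move=> [e e0 we]; exists (Num.truncn e^-1) => // n.
    rewrite (le_lt_trans _ (we n))//.
    rewrite invf_ple ?posrE//; apply/ltW; exact: truncnS_gt.
  by move=> [j _ wj]; exists (j.+1%:R)^-1.
have mG : measurable has_gap.
  by rewrite E; apply: bigcup_measurable => j _; exact: (pr_no_point_within (i0 j)).1.
split => //; apply/eqP; rewrite eq_le pr_le1//= leNgt; apply/negP => G1.
have e0 : 0 < 1 - pr Q has_gap by rewrite subr_gt0.
pose j := Num.truncn (2 / (1 - pr Q has_gap)).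
have : 1 - 2 * (j.+1%:R)^-1 <= pr Q has_gap.
  apply: (@le_trans _ _ (pr Q (no_point_within (j.+1%:R)^-1))).
    by rewrite (pr_no_point_within (i0 j)).2 expR_ge1Dx.
  apply: le_pr => //; first exact: (pr_no_point_within (i0 j)).1.
  by rewrite E => w wj; exists j.
have : 2 / (1 - pr Q has_gap) < j.+1%:R by exact: truncnS_gt.
rewrite ltr_pdivrMr// => h1 h2.
have : 2 * j.+1%:R^-1 < 1 - pr Q has_gap by rewrite ltr_pdivrMr// mulrC.
by rewrite ltrBrDl -ltrBrDr ltNge h2.
Qed.

Definition orthant (sigma : {ffun 'I_d -> bool}) : set V :=
  [set v | forall i, 0 < (-1) ^+ sigma i * v ord0 i].

Let sgnv (sigma : {ffun 'I_d -> bool}) : V := \row_i (-1) ^+ sigma i.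

Let sgnvP sigma : sign_vector (sgnv sigma).
Proof. by move=> i; rewrite mxE normrX normrN1 expr1n. Qed.

Lemma borel_orthant sigma : borel (orthant sigma).
Proof.
apply: borel_forall => i; apply: borel_open.
apply: (@open_ltfun R V (cst 0) (fun v => (-1) ^+ sigma i * v ord0 i)) => v.
  exact: cst_continuous.
apply: (@continuousM R V (cst ((-1) ^+ sigma i)) (fun v : V => v ord0 i)).
  exact: cst_continuous.
exact: coord_continuous.
Qed.

Lemma orthant_sign sigma tau :
  hadamard (sgnv sigma) @^-1` orthant tau = orthant [ffun i => sigma i (+) tau i].
Proof.
by apply/seteqP; split => v H i; have := H i;
  rewrite !mxE ffunE signr_addb mulrA (mulrC ((-1) ^+ tau i)).
Qed.

Lemma unifS_orthant sigma tau : unifS (orthant sigma) = unifS (orthant tau).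
Proof.
rewrite -(unifS_sign (orthant sigma) (sgnvP [ffun i => sigma i (+) tau i])).
rewrite orthant_sign; congr (unifS (orthant _)).
by apply/ffunP => i; rewrite !ffunE addbC addbA addbb addFb.
Qed.

(** All open orthants have equal mass by reflection. If it were 0, a mark would almost surely lie on
    a coordinate hyperplane, and these are null as well. *)
Lemma unifS_orthant_gt0 sigma : 0 < unifS (orthant sigma).
Proof.
rewrite lt_neqAle (unifS_ge0 model (borel_orthant _)) andbT eq_sym; apply/eqP => s0.
pose O := [set w | exists2 tau, tau \in index_enum {ffun 'I_d -> bool} & orthant tau (th 0 w)].
pose H i : set V := [set v | v ord0 i = 0].
have bH i : borel (H i).
  rewrite (_ : H i = [set v | v ord0 i <= 0] `&` [set v | 0 <= v ord0 i]).
    by apply: borelI; apply: borel_closed;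
      [apply: (@closed_lefun R V (fun v => v ord0 i) (cst 0))|
       apply: (@closed_lefun R V (cst 0) (fun v => v ord0 i))] => v;
      (exact: coord_continuous || exact: cst_continuous).
  apply/seteqP; split => v; first by move=> vi; split => /=; rewrite vi.
  by move=> [/= v1 v2]; apply/eqP; rewrite eq_le v1.
pose W := [set w | exists2 i, i \in index_enum 'I_d & H i (th 0 w)].
have [mO O0] : measurable O /\ pr Q O = 0.
  apply: (pr_null_bigcup_seq _ (F := fun tau => [set w | orthant tau (th 0 w)])) => tau.
    exact: (measurable_th model 0 (borel_orthant tau)).
  by rewrite -(unifSE model 0 (borel_orthant tau)) (unifS_orthant _ sigma).
have [mW W0] : measurable W /\ pr Q W = 0.
  apply: (pr_null_bigcup_seq _ (F := fun i => [set w | H i (th 0 w)])) => i.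
    exact: (measurable_th model 0 (bH i)).
  rewrite -(unifSE model 0 (bH i)) /unifS (@vol_coord_hyperplane _ _ i) ?mul0r//.
    move=> _ [c [x [/andP[c0 c1] [_ [Sx ->]]]]].
    by rewrite /Ball /= enormZ Sx mulr1 ger0_norm.
  by move=> _ [c [x [_ [Hx [_ ->]]]]]; rewrite mxE Hx mulr0.
have mOC := measurableC mO; have mWC := measurableC mW.
have : pr Q (~` O `&` ~` W) = 1 by rewrite pr_full_cap ?prC ?O0 ?W0 ?subr0.
rewrite (_ : ~` O `&` ~` W = set0) ?pr_set0 => [/esym/eqP|]; first by rewrite oner_eq0.
apply/seteqP; split => // w [nO nW]; apply: nO.
exists [ffun i => th 0 w ord0 i < 0]; first exact: mem_index_enum.
move=> i; rewrite ffunE; case: (ltgtP (th 0 w ord0 i) 0) => h.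
- by rewrite expr1 mulN1r oppr_gt0.
- by rewrite expr0 mul1r.
- by exfalso; apply: nW; exists i => //; exact: mem_index_enum.
Qed.

(** For nonzero radii: some outer normal [sg (Rn n) th n] lies in the given orthant. Having this for
    every orthant makes the cell bounded. *)
Definition hits_orthant sigma : set T :=
  [set w | exists n, (0 < Rn n w /\ orthant sigma (th n w)) \/
                     (Rn n w <= 0 /\ orthant [ffun i => ~~ sigma i] (th n w))].

(** Opposite orthants have the same mass [p], so whatever the signs of the radii, the first [M]
    points all fail with probability [(1 - p) ^+ M]. *)
Lemma hits_orthant_full sigma : measurable (hits_orthant sigma) /\ pr Q (hits_orthant sigma) = 1.
Proof.
pose g (r : R) := 0 < r.
pose B (b : bool) : set V :=
  ~` orthant (if b then sigma else [ffun i => ~~ sigma i]).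
have mg (b : bool) : measurable [set r | g r = b].
  case: b.
    rewrite (_ : mkset _ = `]0, +oo[%classic); first exact: measurable_itv.
    by apply/seteqP; split => r; rewrite /= in_itv /= andbT.
  rewrite (_ : mkset _ = `]-oo, 0]%classic); first exact: measurable_itv.
  by apply/seteqP; split => r; rewrite /= in_itv /= /g leNgt => /negP; [move=> /negP|move/negP/negbTE].
have bB b : borel (B b) by apply: borelC; exact: borel_orthant.
have mM M := measurable_marked model mg bB M.
pose p := unifS (orthant sigma).
have p0 : 0 < p := unifS_orthant_gt0 sigma.
have p1 : p <= 1 := unifS_le1 model (borel_orthant sigma).
have hitC : ~` hits_orthant sigma = \bigcap_M marked Rn th g B M.
  apply/seteqP; split => w.
    move=> nh M _ n _; rewrite /B /g; have [R0|R0] := ltP 0 (Rn n w) => hn.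
      by apply: nh; exists n; left.
    by apply: nh; exists n; right.
  move=> H [n]; have := H n.+1 I n (ltnSn n); rewrite /B /g.
  by have [R0|R0] := ltP 0 (Rn n w) => nO [[]|[]] // /(lt_le_trans R0); rewrite ltxx.
have mC : measurable (~` hits_orthant sigma).
  by rewrite hitC; exact: bigcapT_measurable.
have mh : measurable (hits_orthant sigma).
  by rewrite -[hits_orthant _]setCK; exact: measurableC.
have prM M : pr Q (marked Rn th g B M) = (1 - p) ^+ M.
  have := @pr_marked_pred _ _ _ _ _ _ _ model _ g B mg bB M predT ((1 - p) ^+ M).
  rewrite (_ : [set w | _] = setT) ?setIT ?pr_setT ?mulr1; last by apply/seteqP; split.
  apply=> h _; rewrite (eq_bigr (fun=> 1 - p)) ?prodr_const ?card_ord// => n _.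
  rewrite /B (unifSC model); last exact: borel_orthant.
  by congr (1 - _); exact: unifS_orthant.
split => //; suff : pr Q (~` hits_orthant sigma) = 0 by rewrite prC//; lra.
have cM : (fun M => (1 - p) ^+ M) @ \oo --> (0 : R).
  by apply: cvg_expr; rewrite ger0_norm; lra.
apply/eqP; rewrite eq_le pr_ge0 andbT.
apply: (ler_cvg_to (cvg_cst (pr Q (~` hits_orthant sigma))) cM).
apply: nearW => M; rewrite -prM le_pr// => w nh.
by move: nh; rewrite hitC; apply.
Qed.

End HyperplaneAlmostSure.

(** * Geometry and containment probabilities of the doubled cell *)

Section PolytopeProbability.
Import numFieldNormedType.Exports.
Context {R : realType} {d : nat}.
Local Notation V := 'rV[R]_d.
Context dT (T : measurableType dT) (Q : probability T R) (Rn : nat -> T -> R)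
  (th : nat -> T -> V).
Hypothesis model : hyperplane_model Q Rn th.
Hypothesis d_gt0 : (0 < d)%N.

Local Notation cell w := (polytope (fun n => Rn n w) (fun n => th n w)).

(** The almost sure event on which the doubled cell is bounded and has the origin in its
    interior. *)
Definition good : set T :=
  (on_sphere th `&` has_gap Rn) `&`
  \bigcap_(sigma in [set: {ffun 'I_d -> bool}]) hits_orthant Rn th sigma.

Lemma good_full : measurable good /\ pr Q good = 1.
Proof.
have [mS S1] := on_sphere_full model; have [mG G1] := has_gap_full model.
have mH := fun sigma => (hits_orthant_full model sigma).1.
have mHI : measurable (\bigcap_(sigma in [set: {ffun 'I_d -> bool}]) hits_orthant Rn th sigma).
  exact: fin_bigcap_measurable.
split; first by apply: measurableI => //; exact: measurableI.
apply: pr_full_cap => //; [exact: measurableI|exact: pr_full_cap|].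
have mHC sigma := measurableC (mH sigma).
have H0 sigma : pr Q (~` hits_orthant Rn th sigma) = 0.
  by rewrite prC// (hits_orthant_full model sigma).2 subrr.
have [mU U0] := pr_null_bigcup_seq (index_enum {ffun 'I_d -> bool}) mHC H0.
have : pr Q (~` \bigcap_(sigma in [set: {ffun 'I_d -> bool}]) hits_orthant Rn th sigma) = 0.
  rewrite -U0; congr (pr Q _); apply/seteqP; split => w.
    by move=> /existsNP[sigma /not_implyP[_ ns]]; exists sigma => //; exact: mem_index_enum.
  by move=> [sigma _ ns] H; apply: ns; exact: H.
by rewrite prC//; lra.
Qed.

Lemma good_Rn_neq0 w : good w -> forall n, Rn n w != 0.
Proof. by move=> [[_ [e e0 ew]] _] n; rewrite -normr_gt0 (lt_trans e0). Qed.

Lemma polytope_interior w : good w ->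
  exists2 rho, 0 < rho & forall x : V, `|x| <= rho -> cell w x.
Proof.
move=> [[sw [e e0 ew]] _]; have d0 : 0 < d%:R :> R by rewrite ltr0n.
exists (2 * e / d%:R); first by rewrite divr_gt0// mulr_gt0.
move=> x xr n; rewrite (le_trans (ler_norm _))// normrM.
rewrite (@le_trans _ _ `|dotp x (th n w)|)//.
  by rewrite ler_piMl// normr_sg; case: (_ != 0).
rewrite (le_trans (dotp_le_l1norm _ _))// sw mulr1 (le_trans (l1norm_le_norm x))//.
rewrite (le_trans (ler_wpM2l (ltW d0) xr))// mulrC divfK ?gt_eqF//.
by rewrite ler_pM2l// ltW.
Qed.

(** Take a normal in the orthant given by the signs of [x]. Then all terms of its inner product with
    [x] are nonnegative, so each of them alone is at most [2 |r|], which bounds each coordinate. The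
    sum over all orthants and coordinates is a bound uniform in [x]. *)
Lemma polytope_bounded w : good w -> exists M, forall x : V, cell w x -> `|x| <= M.
Proof.
move=> gw; have R0 := good_Rn_neq0 gw; case: gw => _ hw.
have /choice[N NP] : forall sigma : {ffun 'I_d -> bool}, exists n, forall i,
    0 < (-1) ^+ sigma i * (Num.sg (Rn n w) * th n w ord0 i).
  move=> sigma; have [n [[Rp O]|[Rp O]]] := hw sigma I; exists n => i.
    by rewrite gtr0_sg// mul1r; exact: O.
  have Rn0 : Rn n w < 0 by rewrite lt_neqAle R0.
  have := O i; rewrite ffunE ltr0_sg// => Oi.
  by rewrite mulN1r mulrN -mulNr -signrN.
pose c (sigma : {ffun 'I_d -> bool}) (i : 'I_d) := (-1) ^+ sigma i * (Num.sg (Rn (N sigma) w) * th (N sigma) w ord0 i).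
pose B (sigma : {ffun 'I_d -> bool}) (i : 'I_d) := 2 * `|Rn (N sigma) w| / c sigma i.
have c0 sigma i : 0 < c sigma i by exact: NP.
have B0 sigma i : 0 <= B sigma i.
  by apply: divr_ge0; [rewrite mulr_ge0|exact/ltW/c0].
exists (\sum_(sigma : {ffun 'I_d -> bool}) \sum_i B sigma i) => x xw.
apply: normr_le_coord => [|i].
  by apply: sumr_ge0 => sigma _; exact: sumr_ge0.
pose sigma := [ffun i => x ord0 i < 0].
apply: (@le_trans _ _ (B sigma i)); last first.
  rewrite (bigD1 sigma)//= (bigD1 i)//= -addrA lerDl.
  by apply: addr_ge0; apply: sumr_ge0 => // tau _; exact: sumr_ge0.
rewrite /B ler_pdivlMr ?c0//.
have xE j : `|x ord0 j| = (-1) ^+ sigma j * x ord0 j.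
  rewrite ffunE; have [x0|x0] := ltP (x ord0 j) 0.
    by rewrite expr1 mulN1r ltr0_norm.
  by rewrite expr0 mul1r ger0_norm.
rewrite (le_trans _ (xw (N sigma)))// /dotp mulr_sumr.
have tE j : Num.sg (Rn (N sigma) w) * (x ord0 j * th (N sigma) w ord0 j) =
            `|x ord0 j| * c sigma j.
  rewrite xE /c; transitivity (((-1) ^+ sigma j * (-1) ^+ sigma j) *
    (Num.sg (Rn (N sigma) w) * (x ord0 j * th (N sigma) w ord0 j))); last by ring.
  by rewrite -expr2 sqrr_sign mul1r.
rewrite (bigD1 i)//= tE lerDl; apply: sumr_ge0 => j _.
by rewrite tE; apply: mulr_ge0 => //; exact/ltW/c0.
Qed.

Lemma measurable_dotp_th (x : V) n : measurable_fun setT (fun w => dotp x (th n w)).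
Proof.
apply: (measurability _ (RGenOInfty.measurableE R)) => _ [_ [a ->] <-].
rewrite setTI (_ : _ @^-1` _ = [set w | [set v | a < dotp x v] (th n w)]).
  apply: (measurable_th model); apply: borel_open.
  apply: (@open_ltfun R V (cst a) (dotp x)); last exact: continuous_dotp.
  by move=> v; exact: cst_continuous.
by apply/seteqP; split => w /=; rewrite in_itv /= andbT.
Qed.

(** Multiplying by [|r|] removes sign and absolute value and leaves a polynomial condition, whose
    measurability is immediate. *)
Lemma polytope_sideE (r t : R) : (Num.sg r * t <= 2 * `|r|) = (0 <= 2 * r ^+ 2 - r * t).
Proof.
rewrite subr_ge0; have [->|r0] := eqVneq r 0.
  by rewrite sgr0 normr0 expr0n !mul0r !mulr0 lexx.
have rp : 0 < `|r| by rewrite normr_gt0.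
rewrite -(ler_pM2l rp) mulrA (mulrC `|r|) -numEsg.
by rewrite [`|r| * _](_ : _ = 2 * r ^+ 2)// mulrCA -expr2 real_normK// num_real.
Qed.

Lemma measurable_in_polytope (x : V) : measurable [set w | cell w x].
Proof.
rewrite (_ : mkset _ = \bigcap_n [set w |
    0 <= 2 * Rn n w ^+ 2 - Rn n w * dotp x (th n w)]); last first.
  apply/seteqP; split => w H n; first by move=> _; rewrite /= -polytope_sideE; exact: H.
  by rewrite /= polytope_sideE; exact: (H n).
apply: bigcapT_measurable => n.
have [mR _] := model.
have mf : measurable_fun setT (fun w => 2 * Rn n w ^+ 2 - Rn n w * dotp x (th n w)).
  apply: measurable_funB; first by apply: measurable_funM => //; exact: measurable_funX.
  by apply: measurable_funM => //; exact: measurable_dotp_th.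
rewrite (_ : mkset _ = setT `&` (fun w => 2 * Rn n w ^+ 2 - Rn n w * dotp x (th n w)) @^-1`
  `[0, +oo[%classic); first by apply: mf => //; exact: measurable_itv.
by rewrite setTI; apply/seteqP; split => w /=; rewrite in_itv /= andbT.
Qed.

Definition contains (xs : seq V) : set T := [set w | forall x, x \in xs -> cell w x].

Lemma measurable_contains xs : measurable (contains xs).
Proof.
rewrite (_ : contains xs = \bigcap_(x in [set` xs]) [set w | cell w x]).
  by apply: fin_bigcap_measurable => // x _; exact: measurable_in_polytope.
by apply/seteqP; split => w H x; exact: H.
Qed.

Section Sandwich.
Variables (xs : seq V) (m : nat) (delta : R).
Hypotheses (delta_gt0 : 0 < delta) (Lt : total_l1norm xs <= m%:R * delta).

(** The indices below [m] are the positive slabs, the index [m + j] is the mirror image of slab [j].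
    With length [delta / 2], the quantity [2 |r|] ranges over [(j delta, (j + 1) delta]]. *)
Definition slab (i : nat) : set R :=
  if (i < m)%N then `](i%:R * (delta / 2)), (i.+1%:R * (delta / 2))]%classic
  else `[- ((i - m).+1%:R * (delta / 2)), - ((i - m)%:R * (delta / 2))[%classic.

Definition forbidden (c : nat -> R) (i : nat) : set V :=
  if (i < m)%N then capcone xs (c i) else capcone (map -%R xs) (c (i - m)%N).

Let delta2 : 0 < delta / 2. Proof. by rewrite divr_gt0. Qed.

Let step (i : nat) : i.+1%:R * (delta / 2) - i%:R * (delta / 2) = delta / 2.
Proof. by rewrite -natr1; ring. Qed.

Lemma slab_pos i r : (i < m)%N -> slab i r ->
  0 < r /\ i%:R * (delta / 2) < r <= i.+1%:R * (delta / 2).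
Proof.
move=> im; rewrite /slab im /= in_itv /= => /andP[ir ri]; rewrite ir ri; split => //.
by rewrite (le_lt_trans _ ir)// mulr_ge0// ltW.
Qed.

Lemma slab_neg i r : (m <= i)%N -> slab i r ->
  r < 0 /\ (i - m)%:R * (delta / 2) < - r <= (i - m).+1%:R * (delta / 2).
Proof.
rewrite leqNgt => /negbTE im; rewrite /slab im /= in_itv /= => /andP[ir ri].
rewrite lerNl ltrNr ir ri; split => //.
by rewrite (lt_le_trans ri)// oppr_le0 mulr_ge0// ltW.
Qed.

Lemma natr_half_open_inj i j (r e : R) : 0 < e ->
  i%:R * e < r <= i.+1%:R * e -> j%:R * e < r <= j.+1%:R * e -> i = j.
Proof.
move=> e0 /andP[ir ri] /andP[jr rj]; apply/eqP; rewrite eqn_leq.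
have := lt_le_trans ir rj; have := lt_le_trans jr ri.
by rewrite !ltr_pM2r// !ltr_nat !ltnS => -> ->.
Qed.

Lemma slab_disjoint i j : i <> j -> slab i `&` slab j = set0.
Proof.
move=> ij; apply/seteqP; split => // r [si sj]; apply: ij.
have [im|im] := ltnP i m; have [jm|jm] := ltnP j m.
- have [_ ri] := slab_pos im si; have [_ rj] := slab_pos jm sj.
  exact: natr_half_open_inj delta2 ri rj.
- have [r0 _] := slab_pos im si; have [r1 _] := slab_neg jm sj.
  by have := lt_trans r0 r1; rewrite ltxx.
- have [r0 _] := slab_neg im si; have [r1 _] := slab_pos jm sj.
  by have := lt_trans r0 r1; rewrite ltxx.
- have [_ ri] := slab_neg im si; have [_ rj] := slab_neg jm sj.
  have := natr_half_open_inj delta2 ri rj.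
  by move=> /(congr1 (addn^~ m)); rewrite !subnK.
Qed.

Lemma slab_measure i : fine (lebesgue_measure (slab i)) = delta / 2.
Proof.
rewrite /slab; case: ifP => _; rewrite lebesgue_measure_itv /= lte_fin.
  by rewrite -subr_gt0 step delta2 /= step.
by rewrite ltrN2 -subr_gt0 step delta2 /= opprK addrC step.
Qed.

Lemma slab_ok i : (i < m + m)%N -> measurable (slab i) /\ bounded_set (slab i).
Proof.
move=> i2; split; first by rewrite /slab; case: ifP => _; exact: measurable_itv.
apply: (@bounded_le_set R _ (m%:R * (delta / 2))) => r si.
have [im|im] := ltnP i m.
  have [r0 /andP[_ ri]] := slab_pos im si; rewrite gtr0_norm// (le_trans ri)//.
  by rewrite ler_pM2r// ler_nat.
have [r0 /andP[_ ri]] := slab_neg im si; rewrite ltr0_norm// (le_trans ri)//.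
by rewrite ler_pM2r// ler_nat ltn_subLR// leq_add2l.
Qed.

Lemma borel_forbidden c i : borel (forbidden c i).
Proof. by rewrite /forbidden; case: ifP => _; exact: borel_capcone. Qed.

(** Slab [j] and its mirror image each contribute [delta / 2] times a cap measure, and the two caps
    agree by [capN]. *)
Lemma pr_avoid_slabs c :
  measurable (avoid_all Rn th (m + m) slab (forbidden c)) /\
  pr Q (avoid_all Rn th (m + m) slab (forbidden c)) =
  expR (- (delta * \sum_(j < m) cap xs (c j))).
Proof.
have dA i j : (i < m + m)%N -> (j < m + m)%N -> i <> j -> slab i `&` slab j = set0.
  by move=> _ _; exact: slab_disjoint.
split; first exact: (measurable_avoid_all model slab_ok dA (borel_forbidden c)).
rewrite (pr_avoid_all model slab_ok dA (borel_forbidden c)).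
rewrite big_split_ord /= mulr_sumr; congr (expR (- _)).
rewrite -big_split /=; apply: eq_bigr => j _.
rewrite !slab_measure /forbidden ltn_ord ltnNge leq_addr /= addKn.
by rewrite -/(cap _ _) -/(cap _ _) capN; field.
Qed.

Lemma nat_half_open (x : R) : 0 < x -> exists i : nat, i%:R < x <= i.+1%:R.
Proof.
move=> x0; have /andP[h1 h2] := truncn_itv (ltW x0).
move: h1; rewrite le_eqVlt => /predU1P[h|h]; last by exists (Num.truncn x); rewrite h ltW.
move: h x0; case: (Num.truncn x) => [<-|n <- _]; first by rewrite ltxx.
by exists n; rewrite lexx andbT ltr_nat.
Qed.

Lemma slab_cover (r : R) : r != 0 -> `|r| <= m%:R * (delta / 2) ->
  exists2 j, (j < m)%N &
    j%:R * (delta / 2) < `|r| <= j.+1%:R * (delta / 2) /\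
    slab (if 0 < r then j else m + j) r.
Proof.
move=> r0 rm; have rp : 0 < `|r| by rewrite normr_gt0.
have [j] := nat_half_open (divr_gt0 rp delta2).
rewrite ltr_pdivlMr// ler_pdivrMr// => jr; exists j.
  have /andP[jr' _] := jr; have := lt_le_trans jr' rm.
  by rewrite ltr_pM2r// ltr_nat.
have jm : (j < m)%N.
  have /andP[jr' _] := jr; have := lt_le_trans jr' rm.
  by rewrite ltr_pM2r// ltr_nat.
split => //; have [r1|r1] := ltP 0 r.
  by rewrite /slab jm /= in_itv /=; move: jr; rewrite gtr0_norm.
have {}r1 : r < 0 by rewrite lt_neqAle r0.
rewrite /slab ltnNge leq_addr /= addKn in_itv /=.
by move: jr; rewrite ltr0_norm// ltrNr lerNl andbC.
Qed.

(** In slab [j] one has [2 |r| <= (j + 1) delta], so a mark in the cap at that threshold would cut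
    off a point of [xs]. *)
Lemma pr_contains_le :
  pr Q (contains xs) <= expR (- (delta * \sum_(j < m) cap xs (j.+1%:R * delta))).
Proof.
have [mS S1] := on_sphere_full model.
have [mA <-] := pr_avoid_slabs (fun j => j.+1%:R * delta).
rewrite -(pr_setI_full (measurable_contains xs) mS S1).
apply: le_pr => //; first by apply: measurableI => //; exact: measurable_contains.
move=> w [cw sw] n; case E: cell_of => [i|//].
have dA i' j' : (i' < m + m)%N -> (j' < m + m)%N -> i' <> j' -> slab i' `&` slab j' = set0.
  by move=> _ _; exact: slab_disjoint.
have /(cell_ofP dA) si := E.
rewrite /avoid /forbidden; have [im|im] := ltnP i m.
  have [r0 /andP[_ ri]] := slab_pos im si.
  move=> [x xxs]; rewrite sw mulr1 => xt; have := cw x xxs n.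
  rewrite gtr0_sg// mul1r gtr0_norm// leNgt (le_lt_trans _ xt)//.
  by move: ri; lra.
have [r0 /andP[_ ri]] := slab_neg im si.
move=> [_ /mapP[x xxs ->]]; rewrite sw mulr1 dotpNl => xt; have := cw x xxs n.
rewrite ltr0_sg// mulN1r ltr0_norm// leNgt (le_lt_trans _ xt)//.
by move: ri; lra.
Qed.

(** In slab [j] one has [j delta < 2 |r|], so avoiding the cap at [j delta] suffices. Radii beyond
    the last slab cut nothing off, because [|x . v| <= L <= m delta]. *)
Lemma pr_contains_ge :
  expR (- (delta * \sum_(j < m) cap xs (j%:R * delta))) <= pr Q (contains xs).
Proof.
have [mS S1] := on_sphere_full model.
have [mA <-] := pr_avoid_slabs (fun j => j%:R * delta).
rewrite -(pr_setI_full mA mS S1).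
apply: le_pr => //; [exact: measurableI|exact: measurable_contains|].
have dA i' j' : (i' < m + m)%N -> (j' < m + m)%N -> i' <> j' -> slab i' `&` slab j' = set0.
  by move=> _ _; exact: slab_disjoint.
move=> w [aw sw] x xxs n; have [R0|R0] := eqVneq (Rn n w) 0.
  by rewrite R0 sgr0 normr0 mul0r mulr0.
have [Rm|Rm] := leP `|Rn n w| (m%:R * (delta / 2)); last first.
  rewrite (le_trans (ler_norm _))// normrM normr_sg R0 mul1r.
  rewrite (le_trans (dotp_le_l1norm _ _))// sw mulr1.
  rewrite (le_trans (l1norm_le_total xxs))// (le_trans Lt)//.
  by move: Rm; lra.
have [j jm [/andP[jr _] sj]] := slab_cover R0 Rm.
have jr2 : j%:R * delta <= 2 * `|Rn n w| by move: jr; lra.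
rewrite (le_trans _ jr2)// leNgt; apply/negP => xt.
have := aw n.
have [R1|R1] := ltP 0 (Rn n w); rewrite ?R1 in sj.
  have jmm : (j < m + m)%N by rewrite ltn_addr.
  have -> : cell_of (m + m) slab (Rn n w) = Some (Ordinal jmm) by exact/(cell_ofP dA).
  rewrite /avoid /forbidden /= jm; apply; exists x => //.
  by rewrite sw mulr1; move: xt; rewrite gtr0_sg// mul1r.
have {}R1 : Rn n w < 0 by rewrite lt_neqAle R0.
rewrite ltNge (ltW R1) /= in sj.
have jmm : (m + j < m + m)%N by rewrite ltn_add2l.
have -> : cell_of (m + m) slab (Rn n w) = Some (Ordinal jmm) by exact/(cell_ofP dA).
rewrite /avoid /forbidden /= ltnNge leq_addr /= addKn; apply; exists (- x).
  by apply/mapP; exists x.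
by rewrite sw mulr1; move: xt; rewrite ltr0_sg// mulN1r dotpNl.
Qed.

End Sandwich.

End PolytopeProbability.

(** * Traces of convex sets on grids *)

Section GridPatterns.
Import numFieldNormedType.Exports.
Context {R : realType} {d : nat}.
Local Notation V := 'rV[R]_d.
Implicit Types (A Y Z : set V) (x y z : V).

Definition convex_body A := forall x y (c : R), A x -> A y -> 0 <= c <= 1 ->
  A (c *: x + (1 - c) *: y).

(** With mesh [1 / (n + 1)] on the cube of radius [n + 1] there are [2 (n + 1)^2 + 1] values per
    coordinate; a single parameter refines and enlarges the grid. *)
Definition grid_index n := {ffun 'I_d -> 'I_(2 * n.+1 ^ 2).+1}.

Definition grid_point n (k : grid_index n) : V :=
  \row_i (((k i)%:R - (n.+1 ^ 2)%:R) / n.+1%:R).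

Lemma grid_approx n x : `|x| <= n.+1%:R ->
  exists k : grid_index n, `|grid_point k - x| <= n.+1%:R^-1.
Proof.
move=> xn; have n0 : 0 < n.+1%:R :> R by rewrite ltr0n.
pose t i := x ord0 i * n.+1%:R + (n.+1 ^ 2)%:R.
have xi i : `|x ord0 i| <= n.+1%:R := le_trans (coord_le_norm x i) xn.
have t0 i : 0 <= t i.
  rewrite /t natrX expr2 -mulrDl; apply: mulr_ge0; last exact: ltW.
  by have := xi i; rewrite ler_norml => /andP[+ _]; lra.
have tN i : t i <= (2 * n.+1 ^ 2)%:R.
  rewrite /t natrM natrX expr2 mulrA -mulrDl ler_pM2r//.
  by have := xi i; rewrite ler_norml => /andP[_ +]; lra.
have kN i : (Num.truncn (t i) < (2 * n.+1 ^ 2).+1)%N.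
  by rewrite ltnS -(ler_nat R) (le_trans _ (tN i))// truncn_le.
exists [ffun i => Ordinal (kN i)]; apply: normr_le_coord => [|i].
  by rewrite invr_ge0 ltW.
rewrite !mxE ffunE /=.
have -> : ((Num.truncn (t i))%:R - (n.+1 ^ 2)%:R) / n.+1%:R - x ord0 i =
    ((Num.truncn (t i))%:R - t i) / n.+1%:R.
  by rewrite /t; field; rewrite gt_eqF.
rewrite normrM (gtr0_norm (_ : 0 < n.+1%:R^-1)) ?invr_gt0//.
rewrite ler_piMl ?invr_ge0 ?ler0n// ler_norml.
have /andP[h1 h2] := truncn_itv (t0 i); rewrite -natr1 in h2.
by apply/andP; split; lra.
Qed.

Lemma convex_average A (I : eqType) (s : seq I) (z : I -> V) : convex_body A ->
  (0 < size s)%N -> (forall i, A (z i)) ->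
  A ((size s)%:R^-1 *: \sum_(i <- s) z i).
Proof.
move=> cA + Az; case: s => // i0 s _.
elim: s i0 => [|i s IH] i0; first by rewrite big_seq1 invr1 scale1r.
rewrite big_cons; set S := \sum_(j <- _) _.
have n0 : (size (i :: s)).+1%:R != 0 :> R by rewrite pnatr_eq0.
have m0 : (size (i :: s))%:R != 0 :> R by rewrite pnatr_eq0.
pose c : R := (size (i :: s)).+1%:R^-1.
rewrite [X in A X](_ : _ = c *: z i0 + (1 - c) *: ((size (i :: s))%:R^-1 *: S)).
  apply: cA => //.
  by rewrite invr_ge0 ler0n invf_le1 ?ltr0n// ler1n.
rewrite scalerDr scalerA; congr (_ + _ *: _).
by rewrite /c -natr1; field; rewrite -natr1 in n0; rewrite n0 m0.
Qed.

Lemma convex_segment0 A x (c : R) : convex_body A -> A 0 -> A x -> 0 <= c <= 1 -> A (c *: x).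
Proof. by move=> cA A0 Ax c01; have := cA x 0 c Ax A0 c01; rewrite scaler0 addr0. Qed.

Hypothesis d_gt0 : (0 < d)%N.

(** The point [x] is the average of the [d] axis points [d x_i e_i], each of which lies on a segment
    from 0 to [r e_i] or [- r e_i]. *)
Lemma convex_cube A (r : R) : convex_body A -> A 0 -> 0 < r ->
  (forall i, A (r *: delta_mx 0 i)) -> (forall i, A (- (r *: delta_mx 0 i))) ->
  forall x, `|x| <= r / d%:R -> A x.
Proof.
move=> cA A0 r0 Ap An x xr.
have d0 : d%:R != 0 :> R by rewrite pnatr_eq0 -lt0n.
pose z i : V := (d%:R * x ord0 i) *: delta_mx 0 i.
have Az i : A (z i).
  have xi : `|d%:R * x ord0 i| <= r.
    rewrite normrM ger0_norm ?ler0n// mulrC -ler_pdivlMr ?ltr0n//.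
    exact: le_trans (coord_le_norm x i) xr.
  have [x0|x0] := leP 0 (d%:R * x ord0 i).
    rewrite /z -[d%:R * _](@divfK _ r) ?gt_eqF// -scalerA.
    apply: convex_segment0 => //; rewrite divr_ge0 ?(ltW r0)//=.
    by rewrite ler_pdivrMr// mul1r -[leLHS]ger0_norm.
  rewrite /z -[d%:R * _]opprK scaleNr -scalerN -[- (d%:R * _)](@divfK _ r) ?gt_eqF//.
  rewrite -scalerA scalerN; apply: convex_segment0 => //.
  rewrite divr_ge0 ?(ltW r0) ?oppr_ge0 ?(ltW x0)//=.
  by rewrite ler_pdivrMr// mul1r -[leLHS]gtr0_norm ?oppr_gt0// normrN.
have := @convex_average A _ (index_enum 'I_d) z cA _ Az.
have sd : size (index_enum 'I_d) = d.
  by rewrite -[RHS]card_ord cardT enumT.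
rewrite sd => /(_ d_gt0); congr A.
rewrite scaler_sumr [RHS]matrix_sum_delta big_ord1; apply: eq_bigr => i _.
by rewrite /z scalerA mulKf.
Qed.

Section Agree.
Variables (n : nat) (Y Z : set V).
Hypotheses (cY : convex_body Y) (cZ : convex_body Z)
  (YZ : forall k : grid_index n, Z (grid_point k) <-> Y (grid_point k)).
Local Notation mesh := (n.+1%:R^-1 : R).

Let n0 : 0 < n.+1%:R :> R. Proof. by rewrite ltr0n. Qed.

Lemma axis_grid_point (j : nat) i (s : bool) : (j <= n.+1 ^ 2)%N ->
  exists k : grid_index n, grid_point k = (-1) ^+ s *: ((j%:R / n.+1%:R) *: delta_mx 0 i).
Proof.
move=> jn; pose v l := if l == i then (if s then n.+1 ^ 2 - j else n.+1 ^ 2 + j)%N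
  else (n.+1 ^ 2)%N.
have vN (l : 'I_d) : (v l < (2 * n.+1 ^ 2).+1)%N.
  rewrite /v ltnS mul2n -addnn; case: eqP => _; last exact: leq_addr.
  by case: (s); [rewrite (leq_trans (leq_subr _ _))// leq_addr|rewrite leq_add2l].
exists [ffun l => Ordinal (vN l)]; apply/rowP => l; rewrite !mxE ffunE /= /v ?eqxx /=.
case: eqP => _; last by rewrite subrr mul0r !mulr0.
by case: (s); rewrite /= ?(natrB _ jn) ?natrD ?expr0 ?expr1 ?mulr1; ring.
Qed.

(** The largest axis grid points within [rho] lie in [Y], hence in [Z], and have size at least
    [rho / 2]; [convex_cube] then fills a cube of [Z]. *)
Lemma agree_cube (rho : R) : 0 < rho -> mesh <= rho / 2 -> rho <= n.+1%:R ->
  (forall x, `|x| <= rho -> Y x) -> forall x, `|x| <= rho / 2 / d%:R -> Z x.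
Proof.
move=> r0 mr rn Yr.
pose j := Num.truncn (rho * n.+1%:R).
have /andP[jl ju] : j%:R <= rho * n.+1%:R < j.+1%:R.
  by apply: truncn_itv; rewrite mulr_ge0 ?ltW.
have jn : (j <= n.+1 ^ 2)%N.
  by rewrite -(ler_nat R) (le_trans jl)// natrX expr2 ler_pM2r.
pose r : R := j%:R / n.+1%:R.
have rr : r <= rho by rewrite ler_pdivrMr.
have rl : rho / 2 <= r.
  move: ju; rewrite -[j.+1%:R]natr1 -ltrBlDr -(ltr_pM2r (_ : 0 < n.+1%:R^-1)) ?invr_gt0//.
  by rewrite mulrBl mulfK ?gt_eqF// mul1r -/r; move: mr; move: (n.+1%:R^-1) => e; lra.
have rp : 0 < r by rewrite (lt_le_trans _ rl)// divr_gt0.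
have axis i (s : bool) : Z ((-1) ^+ s *: (r *: delta_mx 0 i)).
  have [k kE] := axis_grid_point i s jn; rewrite -kE; apply/YZ; apply: Yr.
  rewrite kE; apply: normr_le_coord => [|l]; first exact: ltW.
  rewrite !mxE ?eqxx /= normrM normrX normrN1 expr1n mul1r normrM (gtr0_norm rp).
  by case: eqP => _; rewrite ?normr1 ?normr0 ?mulr1 ?mulr0// ltW.
have Z0 : Z 0.
  have [k] := axis_grid_point (Ordinal d_gt0) false (leq0n _).
  by rewrite mul0r scale0r scaler0 => kE; rewrite -kE; apply/YZ; rewrite kE; apply: Yr; rewrite normr0 ltW.
move=> x xr; apply: (convex_cube cZ Z0 rp) => [i|i|].
- by have := axis i false; rewrite expr0 scale1r.
- by have := axis i true; rewrite expr1 scaleN1r.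
- by rewrite (le_trans xr)// ler_pM2r// invr_gt0 ltr0n.
Qed.

(** Shrink [z] towards the origin and round to the grid. The rounding error is absorbed by the cube
    inside [A], so the rounded point stays in [A]. *)
Lemma near_grid A (r e : R) z : convex_body A -> (forall x, `|x| <= r -> A x) ->
  0 < e -> e <= 1 -> mesh <= e * r -> A z -> `|z| <= n.+1%:R ->
  exists k : grid_index n, A (grid_point k) /\ `|z - grid_point k| <= e * `|z| + mesh.
Proof.
move=> cA Ar e0 e1 me Az zn.
have e1' : 0 <= 1 - e by rewrite subr_ge0.
have [|k kz] := @grid_approx n ((1 - e) *: z).
  rewrite normrZ ger0_norm// (le_trans _ zn)// ler_piMl//.
  by rewrite lerBlDr lerDl ltW.
exists k; set g := grid_point k in kz *; set u := g - (1 - e) *: z in kz *.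
(* The grid point as a convex combination of [z] and [u / e]; the latter has norm at most
   [mesh / e <= r]. *)
have gE : g = (1 - e) *: z + e *: (e^-1 *: u).
  by rewrite scalerA divff ?gt_eqF// scale1r /u addrC subrK.
have Au : A (e^-1 *: u).
  apply: Ar; rewrite normrZ gtr0_norm ?invr_gt0// ler_pdivrMl//.
  exact: le_trans kz me.
split.
  have := cA z (e^-1 *: u) (1 - e) Az Au; rewrite (_ : 1 - (1 - e) = e); last by ring.
  by rewrite -gE; apply; rewrite e1' lerBlDr lerDl ltW.
rewrite (_ : z - g = e *: z - u); last first.
  by rewrite /u opprB scalerBl scale1r addrA (addrC (e *: z)) subrK.
by rewrite (le_trans (ler_normB _ _))// lerD// normrZ gtr0_norm.
Qed.

End Agree.

(** Every point of one set is near a grid point of that set by [near_grid], and the grid points are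
    shared. The threshold [N] depends on [Y] alone: the cube inside [Z] and the bound on [Z] are
    both deduced from the common trace. *)
Lemma pattern_close Y (M rho eta : R) : convex_body Y -> 0 < rho -> 0 < eta ->
  (forall x, Y x -> `|x| <= M) -> (forall x, `|x| <= rho -> Y x) ->
  exists N, forall n, (N <= n)%N -> forall Z, convex_body Z ->
    (forall k : grid_index n, Z (grid_point k) <-> Y (grid_point k)) ->
    (forall y, Y y -> exists2 z, Z z & `|y - z| <= eta) /\
    (forall z, Z z -> exists2 y, Y y & `|z - y| <= eta).
Proof.
move=> cY r0 eta0 YM Yr.
have d0 : 0 < d%:R :> R by rewrite ltr0n.
have d1 : 1 <= d%:R :> R by rewrite ler1n.
have Y0 : Y 0 by apply: Yr; rewrite normr0 ltW.
have M0 : 0 <= M by rewrite -(normr0 V) YM.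
pose rho' := rho / 2 / d%:R.
have r0' : 0 < rho' by rewrite !divr_gt0.
have rr' : rho' <= rho.
  by rewrite ler_pdivrMr// ler_pdivrMr// -mulrA ler_peMr ?(ltW r0)//; lra.
(* Makes [e |z|] at most [eta / 2] and at most [1 / 4] for all [z] of norm up to [M + 1]. *)
pose e := Num.min (eta / 2) (1 / 4) / (M + 1).
have M1 : 0 < M + 1 by lra.
have m0 : 0 < Num.min (eta / 2) (1 / 4) by rewrite lt_min !divr_gt0.
have m1 : Num.min (eta / 2) (1 / 4) <= eta / 2 by rewrite ge_min lexx.
have m2 : Num.min (eta / 2) (1 / 4) <= 1 / 4 by rewrite ge_min lexx orbT.
have e0 : 0 < e by rewrite divr_gt0.
have eM : e * (M + 1) = Num.min (eta / 2) (1 / 4) by rewrite /e divfK ?gt_eqF.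
have e1 : e <= 1.
  have : e * 1 <= e * (M + 1) by rewrite ler_pM2l//; lra.
  by rewrite eM mulr1; lra.
pose B := (e * rho')^-1 + 2 / eta + 4 + 2 / rho + (M + 1) + rho.
have b1 : 0 < (e * rho')^-1 by rewrite invr_gt0 mulr_gt0.
have b2 : 0 < 2 / eta by rewrite divr_gt0.
have b3 : 0 < 2 / rho by rewrite divr_gt0.
exists (Num.truncn B) => n Nn Z cZ YZ.
have Bn : B < n.+1%:R.
  by rewrite (lt_le_trans (truncnS_gt B))// ler_nat.
have n0 : 0 < n.+1%:R :> R by rewrite ltr0n.
have mesh_le (a : R) : 0 < a -> a^-1 <= n.+1%:R -> n.+1%:R^-1 <= a.
  by move=> a0 an; rewrite invf_ple.
have h1 : n.+1%:R^-1 <= e * rho'.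
  by apply: mesh_le; [rewrite mulr_gt0|rewrite /B in Bn; lra].
have h2 : n.+1%:R^-1 <= eta / 2.
  by apply: mesh_le; [rewrite divr_gt0|rewrite invf_div; rewrite /B in Bn; lra].
have h3 : n.+1%:R^-1 <= 1 / 4 :> R.
  by apply: mesh_le; [rewrite divr_gt0|rewrite invf_div divr1; rewrite /B in Bn; lra].
have h4 : n.+1%:R^-1 <= rho / 2.
  by apply: mesh_le; [rewrite divr_gt0|rewrite invf_div; rewrite /B in Bn; lra].
have h5 : M + 1 <= n.+1%:R by rewrite /B in Bn; lra.
have h6 : rho <= n.+1%:R by rewrite /B in Bn; lra.
have Zr := agree_cube cZ YZ r0 h4 h6 Yr.
have Z0 : Z 0 by apply: Zr; rewrite normr0 ltW.
have bound (z : V) : `|z| <= M + 1 -> e * `|z| + n.+1%:R^-1 <= Num.min (eta / 2) (1 / 4) + n.+1%:R^-1.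
  by move=> zM; rewrite lerD2r -eM ler_pM2l.
split => [y Yy|z Zz].
  have yM : `|y| <= M + 1 by rewrite (le_trans (YM _ Yy))// lerDl.
  have h1' : n.+1%:R^-1 <= e * rho by rewrite (le_trans h1)// ler_pM2l.
  have [|k [Yk yk]] := near_grid cY Yr e0 e1 h1' Yy; first exact: le_trans yM h5.
  exists (grid_point k); first exact/YZ.
  by rewrite (le_trans yk)// (le_trans (bound _ yM))//; move: h2; move: (n.+1%:R^-1) => u; lra.
have zM : `|z| <= M + 1.
  rewrite leNgt; apply/negP => Mz.
  have z0 : 0 < `|z| by rewrite (lt_trans M1).
  (* A point of [Z] beyond [M + 1] is pulled back to norm exactly [M + 1]. A grid point of [Z] lies
     within [1 / 2] of it, yet belongs to [Y] and has norm at most [M]: a contradiction. *)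
  pose z' := ((M + 1) / `|z|) *: z.
  have z'n : `|z'| = M + 1.
    by rewrite normrZ gtr0_norm ?divr_gt0// divfK// gt_eqF.
  have Zz' : Z z'.
    apply: convex_segment0 => //; rewrite divr_ge0 ?(ltW M1) ?(ltW z0)//=.
    by rewrite ler_pdivrMr// mul1r ltW.
  have [|k [Zk zk]] := near_grid cZ Zr e0 e1 h1 Zz'; first by rewrite z'n.
  have gM : `|grid_point k| <= M by apply: YM; exact/YZ.
  have := bound z'; rewrite z'n lexx => /(_ isT) bz.
  have := ler_normD (z' - grid_point k) (grid_point k); rewrite subrK z'n.
  by move: zk bz h3; rewrite z'n; move: (n.+1%:R^-1) => u; lra.
have [|k [Zk zk]] := near_grid cZ Zr e0 e1 h1 Zz; first exact: le_trans zM h5.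
exists (grid_point k); first exact/YZ.
by rewrite (le_trans zk)// (le_trans (bound _ zM))//; move: h2; move: (n.+1%:R^-1) => u; lra.
Qed.

Lemma dH_lt (Y Z : set V) (eta delta : R) : 0 < eta -> d%:R * eta < delta ->
  (forall y, Y y -> exists2 z, Z z & `|y - z| <= eta) ->
  (forall z, Z z -> exists2 y, Y y & `|z - y| <= eta) -> (dH Y Z < delta%:E)%E.
Proof.
move=> eta0 ed YZ ZY; rewrite /dH gt_max; apply/andP; split.
  apply: (@le_lt_trans _ _ (d%:R * eta)%:E); last by rewrite lte_fin.
  apply: ge_ereal_sup => _ [y /YZ[z Zz yz] <-].
  apply: (@le_trans _ _ (enorm (y - z))%:E).
    by apply: ereal_inf_lbound; exists z.
  by rewrite lee_fin (le_trans (enorm_le_norm _))// ler_wpM2l.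
apply: (@le_lt_trans _ _ (d%:R * eta)%:E); last by rewrite lte_fin.
apply: ge_ereal_sup => _ [z /ZY[y Yy zy] <-].
apply: (@le_trans _ _ (enorm (y - z))%:E).
  by apply: ereal_inf_lbound; exists y.
by rewrite lee_fin (le_trans (enorm_le_norm _))// ler_wpM2l// distrC.
Qed.

End GridPatterns.

(** * Convergence of containment probabilities *)

Section FiniteContainment.
Import numFieldNormedType.Exports.
Context {R : realType} {d : nat}.
Local Notation V := 'rV[R]_d.
Context dT (T : measurableType dT) (P : R -> probability T R) (C : R -> T -> set V)
  dT' (T' : measurableType dT') (Q : probability T' R)
  (Rn : nat -> T' -> R) (th : nat -> T' -> V).
Hypotheses (d_gt0 : (0 < d)%N)
  (pppC : forall lam : R, 0 < lam -> ppp_ball (P lam) lam (C lam))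
  (model : hyperplane_model Q Rn th).

Definition scaled_model lam w : set V := scale (@Sd R d * lam) (Iset (C lam w)).

Definition scaled_crofton w : set V :=
  scale 2 (crofton (fun n => Rn n w) (fun n => th n w)).

Let Sd0 : 0 < @Sd R d.
Proof. by rewrite mulr_gt0 ?ltr0n// (omega_gt0 model). Qed.

Lemma scaleE (a : R) (A : set V) x : 0 < a -> scale a A x <-> A (a^-1 *: x).
Proof.
move=> a0; split => [[y Ay <-]|Ax].
  by rewrite scalerA mulVf ?gt_eqF// scale1r.
by exists (a^-1 *: x); rewrite // scalerA divff ?gt_eqF// scale1r.
Qed.

Lemma scaled_model_contains lam w xs : 0 < lam ->
  (forall x, x \in xs -> Ball ((@Sd R d * lam)^-1 *: x)) ->
  (forall x, x \in xs -> scaled_model lam w x) <->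
  C lam w `&` exceed xs (@Sd R d * lam)^-1 = set0.
Proof.
move=> lam0 xB; have a0 : 0 < @Sd R d * lam by rewrite mulr_gt0.
split => [H|H x xxs].
  apply/seteqP; split => // c [Cc [x xxs]].
  have /(scaleE _ _ a0)[_ /(_ c Cc)] := H x xxs.
  by rewrite /Ball /= ltNge => ->.
apply/(scaleE _ _ a0); split; first exact: xB.
move=> c Cc; rewrite /Ball /= leNgt; apply/negP => xc.
have : (C lam w `&` exceed xs (@Sd R d * lam)^-1) c by split => //; exists x.
by rewrite H.
Qed.

Lemma measurable_scaled_model lam x : 0 < lam ->
  measurable [set w | scaled_model lam w x].
Proof.
move=> lam0; have a0 : 0 < @Sd R d * lam by rewrite mulr_gt0.
have [xB|xB] := pselect (Ball ((@Sd R d * lam)^-1 *: x)).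
  rewrite (_ : mkset _ = [set w | C lam w `&` exceed [:: x] (@Sd R d * lam)^-1 = set0]).
    exact: (measurable_void (pppC lam0) (@borel_exceed R d _ _)).
  have xsB y : y \in [:: x] -> Ball ((@Sd R d * lam)^-1 *: y) by rewrite inE => /eqP ->.
  apply/seteqP; split => w.
    by move=> wx; apply/(scaled_model_contains w lam0 xsB) => y; rewrite inE => /eqP ->.
  by move=> /(scaled_model_contains w lam0 xsB); apply; rewrite inE.
rewrite (_ : mkset _ = set0)//; apply/seteqP; split => // w.
by move=> /(scaleE _ _ a0)[].
Qed.

Lemma scaled_crofton_polytope w : (forall n, Rn n w != 0) ->
  scaled_crofton w = polytope (fun n => Rn n w) (fun n => th n w).
Proof. exact: scale2_crofton. Qed.

(** The origin lies on a hyperplane, and the connected component of a point outside the set is empty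
    by convention. *)
Lemma scaled_crofton_set0 w n : Rn n w = 0 -> scaled_crofton w = set0.
Proof.
move=> R0; rewrite /scaled_crofton /crofton connected_component_out ?closure0 /scale ?image_set0//.
by apply; exists n => //; rewrite /hyperplane /= dotp0l R0.
Qed.

(** Valid for every [w], exceptional ones included; this makes containment a measurable event as it
    stands. *)
Lemma scaled_crofton_iff w x : scaled_crofton w x <->
  (forall n, Rn n w != 0) /\ polytope (fun n => Rn n w) (fun n => th n w) x.
Proof.
have [R0|/existsNP[n /negP]] := pselect (forall n, Rn n w != 0).
  by rewrite scaled_crofton_polytope//; split => // -[].
rewrite negbK => /eqP Rn0; rewrite (scaled_crofton_set0 Rn0).
by split => // -[/(_ n)]; rewrite Rn0 eqxx.
Qed.

Lemma measurable_scaled_crofton x : measurable [set w | scaled_crofton w x].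
Proof.
rewrite (_ : mkset _ = \bigcap_n [set w | Rn n w != 0] `&`
  [set w | polytope (fun n => Rn n w) (fun n => th n w) x]).
  apply: measurableI; last exact: (measurable_in_polytope model).
  apply: bigcapT_measurable => n.
  rewrite (_ : mkset _ = [set w | (~` [set 0]) (Rn n w)]).
    by apply: (measurable_Rn model); apply: measurableC; exact: measurable_set1.
  by apply/seteqP; split => w /= /eqP.
apply/seteqP; split => w.
  by move=> /scaled_crofton_iff[Rw xw]; split => // n _; exact: Rw.
by move=> [Rw xw]; apply/scaled_crofton_iff; split => // n; exact: Rw.
Qed.

Lemma pr_scaled_crofton xs :
  pr Q [set w | forall x, x \in xs -> scaled_crofton w x] = pr Q (contains Rn th xs).
Proof.
have [mG G1] := good_full model.
have mC := measurable_contains model xs.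
have mD : measurable [set w | forall x, x \in xs -> scaled_crofton w x].
  rewrite (_ : mkset _ = \bigcap_(x in [set` xs]) [set w | scaled_crofton w x]).
    by apply: fin_bigcap_measurable => // x _; exact: measurable_scaled_crofton.
  by apply/seteqP; split => w H x; exact: H.
rewrite -(pr_setI_full mC mG G1) -(pr_setI_full mD mG G1); congr (pr Q _).
have E w x : good Rn th w -> scaled_crofton w x <->
    polytope (fun n => Rn n w) (fun n => th n w) x.
  by move=> /good_Rn_neq0 R0; rewrite scaled_crofton_polytope.
by apply/seteqP; split => w [H gw]; split => // x /H /(E w x gw).
Qed.

Lemma cap_ge0 (xs : seq V) t : 0 <= cap xs t.
Proof. exact: (unifS_ge0 model (@borel_capcone R d xs t)). Qed.

Lemma cap_le1 (xs : seq V) t : cap xs t <= 1.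
Proof. exact: (unifS_le1 model (@borel_capcone R d xs t)). Qed.

Lemma cap_nincr (xs : seq V) t u : t <= u -> cap xs u <= cap xs t.
Proof.
move=> tu; apply: (le_unifS model); [exact: borel_capcone|exact: borel_capcone|].
move=> v [x xxs xv]; exists x => //.
by rewrite (le_lt_trans _ xv)// ler_wpM2r// enorm_ge0.
Qed.

Lemma expR_diff_le (a b : R) : 0 <= b -> b <= a -> expR (- b) - expR (- a) <= a - b.
Proof.
move=> b0 ba; have -> : expR (- a) = expR (- b) * expR (- (a - b)).
  by rewrite -expRD; congr expR; ring.
have e1 : expR (- b) <= 1 by rewrite -expR0 ler_expR oppr_le0.
have e0 : 0 < expR (- b) by exact: expR_gt0.
have := @expR_ge1Dx R (- (a - b)); set u := expR (- (a - b)) => u1.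
have : u <= 1 by rewrite -expR0 ler_expR oppr_le0 subr_ge0.
nra.
Qed.

(** The sums telescope to three boundary terms at each end. The shift is 3 because the two shell
    estimates use the thresholds [(j - 1) delta] and [(j + 2) delta]. *)
Lemma sum_shift3_le (g : nat -> R) m : (forall n, 0 <= g n <= 1) ->
  \sum_(j < m) g j - \sum_(j < m) g j.+3 <= 3.
Proof.
move=> g01; suff -> : \sum_(j < m) g j - \sum_(j < m) g j.+3 =
    g 0%N + g 1%N + g 2%N - (g m + g m.+1 + g m.+2).
  have /andP[_ ?] := g01 0%N; have /andP[_ ?] := g01 1%N; have /andP[_ ?] := g01 2%N.
  have /andP[? _] := g01 m; have /andP[? _] := g01 m.+1; have /andP[? _] := g01 m.+2.
  by lra.
elim: m => [|m IH]; first by rewrite !big_ord0; ring.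
rewrite !big_ord_recr /=; move: IH; lra.
Qed.

(** Both probabilities lie between [exp (- A)] and [exp (- (1 - delta) B)]. Here [A - B <= 3 delta]
    by telescoping and [delta B <= delta (L + 1)], whence [(L + 4) delta]. Each term of the lower
    bound on [a] secures one of the smallness conditions [c1] to [c5]. *)
Lemma containment_close xs (delta : R) (m : nat) lam :
  let L := total_l1norm xs in let a := @Sd R d * lam in
  0 < lam -> 0 < delta -> delta <= 1 -> m%:R * delta = L + 1 ->
  2 * (L + 1) + L ^+ 2 / delta + (L + 1) ^+ 2 / delta + d%:R * (L + 1) / delta + L <= a ->
  `| pr (P lam) [set w | forall x, x \in xs -> scaled_model lam w x] -
     pr Q [set w | forall x, x \in xs -> scaled_crofton w x] | <= (L + 4) * delta.
Proof.
move=> L a lam0 dl0 dl1 mE aK.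
have L0 : 0 <= L := total_l1norm_ge0 xs.
have a0 : 0 < a by rewrite mulr_gt0.
have s_le (u v : R) : 0 < v -> u / v <= a -> a^-1 * u <= v.
  by move=> v0; rewrite ler_pdivrMr// => h; rewrite ler_pdivrMl.
have p1 : 0 <= L ^+ 2 / delta by rewrite divr_ge0 ?sqr_ge0// ltW.
have p2 : 0 <= (L + 1) ^+ 2 / delta by rewrite divr_ge0 ?sqr_ge0// ltW.
have p3 : 0 <= d%:R * (L + 1) / delta.
  by rewrite divr_ge0 ?mulr_ge0 ?ler0n ?addr_ge0// ltW.
have c1 : a^-1 * (m%:R * delta) <= 1 / 2.
  by rewrite mE; apply: s_le => //; lra.
have c2 : a^-1 * L ^+ 2 <= delta by apply: s_le => //; lra.
have c3 : a^-1 * (m%:R * delta) ^+ 2 <= delta by rewrite mE; apply: s_le => //; lra.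
have c4 : d%:R * (a^-1 * (m%:R * delta)) <= delta.
  by rewrite mE mulrCA; apply: s_le => //; lra.
have c5 : a^-1 * L <= 1 by apply: s_le => //; lra.
have Lm : L <= m%:R * delta by rewrite mE; lra.
have xB x : x \in xs -> Ball (a^-1 *: x).
  move=> /l1norm_le_total xL; rewrite /Ball /= enormZ gtr0_norm ?invr_gt0//.
  rewrite (le_trans _ c5)// ler_pM2l ?invr_gt0//.
  exact: le_trans (enorm_le_l1norm x) xL.
rewrite pr_scaled_crofton.
have -> : [set w | forall x, x \in xs -> scaled_model lam w x] =
    [set w | C lam w `&` exceed xs a^-1 = set0].
  by apply/seteqP; split => w /(scaled_model_contains w lam0 xB).
have vB := vol_BallE model; have o0 := omega_gt0 model.
have lo1 := void_exceed_ge lam0 (pppC lam0) d_gt0 vB o0 dl0 Lm c1 c2 c4 (cap_ge0 xs).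
have up1 := void_exceed_le lam0 (pppC lam0) d_gt0 vB o0 dl0 c1 c3 c4 (cap_ge0 xs).
have lo2 := pr_contains_ge model dl0 Lm.
have up2 := @pr_contains_le _ _ _ _ _ _ _ model xs m delta dl0.
pose g j := cap xs (j%:R * delta - delta).
set A := delta * \sum_(j < m) cap xs (j%:R * delta - delta) in lo1.
set B := delta * \sum_(j < m) cap xs (j%:R * delta + 2 * delta).
have BE : (1 - delta) * delta * \sum_(j < m) cap xs (j%:R * delta + 2 * delta) =
    (1 - delta) * B by rewrite /B mulrA.
rewrite BE in up1.
have B0 : 0 <= B by rewrite mulr_ge0 ?(ltW dl0)// sumr_ge0// => j _; exact: cap_ge0.
have Bm : B <= L + 1.
  rewrite -mE mulrC ler_pM2l//.
  rewrite (le_trans (ler_sum _ (fun (j : 'I_m) _ => cap_le1 xs (j%:R * delta + 2 * delta))))//.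
  by rewrite sumr_const card_ord.
have AB : A - B <= 3 * delta.
  rewrite /A /B -mulrBr mulrC ler_pM2r//.
  rewrite (_ : \sum_(j < m) cap xs (j%:R * delta + 2 * delta) = \sum_(j < m) g j.+3).
    by apply: sum_shift3_le => j; rewrite cap_ge0 cap_le1.
  apply: eq_bigr => j _; rewrite /g; congr (cap xs _).
  by rewrite -[j.+3]addn3 natrD; ring.
have lo2' : expR (- A) <= pr Q (contains Rn th xs).
  rewrite (le_trans _ lo2)// ler_expR lerN2 ler_pM2l// ler_sum// => j _.
  by apply: cap_nincr; lra.
have up2' : pr Q (contains Rn th xs) <= expR (- ((1 - delta) * B)).
  rewrite (le_trans up2)// ler_expR lerN2 (@le_trans _ _ B)//.
    by rewrite ler_piMl// lerBlDr lerDl ltW.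
  by rewrite ler_pM2l// ler_sum// => j _; apply: cap_nincr; rewrite -natr1; lra.
have dB0 : 0 <= (1 - delta) * B by rewrite mulr_ge0// subr_ge0.
have dBA : (1 - delta) * B <= A.
  have : expR (- A) <= expR (- ((1 - delta) * B)) by exact: le_trans lo2' up2'.
  by rewrite ler_expR lerN2.
have := expR_diff_le dB0 dBA.
have : delta * B <= delta * (L + 1) by rewrite ler_pM2l.
move: lo1 up1 lo2' up2' AB; rewrite -/(pr _ _).
set p := pr (P lam) _; set q := pr Q _ => lo1 up1 lo2' up2' AB dBL diff.
rewrite ler_norml; apply/andP; split; lra.
Qed.

Lemma containment_cvg (xs : seq V) :
  (fun lam => pr (P lam) [set w | forall x, x \in xs -> scaled_model lam w x]) @ +oo -->
  pr Q [set w | forall x, x \in xs -> scaled_crofton w x].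
Proof.
set q := pr Q _; set L := total_l1norm xs; have L0 : 0 <= L := total_l1norm_ge0 xs.
apply/cvgrPdist_le => e e0.
(* With [m > M] and [delta = (L + 1) / m] one gets [delta ((L + 4) / e + 1) < 1], which yields both
   [delta <= 1] and [(L + 4) delta <= e]. *)
pose M := (L + 1) * ((L + 4) / e + 1).
have Le0 : 0 < (L + 4) / e by rewrite divr_gt0//; lra.
have M0 : 0 < M by rewrite mulr_gt0//; lra.
pose m := (Num.truncn M).+1.
have Mm : M < m%:R by exact: truncnS_gt.
have m0 : 0 < m%:R :> R by rewrite ltr0n.
pose delta := (L + 1) / m%:R.
have dl0 : 0 < delta by rewrite divr_gt0//; lra.
have mE : m%:R * delta = L + 1 by rewrite /delta mulrC divfK// gt_eqF.
have dl : delta * ((L + 4) / e + 1) < 1.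
  by rewrite /delta mulrAC ltr_pdivrMr// mul1r.
have dl1 : delta <= 1.
  rewrite (le_trans _ (ltW dl))// ler_peMr ?(ltW dl0)//; lra.
have dle : (L + 4) * delta <= e.
  have : delta * ((L + 4) / e) <= 1 by rewrite (le_trans _ (ltW dl))// ler_pM2l//; lra.
  by rewrite mulrA ler_pdivrMr// mul1r mulrC.
pose K := 2 * (L + 1) + L ^+ 2 / delta + (L + 1) ^+ 2 / delta + d%:R * (L + 1) / delta + L.
near=> lam.
have lam0 : 0 < lam by near: lam; exact: nbhs_pinfty_gt.
rewrite distrC (le_trans _ dle)//; apply: (@containment_close xs delta m) => //.
rewrite -ler_pdivrMl//; near: lam.
Unshelve. all: end_near.
Qed.

End FiniteContainment.

(** * Convergence in law *)

Section FiniteValuedIntegrals.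
Import numFieldNormedType.Exports.
Context {R : realType} dT (T : measurableType dT) (P : probability T R).

(* Both integrals are suprema over the simple functions below the integrand. *)
Lemma ge0_le_integralT (f g : T -> \bar R) : (forall w, (0 <= f w)%E) ->
  (forall w, (f w <= g w)%E) -> (\int[P]_w f w <= \int[P]_w g w)%E.
Proof.
move=> f0 fg; have g0 w : (0 <= g w)%E := le_trans (f0 w) (fg w).
rewrite !ge0_integralTE//; apply: ereal_sup_le => _ [h hf <-].
by exists h => // w; exact: le_trans (hf w) (fg w).
Qed.

Definition mean (I : finType) (W : T -> I) (g : I -> R) : R :=
  \sum_i g i * pr P [set w | W w = i].

Lemma ge0_integral_finfun (I : finType) (W : T -> I) (g : I -> R) :
  (forall i, measurable [set w | W w = i]) -> (forall i, 0 <= g i) ->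
  (\int[P]_w (g (W w))%:E = (mean W g)%:E)%E.
Proof.
move=> mW g0; pose F i := [set w | W w = i].
rewrite (_ : (fun w => (g (W w))%:E) =
  (fun w => (\sum_(i <- index_enum I) (g i)%:E * (\1_(F i) w)%:E)%E)); last first.
  apply/funext => w; rewrite (bigD1 (W w))//= indicE mem_set// mule1 big1 ?adde0// => i iW.
  rewrite indicE memNset ?mule0// => Wi; move: iW.
  by rewrite -Wi eqxx.
rewrite ge0_integral_sum//; last first.
- by move=> i w _; rewrite -EFinM lee_fin mulr_ge0.
- move=> i; apply: measurable_funeM; apply/measurable_EFinP.
  by apply: measurable_indic; exact: mW.
rewrite /mean -sumEFin; apply: eq_bigr => i _.
rewrite ge0_integralZl_EFin//.
- have -> : (\int[P]_x (\1_(F i) x)%:E)%E = P (F i).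
    have -> := integral_indic P measurableT (mW i).
    by rewrite setIT.
  by rewrite (prE P (mW i)) -/(F i) EFinM.
- by apply/measurable_EFinP; apply: measurable_indic; exact: mW.
Qed.

(** Only [W] carries measurability. The integral of [F] is the difference of those of its positive
    and negative parts, and [ge0_le_integralT] compares each with a finite-valued function of
    [W]. *)
Lemma integral_between (I : finType) (W : T -> I) (F : T -> R) (lo hi : I -> R) :
  (forall i, measurable [set w | W w = i]) ->
  (forall w, lo (W w) <= F w <= hi (W w)) ->
  (((mean W lo)%:E <= \int[P]_w (F w)%:E)%E /\
   (\int[P]_w (F w)%:E <= (mean W hi)%:E)%E).
Proof.
move=> mW loF; pose p (x : R) := Num.max x 0; pose n (x : R) := Num.max (- x) 0.
have p0 x : 0 <= p x by rewrite le_max lexx orbT.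
have n0 x : 0 <= n x by rewrite le_max lexx orbT.
have pn x : x = p x - n x.
  rewrite /p /n; case: (leP x 0) => h.
    by rewrite max_l ?oppr_ge0// sub0r opprK.
  by rewrite max_r ?oppr_le0 ?ltW// subr0.
have ple x y : x <= y -> p x <= p y.
  by move=> xy; rewrite /p ge_max !le_max xy lexx orbT.
have nle x y : x <= y -> n y <= n x.
  by move=> xy; rewrite /n ge_max !le_max lerN2 xy lexx orbT.
have meanE g : mean W g = mean W (p \o g) - mean W (n \o g).
  rewrite /mean -sumrB; apply: eq_bigr => i _; rewrite -mulrBl /=.
  by rewrite -pn.
have FE : (\int[P]_w (F w)%:E = \int[P]_w (p (F w))%:E - \int[P]_w (n (F w))%:E)%E.
  rewrite integralE; congr (_ - _)%E; apply: eq_integral => w _.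
    by rewrite funeposE /p EFin_max.
  by rewrite funenegE /n EFin_max EFinN.
rewrite FE (meanE lo) (meanE hi) !EFinB.
have ip g := @ge0_integral_finfun I W (p \o g) mW (fun i => p0 (g i)).
have iN g := @ge0_integral_finfun I W (n \o g) mW (fun i => n0 (g i)).
rewrite -(ip lo) -(ip hi) -(iN lo) -(iN hi); split; apply: leeB; apply: ge0_le_integralT => w;
  rewrite lee_fin//=; have /andP[? ?] := loF w; by [exact: ple|exact: nle].
Qed.

End FiniteValuedIntegrals.

(** * Convergence of pattern laws from containment probabilities *)

Section PatternLaws.
Import numFieldNormedType.Exports.
Context {R : realType}.

Lemma cvg_bigsum_filter (U : Type) (F : set_system U) (FF : Filter F) (I : Type)
    (r : seq I) (p : pred I) (f : I -> U -> R) (l : I -> R) :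
  (forall i, p i -> f i @ F --> l i) ->
  (fun u => \sum_(i <- r | p i) f i u) @ F --> \sum_(i <- r | p i) l i.
Proof.
move=> fl; elim: r => [|i r IH].
  rewrite big_nil (_ : (fun _ => _) = cst 0); first exact: cvg_cst.
  by apply/funext => u; rewrite big_nil.
rewrite big_cons; case: ifPn => pi.
  rewrite (_ : (fun _ => _) = (fun u => f i u + \sum_(j <- r | p j) f j u)).
    by apply: cvgD => //; exact: fl.
  by apply/funext => u; rewrite big_cons pi.
by under eq_fun do rewrite big_cons (negbTE pi).
Qed.

Context (I : finType) dT (T : measurableType dT) (P : R -> probability T R)
  (W : R -> T -> {ffun I -> bool}) dT' (T' : measurableType dT') (Q : probability T' R)
  (W' : T' -> {ffun I -> bool}).
Hypotheses (mW : forall lam, 0 < lam -> forall i, measurable [set w | W lam w i])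
  (mW' : forall i, measurable [set w | W' w i])
  (cvgW : forall s : seq I,
    (fun lam => pr (P lam) [set w | forall i, i \in s -> W lam w i]) @ +oo -->
    pr Q [set w | forall i, i \in s -> W' w i]).

Lemma measurable_pattern dU (U : measurableType dU) (V : U -> {ffun I -> bool}) :
  (forall i, measurable [set w | V w i]) -> forall h, measurable [set w | V w = h].
Proof.
move=> mV h; rewrite (_ : mkset _ = \bigcap_(i in [set: I]) [set w | V w i = h i]).
  apply: fin_bigcap_measurable => // i _; case: (h i); first exact: mV.
  rewrite (_ : mkset _ = ~` [set w | V w i]); first exact: measurableC.
  by apply/seteqP; split => w /=; [move=> ->|move=> /negP/negbTE].
apply/seteqP; split => w /=; first by move=> <-.
by move=> H; apply/ffunP => i; exact: H.
Qed.

Definition pattern_le (g h : {ffun I -> bool}) := [forall i, g i ==> h i].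

(* Moebius inversion over the patterns above [g]. *)
Lemma pr_pattern dU (U : measurableType dU) (S : probability U R)
    (V : U -> {ffun I -> bool}) g : (forall i, measurable [set w | V w i]) ->
  pr S [set w | V w = g] =
  pr S [set w | forall i, i \in enum [pred i | g i] -> V w i] -
  \sum_(h | pattern_le g h && (h != g)) pr S [set w | V w = h].
Proof.
move=> mV; have mF := measurable_pattern mV.
have mA : measurable [set w | forall i, i \in enum [pred i | g i] -> V w i].
  rewrite (_ : mkset _ = [set w | pattern_le g (V w)]).
    exact: (measurable_finfun S (pattern_le g) mF).
  apply/seteqP; split => w /=.
    by move=> H; apply/forallP => i; apply/implyP => gi; apply: H; rewrite mem_enum.
  by move=> /forallP H i; rewrite mem_enum => gi; have /implyP := H i; exact.
have gg : pattern_le g g by apply/forallP => i; apply/implyP.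
suff -> : pr S [set w | forall i, i \in enum [pred i | g i] -> V w i] =
    \sum_(h | pattern_le g h) pr S [set w | V w = h].
  by rewrite (bigD1 g)//= addrK.
rewrite (pr_fiber S mA mF) (bigID (pattern_le g))/= [X in _ + X]big1 ?addr0; last first.
  move=> h /forallPn[i]; rewrite negb_imply => /andP[gi hi].
  rewrite (_ : _ `&` _ = set0) ?pr_set0//; apply/seteqP; split => // w [/= H Vh].
  by have := H i; rewrite Vh (negbTE hi) mem_enum => /(_ gi).
apply: eq_bigr => h gh; congr (pr S _); apply/seteqP; split => w; first by case.
move=> /= Vh; split => // i; rewrite mem_enum Vh => gi.
by have /forallP/(_ i)/implyP := gh; exact.
Qed.

(** Induction on the number of indices where [g] is false: the patterns strictly above [g], which
    enter [pr_pattern], have fewer of them. *)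
Lemma pattern_cvg g :
  (fun lam => pr (P lam) [set w | W lam w = g]) @ +oo --> pr Q [set w | W' w = g].
Proof.
have [k] := ubnP #|[pred i | ~~ g i]|; elim: k g => // k IH g gk.
rewrite (pr_pattern Q g mW').
pose F lam := pr (P lam) [set w | forall i, i \in enum [pred i | g i] -> W lam w i] -
  \sum_(h | pattern_le g h && (h != g)) pr (P lam) [set w | W lam w = h].
have cF : F @ +oo --> pr Q [set w | forall i, i \in enum [pred i | g i] -> W' w i] -
    \sum_(h | pattern_le g h && (h != g)) pr Q [set w | W' w = h].
  apply: cvgB; first exact: cvgW.
  apply: (@cvg_bigsum_filter _ _ _ _ _ _ (fun h lam => pr (P lam) [set w | W lam w = h])) => h.
  move=> /andP[/forallP gh hg]; apply: IH; rewrite -ltnS (leq_trans _ gk)// ltnS.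
  apply: proper_card; apply/properP; split.
    apply/fintype.subsetP => i; rewrite !inE; apply: contra => gi.
    by have /implyP := gh i; exact.
  have [i gi] : exists i, g i != h i.
    by apply/existsP; rewrite -negb_forall; apply: contra hg => /forallP H;
      apply/eqP/ffunP => i; rewrite (eqP (H i)).
  exists i; rewrite !inE; have := gh i; move: gi; by case: (g i); case: (h i).
apply: cvg_trans cF; apply: near_eq_cvg; near=> lam; rewrite /F; apply/esym.
by apply: pr_pattern; apply: mW; near: lam; exact: nbhs_pinfty_gt.
Unshelve. all: end_near.
Qed.

Lemma mean_cvg (g : {ffun I -> bool} -> R) :
  (fun lam => mean (P lam) (W lam) g) @ +oo --> mean Q W' g.
Proof.
apply: (@cvg_bigsum_filter _ _ _ _ _ _ (fun h lam => g h * pr (P lam) [set w | W lam w = h])) => h _.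
by apply: cvgMr; exact: pattern_cvg.
Qed.

End PatternLaws.

Section Convexity.
Import numFieldNormedType.Exports.
Context {R : realType} {d : nat}.
Local Notation V := 'rV[R]_d.
Implicit Types (A B : set V) (x y : V).

Lemma convex_scale (a : R) A : convex_body A -> convex_body (scale a A).
Proof.
move=> cA _ _ c [x Ax <-] [y Ay <-] c01; exists (c *: x + (1 - c) *: y); first exact: cA.
by rewrite scalerDr !scalerA (mulrC a) (mulrC a).
Qed.

Lemma closed_scale (a : R) A : 0 < a -> closed A -> closed (scale a A).
Proof.
move=> a0 clA; rewrite (_ : scale a A = (fun x : V => a^-1 *: x) @^-1` A).
  apply: closed_comp => // x _.
  exact: scaler_continuous.
by apply/seteqP; split => x /(scaleE _ _ a0).
Qed.

Lemma convex_Ball : convex_body (@Ball R d).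
Proof.
move=> x y c; rewrite /Ball /= !enorm_le1 => x1 y1 /andP[c0 c1].
have -> : dotp (c *: x + (1 - c) *: y) (c *: x + (1 - c) *: y) =
    c * dotp x x + (1 - c) * dotp y y - c * (1 - c) * dotp (x - y) (x - y).
  rewrite !(dotpDl, dotpDr, dotpNl, dotpNr, dotpZl, dotpZr) (dotpC y x); ring.
have h : 0 <= c * (1 - c) * dotp (x - y) (x - y).
  by rewrite !mulr_ge0 ?dotp_ge0// subr_ge0.
have h1 : c * dotp x x <= c by rewrite ler_piMr.
have h2 : (1 - c) * dotp y y <= 1 - c by rewrite ler_piMr// subr_ge0.
by lra.
Qed.

Lemma convex_Iset (C : set V) : convex_body (Iset C).
Proof.
move=> x y c [Bx Cx] [By Cy] c01; split; first exact: convex_Ball.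
move=> z Cz; rewrite (_ : _ - z = c *: (x - z) + (1 - c) *: (y - z)).
  by apply: convex_Ball => //; [exact: Cx|exact: Cy].
by rewrite !scalerBr addrACA -opprD -scalerDl (addrC c) subrK scale1r.
Qed.

Lemma closed_Iset (C : set V) : closed (Iset C).
Proof.
rewrite (_ : Iset C = Ball `&` \bigcap_(c in C) [set x | Ball (x - c)]) //.
apply: closedI; first exact: closed_Ball.
apply: closed_bigI => c _; apply: (@closed_comp _ _ (fun x : V => x - c) Ball).
  by move=> x _; apply: continuousB; [move=> ?; exact: cvg_id|exact: cst_continuous].
exact: closed_Ball.
Qed.

Lemma convex_polytope (r : nat -> R) (t : nat -> V) : convex_body (polytope r t).
Proof.
move=> x y c Px Py /andP[c0 c1] n; rewrite dotpDl !dotpZl mulrDr !(mulrCA (Num.sg _)).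
rewrite (_ : 2 * `|r n| = c * (2 * `|r n|) + (1 - c) * (2 * `|r n|)); last by ring.
by rewrite lerD// ler_wpM2l ?subr_ge0.
Qed.

End Convexity.

(** * Oscillation of a test function over convex sets with a given trace *)

Section Oscillation.
Import numFieldNormedType.Exports.
Context {R : realType} {d : nat}.
Local Notation V := 'rV[R]_d.
Variables (f : set V -> R) (M : R).
Hypotheses (fM : forall X, closed X -> `|f X| <= M) (d_gt0 : (0 < d)%N).

Definition pattern n (Z : set V) : {ffun @grid_index d n -> bool} :=
  [ffun k => `[< Z (@grid_point R d n k) >]].

Definition closed_convex (Z : set V) := closed Z /\ convex_body Z.

Definition with_pattern n (h : {ffun @grid_index d n -> bool}) : set (set V) := [set Z | closed_convex Z /\ pattern n Z = h].

Definition hi n (h : {ffun @grid_index d n -> bool}) : R := sup (f @` with_pattern h).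
Definition lo n (h : {ffun @grid_index d n -> bool}) : R := inf (f @` with_pattern h).

Let ubM n (h : {ffun @grid_index d n -> bool}) : ubound (f @` with_pattern h) M.
Proof.
by move=> _ [Z [[clZ _] _] <-]; have := fM clZ; rewrite ler_norml => /andP[].
Qed.

Let lbM n (h : {ffun @grid_index d n -> bool}) : lbound (f @` with_pattern h) (- M).
Proof.
by move=> _ [Z [[clZ _] _] <-]; have := fM clZ; rewrite ler_norml => /andP[].
Qed.

Lemma M_ge0 : 0 <= M.
Proof. exact: le_trans (normr_ge0 _) (fM closed0). Qed.

Lemma lo_le_hi n Z : closed_convex Z -> lo (pattern n Z) <= f Z <= hi (pattern n Z).
Proof.
move=> cZ; apply/andP; split.
  by apply: ge_inf; [exists (- M); exact: lbM|exists Z].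
by apply: ub_le_sup; [exists M; exact: ubM|exists Z].
Qed.

Lemma hi_sub_lo_le2M n (h : {ffun @grid_index d n -> bool}) : hi h - lo h <= 2 * M.
Proof.
rewrite /hi /lo; have [->|/set0P[Z hZ]] := eqVneq (with_pattern h) set0.
  (* A pattern that no closed convex set realizes has [sup] and [inf] equal to the default 0. *)
  by rewrite image_set0 sup0 inf0 subrr mulr_ge0// M_ge0.
have ne : f @` with_pattern h !=set0 by exists (f Z), Z.
have : sup (f @` with_pattern h) <= M by apply: ge_sup => //; exact: ubM.
have : - M <= inf (f @` with_pattern h) by apply: lb_le_inf => //; exact: lbM.
by lra.
Qed.

Lemma oscillation_to0 (Y : set V) (B rho e : R) : dH_bounded_continuous f ->
  closed_convex Y -> 0 < rho -> 0 < e ->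
  (forall x, Y x -> `|x| <= B) -> (forall x, `|x| <= rho -> Y x) ->
  exists N, forall n, (N <= n)%N -> hi (pattern n Y) - lo (pattern n Y) <= e.
Proof.
move=> [_ fc] [clY cY] r0 e0 YB Yr.
have [|delta dl0 fd] := fc Y clY (e / 2); first by rewrite divr_gt0.
have d0 : 0 < d%:R :> R by rewrite ltr0n.
pose eta := delta / 2 / d%:R.
have eta0 : 0 < eta by rewrite !divr_gt0.
have [N NP] := pattern_close d_gt0 cY r0 eta0 YB Yr.
exists N => n Nn.
have fZ Z : with_pattern (pattern n Y) Z -> `|f Y - f Z| < e / 2.
  move=> [[clZ cZ] pZ]; apply: fd => //.
  have ZY (k : @grid_index d n) : Z (@grid_point R d n k) <-> Y (@grid_point R d n k).
    have /ffunP/(_ k) := pZ; rewrite !ffunE => ZYk; split => H; apply/asboolP.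
      by rewrite -ZYk; exact/asboolP.
    by rewrite ZYk; exact/asboolP.
  have [YZ ZY'] := NP n Nn Z cZ ZY.
  have ed : d%:R * eta < delta by rewrite /eta mulrC divfK ?gt_eqF//; lra.
  exact: (dH_lt eta0 ed YZ ZY').
have ne : f @` with_pattern (pattern n Y) !=set0 by exists (f Y), Y.
have : hi (pattern n Y) <= f Y + e / 2.
  apply: ge_sup => // _ [Z /fZ + <-]; rewrite ltr_norml => /andP[? ?]; lra.
have : f Y - e / 2 <= lo (pattern n Y).
  apply: lb_le_inf => // _ [Z /fZ + <-]; rewrite ltr_norml => /andP[? ?]; lra.
by lra.
Qed.

End Oscillation.

(** * Assembly of the convergence in law *)

Section Convergence.
Import numFieldNormedType.Exports.
Context {R : realType} {d : nat}.
Local Notation V := 'rV[R]_d.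
Context dT (T : measurableType dT) (P : R -> probability T R) (C : R -> T -> set V)
  dT' (T' : measurableType dT') (Q : probability T' R)
  (Rn : nat -> T' -> R) (th : nat -> T' -> V).
Hypotheses (d_gt0 : (0 < d)%N)
  (pppC : forall lam : R, 0 < lam -> ppp_ball (P lam) lam (C lam))
  (model : hyperplane_model Q Rn th).

Local Notation X := (scaled_model C).
Local Notation Y := (scaled_crofton Rn th).

Lemma closed_convex_scaled_model lam w : 0 < lam -> closed_convex (X lam w).
Proof.
move=> lam0; split.
  apply: closed_scale; last exact: closed_Iset.
  by rewrite !mulr_gt0 ?ltr0n// (omega_gt0 model).
by apply: convex_scale; exact: convex_Iset.
Qed.

Lemma closed_convex_scaled_crofton w : closed_convex (Y w).
Proof.
have [R0|/existsNP[n /negP]] := pselect (forall n, Rn n w != 0).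
  rewrite scaled_crofton_polytope//; split; first exact: closed_polytope.
  exact: convex_polytope.
rewrite negbK => /eqP Rn0; rewrite (scaled_crofton_set0 _ Rn0); split => //.
exact: closed0.
Qed.

Lemma measurable_pattern_model n lam k : 0 < lam ->
  measurable [set w | pattern n (X lam w) k].
Proof.
move=> lam0; rewrite (_ : mkset _ = [set w | X lam w (@grid_point R d n k)]).
  exact: (measurable_scaled_model d_gt0 pppC model).
by apply/seteqP; split => w /=; rewrite ffunE => /asboolP.
Qed.

Lemma measurable_pattern_crofton n k : measurable [set w | pattern n (Y w) k].
Proof.
rewrite (_ : mkset _ = [set w | Y w (@grid_point R d n k)]).
  exact: (measurable_scaled_crofton model).
by apply/seteqP; split => w /=; rewrite ffunE => /asboolP.
Qed.

Lemma mean_pattern_cvg n g :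
  (fun lam => mean (P lam) (fun w => pattern n (X lam w)) g) @ +oo -->
  mean Q (fun w => pattern n (Y w)) g.
Proof.
apply: mean_cvg => [lam lam0 k|k|s].
- exact: measurable_pattern_model.
- exact: measurable_pattern_crofton.
have E (Z : set V) : (forall k, k \in s -> pattern n Z k) <->
    (forall x, x \in [seq (@grid_point R d n k) | k <- s] -> Z x).
  split => [H _ /mapP[k ks ->]|H k ks].
    by have := H k ks; rewrite ffunE => /asboolP.
  by rewrite ffunE; apply/asboolP/H/map_f.
have eX lam : [set w | forall k, k \in s -> pattern n (X lam w) k] =
    [set w | forall x, x \in [seq (@grid_point R d n k) | k <- s] -> X lam w x].
  by apply/seteqP; split => w /E.
have eY : [set w | forall k, k \in s -> pattern n (Y w) k] =
    [set w | forall x, x \in [seq (@grid_point R d n k) | k <- s] -> Y w x].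
  by apply/seteqP; split => w /E.
rewrite eY; under eq_fun do rewrite eX.
exact: (@containment_cvg _ _ _ _ _ _ _ _ _ _ _ d_gt0 pppC model).
Qed.

(** On the good event the oscillation is eventually at most [e / 2], so the probability that it is
    larger tends to 0. The mean splits accordingly, with the bound [2 M] on the exceptional
    patterns. *)
Lemma mean_oscillation_small (f : set V -> R) (M e : R) :
  (forall X, closed X -> `|f X| <= M) -> dH_bounded_continuous f -> 0 < e ->
  exists n, mean Q (fun w => pattern n (Y w)) (fun h => hi f h - lo f h) <= e.
Proof.
move=> fM fc e0; have [mG G1] := good_full model.
pose osc n (h : {ffun @grid_index d n -> bool}) := hi f h - lo f h.
pose W n w := pattern n (Y w).
have mW n := measurable_pattern (@measurable_pattern_crofton n).
have mosc n : measurable [set w | e / 2 < osc n (W n w)].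
  exact: (measurable_finfun Q (fun h => e / 2 < osc n h) (mW n)).
have e2 : 0 < e / 2 by rewrite divr_gt0.
have [||_ cosc] := @pr_cvg_pointwise _ _ _ Q
    (fun n => [set w | e / 2 < osc n (W n w)] `&` good Rn th) set0.
- by move=> n; exact: measurableI.
- move=> w; have [gw|ngw] := pselect (good Rn th w); last first.
    by exists 0%N => n _; split => // -[].
  have [rho r0 Yr] := polytope_interior d_gt0 gw.
  have [B YB] := polytope_bounded gw.
  have R0 := good_Rn_neq0 gw.
  rewrite -(scaled_crofton_polytope _ R0) in Yr YB.
  have [N NP] := oscillation_to0 d_gt0 fc (closed_convex_scaled_crofton w) r0 e2 YB Yr.
  exists N => n Nn; split => // -[/= + _].
  by rewrite ltNge NP.
rewrite pr_set0 in cosc.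
have M0 : 0 <= M := M_ge0 fM.
(* One is added since [M] may be 0 and the bound is about to be a divisor. *)
have M1 : 0 < 2 * M + 1 by lra.
have /cvgrPdist_le/(_ (e / 2 / (2 * M + 1))) := cosc.
move=> /(_ (divr_gt0 e2 M1))[n _ /(_ n (leqnn n))].
rewrite sub0r normrN ger0_norm ?pr_ge0// pr_setI_full// => posc.
exists n; rewrite /mean (bigID (fun h => e / 2 < osc n h)) /=.
have q0 h : 0 <= pr Q [set w | W n w = h] by exact: pr_ge0.
have lt1 : \sum_(h | e / 2 < osc n h) osc n h * pr Q [set w | W n w = h] <= e / 2.
  apply: (@le_trans _ _ (\sum_(h | e / 2 < osc n h) (2 * M + 1) * pr Q [set w | W n w = h])).
    apply: ler_sum => h _; rewrite ler_wpM2r//.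
    by rewrite (le_trans (hi_sub_lo_le2M fM _))// lerDl.
  rewrite -mulr_sumr -(pr_finfun Q (fun h => e / 2 < osc n h) (mW n)).
  by rewrite mulrC -ler_pdivlMr.
have lt2 : \sum_(h | ~~ (e / 2 < osc n h)) osc n h * pr Q [set w | W n w = h] <= e / 2.
  apply: (@le_trans _ _ (\sum_(h | ~~ (e / 2 < osc n h)) e / 2 * pr Q [set w | W n w = h])).
    by apply: ler_sum => h; rewrite -leNgt => osch; rewrite ler_wpM2r.
  rewrite -mulr_sumr -(pr_finfun Q (fun h => ~~ (e / 2 < osc n h)) (mW n)).
  rewrite ler_piMr ?(ltW e2)// pr_le1//.
  exact: (measurable_finfun Q (fun h => ~~ (e / 2 < osc n h)) (mW n)).
by have := lerD lt1 lt2; rewrite -splitr.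
Qed.

(** Fix [n] with mean oscillation of the limit at most [e / 3], then let [lam] grow until the means
    of [lo] and [hi] are within [e / 3] of their limits. Both integrals lie between the respective
    means of [lo] and [hi]. *)
Lemma scaled_model_cvg_dist : cvg_dist_dH P X Q Y.
Proof.
move=> f fc; have [[M fM] _] := fc.
pose WX n lam w := pattern n (X lam w); pose WY n w := pattern n (Y w).
have bX n lam : 0 < lam ->
    ((mean (P lam) (WX n lam) (lo f (n := n)))%:E <= \int[P lam]_w (f (X lam w))%:E)%E /\
    (\int[P lam]_w (f (X lam w))%:E <= (mean (P lam) (WX n lam) (hi f (n := n)))%:E)%E.
  move=> lam0; apply: (integral_between (P lam) (W := WX n lam)) => [h|w].
    by apply: measurable_pattern => k; exact: measurable_pattern_model.
  by apply: (lo_le_hi fM); exact: closed_convex_scaled_model.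
have bY n :
    ((mean Q (WY n) (lo f (n := n)))%:E <= \int[Q]_w (f (Y w))%:E)%E /\
    (\int[Q]_w (f (Y w))%:E <= (mean Q (WY n) (hi f (n := n)))%:E)%E.
  apply: (integral_between Q (W := WY n)) => [h|w].
    by apply: measurable_pattern => k; exact: measurable_pattern_crofton.
  by apply: (lo_le_hi fM); exact: closed_convex_scaled_crofton.
have fin_between (a b : R) (x : \bar R) : (a%:E <= x)%E -> (x <= b%:E)%E -> x \is a fin_num.
  by case: x.
have fX lam : 0 < lam -> (\int[P lam]_w (f (X lam w))%:E)%E \is a fin_num.
  by move=> lam0; have [h1 h2] := bX 0%N lam lam0; exact: fin_between h1 h2.
have fY : (\int[Q]_w (f (Y w))%:E)%E \is a fin_num.
  by have [h1 h2] := bY 0%N; exact: fin_between h1 h2.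
rewrite -(fineK fY); apply: cvg_EFin.
  by near=> lam; apply: fX; near: lam; exact: nbhs_pinfty_gt.
apply/cvgrPdist_le => e e0.
have e3 : 0 < e / 3 by rewrite divr_gt0.
have [n nosc] := mean_oscillation_small fM fc e3.
have /cvgrPdist_le/(_ _ e3) clo := @mean_pattern_cvg n (lo f (n := n)).
have /cvgrPdist_le/(_ _ e3) chi := @mean_pattern_cvg n (hi f (n := n)).
near=> lam.
have lam0 : 0 < lam by near: lam; exact: nbhs_pinfty_gt.
have := bX n lam lam0; rewrite -(fineK (fX lam lam0)) !lee_fin => -[x1 x2].
have := bY n; rewrite -(fineK fY) !lee_fin => -[y1 y2].
have l1 : `|mean Q (WY n) (lo f (n := n)) - mean (P lam) (WX n lam) (lo f (n := n))| <= e / 3.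
  by near: lam.
have h1 : `|mean Q (WY n) (hi f (n := n)) - mean (P lam) (WX n lam) (hi f (n := n))| <= e / 3.
  by near: lam.
have oscE : mean Q (WY n) (fun h => hi f h - lo f h) =
    mean Q (WY n) (hi f (n := n)) - mean Q (WY n) (lo f (n := n)).
  by rewrite /mean -sumrB; apply: eq_bigr => h _; rewrite mulrBl.
rewrite -/(WY n) oscE in nosc.
move: l1 h1; rewrite !ler_norml => /andP[? ?] /andP[? ?] /=.
by apply/andP; split; lra.
Unshelve. all: end_near.
Qed.

End Convergence.


Unset Implicit Arguments. Set Strict Implicit. Set Printing Implicit Defensive.

Theorem mainTheorem1 (R : realType) (d : nat)
    (dT : measure_display) (T : measurableType dT)
    (P : R -> probability T R) (C : R -> T -> set 'rV[R]_d)
    (dT' : measure_display) (T' : measurableType dT')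
    (Q : probability T' R) (Rn : nat -> T' -> R) (th : nat -> T' -> 'rV[R]_d) :
  (2 <= d)%N ->
  (forall lam : R, 0 < lam -> ppp_ball (P lam) lam (C lam)) ->
  hyperplane_model Q Rn th ->
  cvg_dist_dH P (fun lam w => scale (@Sd R d * lam) (Iset (C lam w)))
    Q (fun w => scale 2 (crofton (fun n => Rn n w) (fun n => th n w))).
Proof.
move=> d2 pppC model.
exact: (scaled_model_cvg_dist (ltnW d2) pppC model).
Qed.
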